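(* The backward Euler fully discrete weak Galerkin scheme has a unique solution: for $n=1,2,\dots,N$ there are unique $(\bm\sigma_h^n,\bm v_h^n)=(\bm\sigma_h^n,\{\bm v_{h0}^n,\bm v_{hb}^n\})\in\Sigma_h\times V_h^0$ such that, with $\bm\sigma_h^0=Q_k^0\psi_0$, $$a_h\Big(\frac{\bm\sigma_h^n-\bm\sigma_h^{n-1}}{\Delta t},\bm\tau_h\Big)+a_h(\bm\sigma_h^n,\bm\tau_h)-b_h(\bm\tau_h,\bm v_h^n)=0\quad\forall\bm\tau_h\in\Sigma_h,$$ $$b_h(\bm\sigma_h^n,\bm w_h)+s_h(\bm v_h^n,\bm w_h)=(\bm f^n,\bm w_{h0})\quad\forall\bm w_h=\{\bm w_{h0},\bm w_{hb}\}\in V_h^0 .$$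
   Context: $\Omega\subset\mathbb R^d$ ($d=2,3$) is a convex polyhedral domain, $T>0$, $\bm f\in H^1(0,T;[L^2(\Omega)]^d)$ and $\psi_0\in\bm L^2(\Omega,S)$, where $\bm L^2(\Omega,S)$ is the space of symmetric $d\times d$ tensor fields with entries in $L^2(\Omega)$. $N$ is a positive integer, $\Delta t=T/N$, $t_n=n\Delta t$, $\bm f^n=\bm f(t_n)$. $\mathbb C$ is an elastic module (elasticity) tensor on $\Omega$, in the usual sense of linear elasticity, with $M_0\,\bm\tau:\bm\tau\le\mathbb C^{-1}\bm\tau:\bm\tau\le M_1\,\bm\tau:\bm\tau$ for all symmetric tensors $\bm\tau$ and a.e. $x\in\Omega$, for some constants $M_0,M_1>0$. $(\cdot,\cdot)_D$ is the $L^2(D)$ inner product, written $\langle\cdot,\cdot\rangle_D$ if $D$ is $(d-1)$-dimensional, and $(\cdot,\cdot)=(\cdot,\cdot)_\Omega$. Mesh: $\mathscr T_h$ is a decomposition of $\Omega$ into polygons/polyhedra $K$ of diameter $h_K$, shape-regular in the following sense: (A1) there is a constant $\theta_*>0$ such that each $K$ is star-shaped with respect to every point of some ball of radius $\theta_*h_K$ centered at a point $M_K\in K$; (A2) there is a constant $l_*>0$ such that the distance between any two vertices of each $K$ is at least $l_*h_K$. $\mathcal E_h$ is the set of all edges/faces $E$ of elements, $h_E$ the diameter of $E$, $h=\max_Kh_K$. Spaces: $k\ge1$ is an integer, $P_j(D)$ the polynomials of degree at most $j$ on $D$. $\Sigma_h=\{\bm\tau_h\in\bm L^2(\Omega,S):\bm\tau_h|_K\in[P_k(K)]^{d\times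 d}\ \forall K\in\mathscr T_h\}$. $V_h=\{\bm v_h=\{\bm v_{h0},\bm v_{hb}\}:\bm v_{h0}|_K\in[P_{k+1}(K)]^d,\ \bm v_{hb}|_E\in[P_k(E)]^d\ \forall K\in\mathscr T_h,E\in\mathcal E_h\}$ ($\bm v_{hb}$ is single-valued on each $E$), $V_h^0=\{\bm v_h\in V_h:\bm v_{hb}|_{\partial\Omega}=0\}$. $Q_j^0:L^2(K)\to P_j(K)$ and $Q_j^b:L^2(E)\to P_j(E)$ are the $L^2$ projections, applied elementwise/facewise and componentwise to vectors and tensors. Discrete weak gradient: for a scalar pair $v=\{v_0,v_b\}$, $\nabla_{w,k}v|_K\in[P_k(K)]^d$ is defined by $(\nabla_{w,k}v,\bm q)_K=-(v_0,\nabla\cdot\bm q)_K+\langle v_b,\bm q\cdot\mathbf n_K\rangle_{\partial K}$ for all $\bm q\in[P_k(K)]^d$, with $\mathbf n_K$ the unit outward normal; for vectors it acts on each component (rows). $\bm\varepsilon_{w,k}(\bm w_h)=(\nabla_{w,k}\bm w_h+(\nabla_{w,k}\bm w_h)^T)/2$. Forms: $a_h(\bm\sigma_h,\bm\tau_h)=(\mathbb C^{-1}\bm\sigma_h,\bm\tau_h)$, $b_h(\bm\tau_h,\bm w_h)=(\bm\varepsilon_{w,k}(\bm w_h),\bm\tau_h)$, $s_h(\bm v_h,\bm w_h)=\langle\alpha(Q_k^b\bm v_{h0}-\bm v_{hb}),Q_k^b\bm w_{h0}-\bm w_{hb}\rangle_{\partial\mathscr T_h}$, with $\langle\cdot,\cdot\rangle_{\partial\mathscr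 T_h}=\sum_{K\in\mathscr T_h}\langle\cdot,\cdot\rangle_{\partial K}$ and $\alpha|_E=h_E^{-1}$. *)

(* Defs.v *)
From HB Require Import structures.
From mathcomp Require Import all_boot all_order all_algebra.
(* The notations of mpoly clash with those of MathComp-Analysis. *)
From mathcomp Require Import -(notations) mpoly.
From mathcomp Require Import all_classical all_reals all_analysis.

Set Implicit Arguments.
Unset Strict Implicit.
Unset Printing Implicit Defensive.

Import Order.TTheory GRing.Theory Num.Theory.
Import numFieldNormedType.Exports.

Local Open Scope classical_set_scope.
Local Open Scope ring_scope.

Definition rV_display : measure_display.
Proof. exact: default_measure_display. Qed.

Section rV_measurable.
Context {R : realType} {n : nat}.

Definition rV_coord (i : 'I_n) (x : 'rV[R]_n) : measurableTypeR R := x 0 i.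

Let rV_set0 : g_sigma_preimage rV_coord set0.
Proof. exact: sigma_algebra0. Qed.

Let rV_setC A : g_sigma_preimage rV_coord A -> g_sigma_preimage rV_coord (~` A).
Proof. exact: sigma_algebraC. Qed.

Let rV_bigcup (F : _^nat) : (forall i, g_sigma_preimage rV_coord (F i)) ->
  g_sigma_preimage rV_coord (\bigcup_i (F i)).
Proof. exact: sigma_algebra_bigcup. Qed.

(* The sigma-algebra generated by the coordinates, i.e. the Borel sets. *)
HB.instance Definition _ := @isMeasurable.Build rV_display
  'rV[R]_n (g_sigma_preimage rV_coord) rV_set0 rV_setC rV_bigcup.

Lemma measurable_rV_coord (i : 'I_n) : measurable_fun setT (rV_coord i).
Proof.
move=> _ Y mY; rewrite setTI; apply: sub_sigma_algebra => /=.
rewrite -bigcup_seq/=; exists i => /=; first by rewrite mem_index_enum.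
by exists Y => //; rewrite setTI.
Qed.

Lemma measurable_fun_rV d (T : measurableType d) (f : T -> 'rV[R]_n) :
  (forall i, measurable_fun setT (fun x => rV_coord i (f x))) ->
  measurable_fun setT f.
Proof.
move=> mf; suff : g_sigma_preimage (fun i => rV_coord i \o f) `<=` measurable.
  rewrite g_sigma_preimage_comp => prefS _ A mA.
  by apply: prefS; exists A.
apply: smallest_sub; first exact: sigma_algebra_measurable.
rewrite -bigcup_seq; apply: bigcup_sub => i _ A [B mB <-].
exact: mf.
Qed.

End rV_measurable.

Section lebesgue_rV_step.
Context {R : realType} {n : nat}.
Variable mu : {sigma_finite_measure set 'rV[R]_n -> \bar R}.

Definition rV_cons (p : measurableTypeR R * 'rV[R]_n) : 'rV[R]_n.+1 :=
  row_mx (const_mx p.1 : 'rV_1) p.2.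

Definition rV_uncons (x : 'rV[R]_n.+1) : measurableTypeR R * 'rV[R]_n :=
  (x 0 ord0, \row_i x 0 (lift ord0 i)).

Lemma rV_cons0 p : rV_cons p 0 ord0 = p.1.
Proof.
transitivity (row_mx (const_mx p.1 : 'rV_1) p.2 0 (lshift n 0)).
  by congr (fun_of_matrix _ _ _); exact/val_inj.
by rewrite row_mxEl mxE.
Qed.

Lemma rV_consS p i : rV_cons p 0 (lift ord0 i) = p.2 0 i.
Proof.
transitivity (row_mx (const_mx p.1 : 'rV_1) p.2 0 (rshift 1 i)).
  by congr (fun_of_matrix _ _ _); exact/val_inj.
by rewrite row_mxEr.
Qed.

Lemma rV_consK : cancel rV_cons rV_uncons.
Proof.
move=> [a x]; rewrite /rV_uncons rV_cons0; congr pair.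
by apply/rowP => i; rewrite mxE rV_consS.
Qed.

Lemma rV_unconsK : cancel rV_uncons rV_cons.
Proof.
move=> x; apply/rowP => i; case: (unliftP ord0 i) => [j|] ->.
  by rewrite rV_consS mxE.
by rewrite rV_cons0.
Qed.

Lemma measurable_rV_cons : measurable_fun setT rV_cons.
Proof.
apply: measurable_fun_rV => i; case: (unliftP ord0 i) => [j|] ->.
- apply: (eq_measurable_fun (rV_coord j \o snd)).
    by move=> p _; rewrite /rV_coord rV_consS.
  by apply: measurableT_comp; [exact: measurable_rV_coord|exact: measurable_snd].
- apply: (eq_measurable_fun fst); last exact: measurable_fst.
  by move=> p _; rewrite /rV_coord rV_cons0.
Qed.

Lemma measurable_rV_uncons : measurable_fun setT rV_uncons.
Proof.
apply/measurable_fun_pairP; split; first exact: measurable_rV_coord.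
apply: measurable_fun_rV => i.
apply: (eq_measurable_fun (rV_coord (lift ord0 i))).
  by move=> x _; rewrite /rV_coord /= mxE.
exact: measurable_rV_coord.
Qed.

Definition lebesgue_rV_step : set 'rV[R]_n.+1 -> \bar R :=
  pushforward ((@lebesgue_measure R) \x mu)%E rV_cons.

Let step0 : lebesgue_rV_step set0 = 0%E.
Proof. by rewrite /lebesgue_rV_step /pushforward preimage_set0 measure0. Qed.

Let step_ge0 A : (0 <= lebesgue_rV_step A)%E.
Proof. by rewrite /lebesgue_rV_step /pushforward measure_ge0. Qed.

Let step_sigma_additive : semi_sigma_additive lebesgue_rV_step.
Proof.
move=> F mF tF mUF; rewrite /lebesgue_rV_step /pushforward preimage_bigcup.
apply: measure_semi_sigma_additive.
- by move=> k; rewrite -[X in measurable X]setTI; exact: measurable_rV_cons.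
- apply/trivIsetP => /= i j _ _ ij; rewrite -preimage_setI.
  by move/trivIsetP : tF => /(_ _ _ _ _ ij) ->//; rewrite preimage_set0.
- rewrite -preimage_bigcup -[X in measurable X]setTI.
  exact: measurable_rV_cons.
Qed.

HB.instance Definition _ := isMeasure.Build _ _ _
  lebesgue_rV_step step0 step_ge0 step_sigma_additive.

(* The canonical sigma-finite structure on \x of the library is shadowed by a
   later instance, hence the direct proof. *)
Let step_sigma_finite : sigma_finite setT lebesgue_rV_step.
Proof.
have /sigma_finiteP[F [TF ndF Foo]] := sigma_finiteT (@lebesgue_measure R).
have /sigma_finiteP[G [TG ndG Goo]] := sigma_finiteT mu.
exists (fun k => rV_uncons @^-1` (F k `*` G k)).
  rewrite -preimage_bigcup (_ : \bigcup_k _ = setT) ?preimage_setT//.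
  rewrite -setXTT TF TG predeqE => -[x y]; split.
    by move=> [k _ []/= ? ?]; split; exists k.
  move=> [/= [k _ Fkx] [l _ Gly]]; exists (maxn k l) => //; split.
  - by move: x Fkx; exact/subsetPset/ndF/leq_maxl.
  - by move: y Gly; exact/subsetPset/ndG/leq_maxr.
move=> k; have [mF Fk] := Foo k; have [mG Gk] := Goo k; split.
  rewrite -[X in measurable X]setTI; apply: measurable_rV_uncons => //.
  exact: measurableX.
rewrite /lebesgue_rV_step /pushforward -comp_preimage.
rewrite (_ : rV_uncons \o rV_cons = id); last first.
  by apply/funext => x /=; rewrite rV_consK.
by rewrite /= product_measure1E// lte_mul_pinfty// ge0_fin_numE.
Qed.

HB.instance Definition _ := Measure_isSigmaFinite.Build _ _ _
  lebesgue_rV_step step_sigma_finite.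

End lebesgue_rV_step.

Fixpoint lebesgue_rV (R : realType) (n : nat) :
    {sigma_finite_measure set 'rV[R]_n -> \bar R} :=
  match n with
  | 0%N => dirac (0 : 'rV[R]_0)
  | m.+1 => lebesgue_rV_step (lebesgue_rV R m)
  end.

Section geometry.
Context {R : realType}.
Implicit Types n d : nat.

Definition dotp n (x y : 'rV[R]_n) : R := \sum_i x 0 i * y 0 i.

(* The library norm of 'rV[R]_n is the sup norm; lengths are Euclidean here. *)
Definition enorm n (x : 'rV[R]_n) : R := Num.sqrt (dotp x x).

Definition diam n (A : set 'rV[R]_n) : R :=
  sup [set enorm (x - y) | x in A & y in A].

Definition convex_polyhedral_domain n (Om : set 'rV[R]_n) : Prop :=
  [/\ Om !=set0, bounded_set Om &
      exists H : seq ('rV[R]_n * R),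
        Om = [set x | forall h, h \in H -> dotp h.1 x < h.2]].

Definition closed_polyhedron n (H : seq ('rV[R]_n * R)) : set 'rV[R]_n :=
  [set x | forall h, h \in H -> dotp h.1 x <= h.2].

(* Closed, possibly nonconvex, n-dimensional polytopes: finite unions of
   full-dimensional convex ones whose interior is connected. *)
Definition polytope n (P : set 'rV[R]_n) : Prop :=
  [/\ P !=set0, bounded_set P, connected (interior P) &
      exists2 Hs : seq (seq ('rV[R]_n * R)),
        (forall H, H \in Hs -> interior (closed_polyhedron H) !=set0) &
        P = [set x | exists2 H, H \in Hs & closed_polyhedron H x]].

(* A vertex is a point near which P is not invariant along any direction. *)
Definition vertices n (P : set 'rV[R]_n) : set 'rV[R]_n :=
  [set x | P x /\ forall e : 'rV[R]_n, e != 0 ->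
    ~ exists2 r : R, 0 < r & forall (y : 'rV[R]_n) (t : R),
        enorm (y - x) < r -> enorm (y + t *: e - x) < r ->
        (P y <-> P (y + t *: e))].

Definition boundary n (A : set 'rV[R]_n) : set 'rV[R]_n :=
  closure A `\` interior A.

Definition star_shaped_wrt n (A : set 'rV[R]_n) (y : 'rV[R]_n) : Prop :=
  A y /\ forall x (t : R), A x -> 0 <= t -> t <= 1 -> A (t *: x + (1 - t) *: y).

(* A flat (d-1)-dimensional piece of R^d: the image of a polytope of R^(d-1)
   under an affine isometry. *)
Record flat_face d := FlatFace {
  face_origin : 'rV[R]_d;
  face_frame : 'M[R]_(d.-1, d);
  face_dom : set 'rV[R]_(d.-1) }.

Definition face_chart d (E : flat_face d) (u : 'rV[R]_(d.-1)) : 'rV[R]_d :=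
  face_origin E + u *m face_frame E.

Definition face_set d (E : flat_face d) : set 'rV[R]_d :=
  face_chart E @` face_dom E.

Definition face_relint d (E : flat_face d) : set 'rV[R]_d :=
  face_chart E @` interior (face_dom E).

Definition wf_face d (E : flat_face d) : Prop :=
  face_frame E *m (face_frame E)^T = 1%:M /\ polytope (face_dom E).

Definition outward_normal d (K : set 'rV[R]_d) (E : flat_face d)
    (nu : 'rV[R]_d) : Prop :=
  [/\ enorm nu = 1, face_frame E *m nu^T = 0 &
      forall x, face_relint E x -> exists2 r : R, 0 < r &
        forall t : R, 0 < t -> t < r -> K (x - t *: nu) /\ ~ K (x + t *: nu)].

End geometry.

Section mesh.
Context {R : realType} {d : nat}.

Record mesh := Mesh {
  cell : finType;
  face : finType;
  cell_set : cell -> set 'rV[R]_d;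
  face_geo : face -> @flat_face R d;
  normal : cell -> face -> 'rV[R]_d }.

Variable M : mesh.
Implicit Types (K : cell M) (E : face M).

Definition face_of K E : bool :=
  `[< face_set (face_geo E) `<=` boundary (cell_set K) >].

(* Each boundary of a cell is exactly tiled by faces of the mesh, so that a
   hanging node splits the face it lies on. *)
Definition is_decomposition (Om : set 'rV[R]_d) : Prop :=
  (forall K, polytope (cell_set K)) /\
  (forall E, wf_face (face_geo E)) /\
  closure Om = \bigcup_(K in [set: cell M]) cell_set K /\
  (forall K K', K != K' ->
     interior (cell_set K) `&` interior (cell_set K') = set0) /\
  (forall E, exists K, face_of K E) /\
  (forall K, boundary (cell_set K) =
     [set x | exists2 E, face_of K E & face_set (face_geo E) x]) /\
  (forall E E', E != E' ->
     face_relint (face_geo E) `&` face_relint (face_geo E') = set0) /\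
  (forall K E, face_of K E ->
     outward_normal (cell_set K) (face_geo E) (normal K E)).

(* Cells are closed sets; elementwise integrals are over their interiors, which
   are contained in Om. *)
Definition cell_int K : set 'rV[R]_d := interior (cell_set K).

Definition boundary_face (Om : set 'rV[R]_d) E : Prop :=
  face_set (face_geo E) `<=` boundary Om.

Definition diam_cell K : R := diam (cell_set K).
Definition diam_face E : R := diam (face_set (face_geo E)).

Definition cell_vertices K : set 'rV[R]_d :=
  [set x | exists2 E, face_of K E &
    (face_chart (face_geo E) @` vertices (face_dom (face_geo E))) x].

Definition uniformly_star_shaped (theta : R) : Prop :=
  forall K, exists2 x, cell_set K x &
    forall y, enorm (y - x) < theta * diam_cell K ->
      star_shaped_wrt (cell_set K) y.

Definition separated_vertices (l : R) : Prop :=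
  forall K x y, cell_vertices K x -> cell_vertices K y -> x != y ->
    l * diam_cell K <= enorm (x - y).

Definition shape_regular (theta l : R) : Prop :=
  uniformly_star_shaped theta /\ separated_vertices l.

End mesh.
Arguments mesh : clear implicits.

Section polynomials.
Context {R : realType}.
Implicit Types n j : nat.

Definition pev n (p : mpoly n R) (x : 'rV[R]_n) : R :=
  meval (fun i => x 0 i) p.

(* mmeasure mdeg p is one plus the total degree of p, and 0 for p = 0. *)
Definition deg_le n j (p : mpoly n R) : Prop := (mmeasure mdeg p <= j.+1)%N.

Definition L2 n (D : set 'rV[R]_n) (g : 'rV[R]_n -> R) : Prop :=
  measurable_fun D g /\
  (\int[lebesgue_rV R n]_(x in D) ((g x) ^+ 2)%:E < +oo)%E.

Definition ip n (D : set 'rV[R]_n) (f g : 'rV[R]_n -> R) : R :=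
  \int[lebesgue_rV R n]_(x in D) (f x * g x).

Definition L2proj n (D : set 'rV[R]_n) j (g : 'rV[R]_n -> R) : mpoly n R :=
  xget 0 [set p | deg_le j p /\
    forall q, deg_le j q -> ip D (pev p) (pev q) = ip D g (pev q)].

Definition divergence n (q : 'rV[mpoly n R]_n) : mpoly n R :=
  \sum_i mderiv i (q 0 i).

Definition pevmx n m1 m2 (A : 'M[mpoly n R]_(m1, m2)) (x : 'rV[R]_n) :
  'M[R]_(m1, m2) := map_mx (fun p => pev p x) A.

End polynomials.

Section tensors.
Context {R : realType} {d : nat}.

Definition frob (A B : 'M[R]_d) : R := \sum_i \sum_j A i j * B i j.

Definition symm (A : 'M[R]_d) : Prop := A^T = A.

Definition tensor4_field :=
  'rV[R]_d -> 'I_d -> 'I_d -> 'I_d -> 'I_d -> R.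

Definition tapp (C : tensor4_field) (x : 'rV[R]_d) (A : 'M[R]_d) : 'M[R]_d :=
  \matrix_(i, j) \sum_k \sum_l C x i j k l * A k l.

Definition measurable_tensor4 (Om : set 'rV[R]_d) (C : tensor4_field) : Prop :=
  forall i j k l, measurable_fun Om (fun x => C x i j k l).

Definition elasticity_tensor (Om : set 'rV[R]_d) (C : tensor4_field) : Prop :=
  measurable_tensor4 Om C /\
  {ae lebesgue_rV R d, forall x, Om x ->
    [/\ forall i j k l, C x i j k l = C x j i k l,
        forall i j k l, C x i j k l = C x k l i j &
        forall A, symm A -> A != 0 -> 0 < frob (tapp C x A) A]}.

(* Ci x is the inverse of C x on symmetric tensors. *)
Definition inverse_tensor (Om : set 'rV[R]_d) (C Ci : tensor4_field) : Prop :=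
  measurable_tensor4 Om Ci /\
  {ae lebesgue_rV R d, forall x, Om x -> forall A, symm A ->
    [/\ symm (tapp Ci x A), tapp C x (tapp Ci x A) = A &
        tapp Ci x (tapp C x A) = A]}.

Definition L2_sym (Om : set 'rV[R]_d) (psi : 'rV[R]_d -> 'M[R]_d) : Prop :=
  (forall i j, L2 Om (fun x => psi x i j)) /\
  {ae lebesgue_rV R d, forall x, Om x -> symm (psi x)}.

End tensors.
Arguments tensor4_field : clear implicits.

Section bochner.
Context {R : realType} {d : nat}.
Variables (T : R) (Om : set 'rV[R]_d).

(* L^2(0, T; [L^2(Om)]^d), identified with [L^2((0, T) x Om)]^d *)
Definition L2_L2 (f : R -> 'rV[R]_d -> 'rV[R]_d) : Prop :=
  forall i,
    measurable_fun (`]0, T[ `*` Om) (fun p : R * 'rV[R]_d => f p.1 p.2 0 i) /\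
    (\int[@lebesgue_measure R]_(t in `]0%R, T[)
       \int[lebesgue_rV R d]_(x in Om) ((f t x 0 i) ^+ 2)%:E < +oo)%E.

Definition test_function (phi : R -> R) : Prop :=
  (forall n t, derivable (derive1n n phi) t 1) /\
  exists a b, [/\ 0 < a, b < T & forall t, ~ (a <= t /\ t <= b) -> phi t = 0].

Definition weak_time_derivative (f g : R -> 'rV[R]_d -> 'rV[R]_d) : Prop :=
  forall phi, test_function phi -> forall i,
    {ae lebesgue_rV R d, forall x, Om x ->
      \int[@lebesgue_measure R]_(t in `]0%R, T[) (f t x 0 i * derive1 phi t) =
      - \int[@lebesgue_measure R]_(t in `]0%R, T[) (g t x 0 i * phi t)}.

Definition continuous_in_L2 (f : R -> 'rV[R]_d -> 'rV[R]_d) : Prop :=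
  (forall t, 0 <= t -> t <= T -> forall i, L2 Om (fun x => f t x 0 i)) /\
  forall t, 0 <= t -> t <= T -> forall e : R, 0 < e ->
    exists2 dl : R, 0 < dl & forall s, 0 <= s -> s <= T -> `|s - t| < dl ->
      (\int[lebesgue_rV R d]_(x in Om)
         (dotp (f s x - f t x) (f s x - f t x))%:E < e%:E)%E.

(* Point values in time refer to the continuous representative. *)
Definition H1_L2 (f : R -> 'rV[R]_d -> 'rV[R]_d) : Prop :=
  [/\ L2_L2 f, exists2 g, L2_L2 g & weak_time_derivative f g &
      continuous_in_L2 f].

End bochner.

Section weak_galerkin.
Context {R : realType} {d : nat}.
Variables (Om : set 'rV[R]_d) (M : mesh R d) (k : nat).
Implicit Types (K : cell M) (E : face M).

(* An element of P_j(K) is a polynomial in the d coordinates, and one of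
   P_j(E) is a polynomial in the d-1 coordinates of the isometric chart of E. *)
Definition broken_tensor := {ffun cell M -> 'M[mpoly d R]_d}.
Definition weak_vector :=
  ({ffun cell M -> 'rV[mpoly d R]_d} * {ffun face M -> 'rV[mpoly d.-1 R]_(d)})%type.

Definition Sigma_h (tau : broken_tensor) : Prop :=
  forall K, (tau K)^T = tau K /\ forall i j, deg_le k (tau K i j).

Definition V_h (v : weak_vector) : Prop :=
  (forall K i, deg_le k.+1 (v.1 K 0 i)) /\ (forall E i, deg_le k (v.2 E 0 i)).

Definition V_h0 (v : weak_vector) : Prop :=
  V_h v /\ forall E, boundary_face Om E -> v.2 E = 0.

(* Equal to u K on the interior of each K; the value 0 on the union of the
   cell boundaries is irrelevant, this set being negligible. *)
Definition glue (V : nmodType) (u : cell M -> 'rV[R]_d -> V) (x : 'rV[R]_d) : V :=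
  \sum_(K | x \in cell_int K) u K x.

Definition tensor_fun (tau : broken_tensor) : 'rV[R]_d -> 'M[R]_d :=
  glue (fun K => pevmx (tau K)).

Definition interior_fun (w : weak_vector) : 'rV[R]_d -> 'rV[R]_d :=
  glue (fun K => pevmx (w.1 K)).

Definition face_ip E (f g : 'rV[R]_(d.-1) -> R) : R :=
  ip (face_dom (face_geo E)) f g.

Definition face_trace E (V : Type) (g : 'rV[R]_d -> V) : 'rV[R]_(d.-1) -> V :=
  g \o face_chart (face_geo E).

Definition weak_gradient (v0 : cell M -> mpoly d R) (vb : face M -> mpoly d.-1 R)
    K : 'rV[mpoly d R]_d :=
  xget (0 : 'rV[mpoly d R]_d) [set G : 'rV[mpoly d R]_d | (forall i, deg_le k (G 0 i)) /\
    forall q : 'rV[mpoly d R]_d, (forall i, deg_le k (q 0 i)) ->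
      \sum_i ip (cell_int K) (pev (G 0 i)) (pev (q 0 i)) =
      - ip (cell_int K) (pev (v0 K)) (pev (divergence q)) +
      \sum_(E | face_of K E)
        face_ip E (pev (vb E))
          (face_trace E (fun x => dotp (pevmx q x) (normal K E)))].

Definition weak_gradient_vec (w : weak_vector) K : 'M[mpoly d R]_d :=
  \matrix_(i, j)
    weak_gradient (fun K => w.1 K 0 i) (fun E => w.2 E 0 i) K 0 j.

Definition weak_strain (w : weak_vector) : 'rV[R]_d -> 'M[R]_d :=
  glue (fun K x => let G := pevmx (weak_gradient_vec w K) x in
                   2^-1 *: (G + G^T)).

Definition Qk0 (psi : 'rV[R]_d -> 'M[R]_d) : broken_tensor :=
  [ffun K => \matrix_(i, j) L2proj (cell_int K) k (fun x => psi x i j)].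

Definition Qkb E (g : 'rV[R]_d -> 'rV[R]_d) : 'rV[mpoly d.-1 R]_d :=
  \row_i L2proj (face_dom (face_geo E)) k (face_trace E (fun x => g x 0 i)).

Definition ip_tensor (A B : 'rV[R]_d -> 'M[R]_d) : R :=
  \int[lebesgue_rV R d]_(x in Om) frob (A x) (B x).

Definition ip_vector (f g : 'rV[R]_d -> 'rV[R]_d) : R :=
  \int[lebesgue_rV R d]_(x in Om) dotp (f x) (g x).

Definition a_h (Ci : tensor4_field R d) (sigma tau : 'rV[R]_d -> 'M[R]_d) : R :=
  ip_tensor (fun x => tapp Ci x (sigma x)) tau.

Definition b_h (tau : broken_tensor) (w : weak_vector) : R :=
  ip_tensor (weak_strain w) (tensor_fun tau).

(* The trace of v_h0 on E is the one from inside K, as E may be shared. *)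
Definition jump K E (v : weak_vector) : 'rV[mpoly d.-1 R]_d :=
  Qkb E (pevmx (v.1 K)) - v.2 E.

Definition s_h (v w : weak_vector) : R :=
  \sum_K \sum_(E | face_of K E) \sum_i
    face_ip E (fun u => (diam_face E)^-1 * pev (jump K E v 0 i) u)
              (pev (jump K E w 0 i)).

Definition euler_scheme (Ci : tensor4_field R d) (T : R) (N : nat)
    (f : R -> 'rV[R]_d -> 'rV[R]_d) (psi0 : 'rV[R]_d -> 'M[R]_d)
    (sigma : nat -> broken_tensor) (v : nat -> weak_vector) : Prop :=
  let dt := T / N%:R in
  sigma 0%N = Qk0 psi0 /\
  forall n, (1 <= n <= N)%N ->
    [/\ Sigma_h (sigma n), V_h0 (v n),
        forall tau, Sigma_h tau ->
          a_h Ci (fun x => dt^-1 *: (tensor_fun (sigma n) x -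
                                     tensor_fun (sigma n.-1) x))
              (tensor_fun tau) +
          a_h Ci (tensor_fun (sigma n)) (tensor_fun tau) - b_h tau (v n) = 0 &
        forall w, V_h0 w ->
          b_h (sigma n) w + s_h (v n) w =
          ip_vector (f (n%:R * dt)) (interior_fun w)].

End weak_galerkin.

(* Main.v *)
(* Because the system of each time step is linear with finitely many unknowns,
   it suffices that its homogeneous version has only the zero solution.  Testing
   that version with the solution itself gives sigma = 0 and s_h(v, v) = 0, hence
   v_b is the projection of the trace of v_0 on every face, and then
   eps_w(v) = 0.  Green's formula now identifies the weak gradient with the
   classical one, so v_0 is an infinitesimal rigid motion on each cell.  A rigid
   motion vanishing on a face is zero; since v_b is single valued, v_0 vanishes on
   both neighbours of a face or on none.  The cells on which v_0 is nonzero
   therefore have no boundary face and each of their faces has both neighbours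
   among them.  No nonempty family of cells is closed in this sense: the flux of
   x |-> x through the faces of the family is a multiple of its volume, whereas
   the two contributions of each face cancel.

   The divergence theorem on a polytope is reduced by Fubini to lines parallel to
   a coordinate axis.  A generic line crosses the boundary at finitely many points,
   each lying in the relative interior of exactly one face, and every crossing
   contributes the sign of the corresponding component of the normal. *)

Require Import Defs.
From mathcomp Require Import all_boot all_order all_algebra perm.
From mathcomp Require Import -(notations) mpoly.
From mathcomp Require Import all_classical all_reals all_analysis.
From mathcomp Require Import measurable_realfun.
From mathcomp Require Import ring lra.

Set Implicit Arguments.
Unset Strict Implicit.
Unset Printing Implicit Defensive.

Import Order.TTheory GRing.Theory Num.Theory.
Import numFieldNormedType.Exports.

Local Open Scope classical_set_scope.
Local Open Scope ring_scope.

(** * Lebesgue measure on row vectors *)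

(** The measure on row vectors is an iterated product in a fixed order of the coordinates, whereas a
    face is integrated in an isometric chart. Fubini along an arbitrary axis and the passage from a
    chart to a coordinate hyperplane both rest on the affine change of variables, built here from
    translations, shears and block triangular maps. For a face with unit normal [nu] the projection
    along axis [i] has Jacobian [|nu_i|]; times the sign of the crossing this is [nu_i], which is
    how the flux appears. Genericity is made algebraic: an exceptional set is one covered by
    finitely many hyperplanes. Such sets survive finite unions and surjective affine preimages, are
    null, and contain no nonempty open set. Linearity of each form requires integrability first. For
    the form of [Ci] only the diagonal is bounded, and only almost everywhere, so a bound off the
    diagonal has to be derived. Similarly the initial datum is symmetric only almost everywhere, and
    its projection must be shown symmetric before the first step can start. *)

Lemma rV_ballP (R : realType) n (x y : 'rV[R]_n) (e : R) : 0 < e ->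
  ball x e y <-> forall i, `|x 0 i - y 0 i| < e.
Proof.
move=> e0; split=> [[_ h] i|h]; first exact: h.
by split=> // j i; rewrite ord1; exact: h.
Qed.

Lemma coord_le_norm (R : realType) n (x : 'rV[R]_n) i : `|x 0 i| <= `|x|.
Proof.
rewrite /Num.norm/= mx_normrE.
by rewrite (le_bigmax_cond _ (fun i : 'I_1 * 'I_n => `|x i.1 i.2|) (j := (0, i))).
Qed.

Section rV_open.
Context {R : realType} {n : nat}.

(** The sigma-algebra is generated by the coordinates alone, so balls are measurable as finite
    intersections; an open set is the union of the countably many balls with rational centre and
    radius [e m] that it contains. *)
Lemma open_measurable_rV (U : set 'rV[R]_n) : open U -> measurable U.
Proof.
move=> oU.
pose c (q : 'rV[rat]_n) : 'rV[R]_n := map_mx ratr q.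
pose e m : R := m.+1%:R^-1.
have e0 m : 0 < e m by rewrite invr_gt0.
have mB (x : 'rV[R]_n) m : measurable (ball x (e m)).
  rewrite (_ : ball x (e m) =
    \bigcap_i (rV_coord i @^-1` [set y | `|x 0 i - y| < e m])).
    apply: fin_bigcap_measurable => // i _.
    rewrite -[X in measurable X]setTI; apply: measurable_rV_coord => //.
    exact: measurable_ball.
  apply/seteqP; split=> y.
    by move=> /(rV_ballP _ _ (e0 m)) h i _; exact: h.
  by move=> h; apply/(rV_ballP _ _ (e0 m)) => i; exact: h.
rewrite (_ : U = \bigcup_(p : 'rV[rat]_n * nat)
   (if pselect (ball (c p.1) (e p.2) `<=` U) then ball (c p.1) (e p.2) else set0)).
  apply: countable_bigcupT_measurable => [|p]; first exact: countableP.
  by case: pselect => [?|?]; [exact: mB|exact: measurable0].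
apply/seteqP; split=> [x Ux|x [p _]]; last by case: pselect => // h /h.
have /nbhs_ballP[r /= r0 xrU] : nbhs x U by exact: open_nbhs_nbhs.
(* With [e m < r / 2], a ball of radius [e m] whose centre is within [e m] of [x] stays in
   [ball x r]. *)
have [m mr] : exists m, e m < r / 2.
  have [k _ /(_ k (leqnn _)) /=] := near_infty_natSinv_lt (PosNum (divr_gt0 r0 (ltr0n _ 2))).
  by exists k.
have /choice[q qx] : forall i, exists q : rat, `|ratr q - x 0 i| < e m.
  move=> i; have [q] := @rat_in_itvoo R (x 0 i - e m) (x 0 i + e m) ltac:(by move: (e0 m); lra).
  rewrite in_itv/= => /andP[h1 h2]; exists q.
  by rewrite ltr_norml; apply/andP; split; lra.
exists (\row_i q i, m) => //=; case: pselect => /=.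
  by move=> _; apply/(rV_ballP _ _ (e0 m)) => i; rewrite !mxE.
case=> y /(rV_ballP _ _ (e0 m)) h; apply: xrU; apply/rV_ballP => // i.
move: (h i) (qx i); rewrite !mxE !ltr_norml => /andP[? ?] /andP[? ?].
by apply/andP; split; lra.
Qed.

Lemma measurable_ball_rV (x : 'rV[R]_n) (r : R) : measurable (ball x r).
Proof. by apply: open_measurable_rV; exact: ball_open. Qed.

Lemma closed_measurable_rV (F : set 'rV[R]_n) : closed F -> measurable F.
Proof.
move=> cF; rewrite -(setCK F); apply: measurableC.
by apply: open_measurable_rV; exact: closed_openC.
Qed.

Lemma continuous_measurable_rV (D : set 'rV[R]_n) (f : 'rV[R]_n -> R) :
  continuous f -> measurable D -> measurable_fun D f.
Proof.
move=> cf mD; apply: (measurable_funS measurableT) => //.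
apply: (measurability _ (RGenOpens.measurableE R)) => _ [_ [a [b ->]] <-].
rewrite setTI; apply: open_measurable_rV.
by apply: open_comp => //; exact: interval_open.
Qed.

Lemma measurable_rV_comp m (g : 'rV[R]_n -> 'rV[R]_m) :
  continuous g -> measurable_fun setT g.
Proof.
move=> cg; apply: measurable_fun_rV => i.
apply: (@continuous_measurable_rV _ (fun x => g x 0 i)) => // x.
apply: (@continuous_comp _ _ _ g (fun y : 'rV[R]_m => y 0 i)) => //.
  exact: cg.
exact: coord_continuous.
Qed.

End rV_open.

Lemma lebesgue_rVS (R : realType) n (A : set 'rV[R]_n.+1) :
  lebesgue_rV R n.+1 A = ((@lebesgue_measure R) \x (lebesgue_rV R n))%E (rV_cons @^-1` A).
Proof. by []. Qed.

(** The norm is the sup norm, so a ball is a cube, a product of intervals of length [2r]. *)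
Lemma lebesgue_rV_ball (R : realType) n (x : 'rV[R]_n) (r : R) : 0 < r ->
  lebesgue_rV R n (ball x r) = ((r *+ 2) ^+ n)%:E.
Proof.
move=> r0; elim: n x => [|n IH] x.
  rewrite /= diracE mem_set ?expr0 //.
  by apply/rV_ballP => // -[].
rewrite lebesgue_rVS (_ : _ @^-1` _ = ball (x 0 ord0) r `*` ball (rV_uncons x).2 r).
  rewrite product_measure1E//.
  - rewrite IH exprS EFinM; congr (_ * _)%E; exact: lebesgue_measure_ball (ltW r0).
  - exact: measurable_ball.
  - exact: measurable_ball_rV.
apply/seteqP; split=> -[t y] /=.
  move=> /(rV_ballP _ _ r0) h; split.
    by have := h ord0; rewrite rV_cons0.
  by apply/rV_ballP => // i; have := h (lift ord0 i); rewrite rV_consS mxE.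
move=> [h0 /(rV_ballP _ _ r0) h]; apply/rV_ballP => // i.
case: (unliftP ord0 i) => [j|] ->; last by rewrite rV_cons0.
by have := h j; rewrite rV_consS mxE.
Qed.

Lemma bounded_subset_ball (R : realType) n (A : set 'rV[R]_n) :
  bounded_set A -> exists2 L : R, 0 < L & A `<=` ball 0 L.
Proof.
(* [bounded_set] bounds the norm by any number above [M], here [|M| + 1]; one more unit makes the
   ball condition strict. *)
case=> M [Mr h]; exists (`|M| + 2); first by rewrite ltr_wpDl.
move=> x Ax; apply/rV_ballP => [|i]; first by rewrite ltr_wpDl.
rewrite mxE sub0r normrN (le_lt_trans (coord_le_norm _ _))//.
have /(_ (`|M|+1)) := h; rewrite ltr_pwDr ?ler_norm// => /(_ isT x Ax) hx.
by rewrite (le_lt_trans hx)// ltrD2l ltr1n.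
Qed.

Lemma lebesgue_rV_bounded (R : realType) n (A : set 'rV[R]_n) :
  measurable A -> bounded_set A -> (lebesgue_rV R n A < +oo)%E.
Proof.
move=> mA /bounded_subset_ball[L L0 AL].
apply: (@le_lt_trans _ _ (lebesgue_rV R n (ball 0 L))).
  by apply: le_measure => //; rewrite inE//; exact: measurable_ball_rV.
by rewrite lebesgue_rV_ball// ltry.
Qed.

Lemma lebesgue_rV_open_gt0 (R : realType) n (A : set 'rV[R]_n) :
  open A -> A !=set0 -> (0 < lebesgue_rV R n A)%E.
Proof.
move=> oA [x Ax]; have /nbhs_ballP[r /= r0 xrA] : nbhs x A by exact: open_nbhs_nbhs.
apply: (@lt_le_trans _ _ (lebesgue_rV R n (ball x r))).
  by rewrite lebesgue_rV_ball// lte_fin exprn_gt0// mulrn_wgt0.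
apply: le_measure => //; rewrite inE//; last exact: open_measurable_rV.
exact: measurable_ball_rV.
Qed.

(** * Change of variables with a constant factor *)

Section scaled_pushforward.
Context d1 d2 (X : measurableType d1) (Y : measurableType d2) (R : realType).
Variables (m1 : {measure set X -> \bar R}) (m2 : {measure set Y -> \bar R}).
Variables (phi : X -> Y) (c : R).
Hypothesis mphi : measurable_fun setT phi.
Hypothesis c0 : 0 <= c.
Hypothesis phiE : forall A, measurable A -> m1 (phi @^-1` A) = (c%:E * m2 A)%E.
Local Open Scope ereal_scope.

(** Two different spaces are allowed, so that one statement serves affine maps, with [c] the inverse
    Jacobian, and the insertion of a coordinate from a product space, with [c = 1]. *)
Lemma ge0_integral_scaled_pushforward (D : set Y) (f : Y -> \bar R) :
  measurable D -> measurable_fun D f -> (forall y, D y -> 0 <= f y) ->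
  \int[m1]_(x in phi @^-1` D) f (phi x) = c%:E * \int[m2]_(y in D) f y.
Proof.
move=> mD mf f0; rewrite -(ge0_integral_pushforward mphi m1 mD mf); last first.
  by move=> y /set_mem; exact: f0.
rewrite -(ge0_integral_mscale m2 mD (NngNum c0) mf f0).
by apply: eq_measure_integral => A mA _; exact: phiE.
Qed.

Lemma integrable_scaled_pushforward (D : set Y) (f : Y -> \bar R) :
  measurable D -> m2.-integrable D f ->
  m1.-integrable (phi @^-1` D) (f \o phi).
Proof.
move=> mD /integrableP[mf foo]; apply/integrableP; split.
  apply: (@measurable_comp _ _ _ _ _ _ D) => //.
  - by move=> _ [x h <-].
  - exact: measurable_funTS.
rewrite (_ : (fun x => `|(f \o phi) x|) = (fun x => (abse \o f) (phi x)))//.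
rewrite ge0_integral_scaled_pushforward//=; last exact: measurableT_comp.
by rewrite lte_mul_pinfty.
Qed.

Lemma integral_scaled_pushforward (D : set Y) (g : Y -> \bar R) :
  measurable D -> m2.-integrable D g ->
  \int[m1]_(x in phi @^-1` D) g (phi x) = c%:E * \int[m2]_(y in D) g y.
Proof.
move=> mD If.
have mfp := measurable_funepos (measurable_int _ If).
have mfn := measurable_funeneg (measurable_int _ If).
rewrite [LHS](integralE m1 _ (g \o phi)) [X in (_ * X)%E](integralE m2 D g).
rewrite funepos_comp funeneg_comp !ge0_integral_scaled_pushforward//.
have fp := integral_funepos_lt_pinfty mD If.
have fn := integral_funeneg_lt_pinfty mD If.
by rewrite [RHS]muleBr// fin_num_adde_defl// fin_numN ge0_fin_numE// integral_ge0.
Qed.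

Lemma Rintegral_scaled_pushforward (D : set Y) (f : Y -> R) :
  measurable D -> m2.-integrable D (EFin \o f) ->
  (\int[m1]_(x in phi @^-1` D) f (phi x) = c * \int[m2]_(y in D) f y)%R.
Proof.
move=> mD If; rewrite /Rintegral.
rewrite (integral_scaled_pushforward mD If) fineM//.
exact: integrable_fin_num.
Qed.

End scaled_pushforward.

(** [|a|] times the image measure agrees with Lebesgue measure on half-open intervals, hence
    everywhere by uniqueness. *)
Lemma lebesgue_measure_affine (R : realType) (a b : R) (A : set (measurableTypeR R)) :
  a != 0 -> measurable A ->
  (@lebesgue_measure R) ((fun t => a * t + b) @^-1` A) =
  (`|a|^-1%:E * (@lebesgue_measure R) A)%E.
Proof.
move=> a0 mA; pose phi (t : measurableTypeR R) : measurableTypeR R := a * t + b.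
rewrite -[X in X @^-1` A]/phi; have mphi : measurable_fun setT phi.
  by apply: measurable_funD => //; exact: measurable_funM.
pose pf : {measure set (measurableTypeR R) -> \bar R} :=
  measure_function_pushforward__canonical__measure_function_Measure
    (@lebesgue_measure R) mphi.
pose m := mscale (NngNum (normr_ge0 a)) pf.
have := @lebesgue_measure_unique R m.
move=> /(_ _ A mA) ->; last first.
  move=> _ [[u v] _ <-] /=; rewrite /m /mscale /pushforward /=.
  rewrite lebesgue_measure_itv/= lte_fin.
  rewrite /pushforward; have an : 0 < `|a| by rewrite normr_gt0.
  (* A negative slope exchanges the open and the closed end of the interval; its length is not
     affected. *)
  case/orP : (lt_total a0) => [an0|ap].
    rewrite (_ : phi @^-1` _ = `[(v - b) / a, (u - b) / a[%classic); last first.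
      apply/seteqP; split=> t; rewrite /phi/= !in_itv/= => /andP[h1 h2]; apply/andP; split.
      - by rewrite ler_ndivrMr// mulrC lerBrDr.
      - by rewrite ltr_ndivlMr// mulrC ltrBlDr.
      - by move: h2; rewrite ltr_ndivlMr// mulrC ltrBlDr.
      - by move: h1; rewrite ler_ndivrMr// mulrC lerBrDr.
    rewrite lebesgue_measure_itv/= lte_fin ltr_nM2r ?invr_lt0// ltrD2r.
    case: ifPn => _; last by rewrite mule0.
    rewrite -!EFinB -EFinM; congr EFin; rewrite ltr0_norm//; field.
    by rewrite lt_eqF.
  rewrite (_ : phi @^-1` _ = `](u - b) / a, (v - b) / a]%classic); last first.
    apply/seteqP; split=> t; rewrite /phi/= !in_itv/= => /andP[h1 h2]; apply/andP; split.
    - by rewrite ltr_pdivrMr// mulrC ltrBlDr.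
    - by rewrite ler_pdivlMr// mulrC lerBrDr.
    - by move: h1; rewrite ltr_pdivrMr// mulrC ltrBlDr.
    - by move: h2; rewrite ler_pdivlMr// mulrC lerBrDr.
  rewrite lebesgue_measure_itv/= lte_fin ltr_pM2r ?invr_gt0// ltrD2r.
  case: ifPn => _; last by rewrite mule0.
  rewrite -!EFinB -EFinM; congr EFin; rewrite gtr0_norm//; field.
  by rewrite gt_eqF.
rewrite /m /mscale /= /pushforward muleA -EFinM mulVf ?mul1e//.
by rewrite normr_eq0.
Qed.

Section rV_sections.
Context {R : realType} {n : nat}.
Let mu1 : {sigma_finite_measure set (measurableTypeR R) -> \bar R} := @lebesgue_measure R.
Local Notation mun := (lebesgue_rV R n).
Local Notation munS := (lebesgue_rV R n.+1).
Local Open Scope ereal_scope.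

Lemma measurable_rV_cons_preimage (A : set 'rV[R]_n.+1) :
  measurable A -> measurable (@rV_cons R n @^-1` A).
Proof. by move=> mA; rewrite -[X in measurable X]setTI; exact: measurable_rV_cons. Qed.

Lemma lebesgue_rV_xsection (A : set 'rV[R]_n.+1) : measurable A ->
  munS A = \int[mu1]_t mun [set y | A (rV_cons (t, y))].
Proof.
move=> mA; rewrite lebesgue_rVS /product_measure1; apply: eq_integral => t _ /=.
by congr (mun _); apply/seteqP; split => y; rewrite /xsection /= in_setE.
Qed.

(** The definition puts the integral over the new coordinate outermost; uniqueness of the product
    measure gives the other order. *)
Lemma lebesgue_rV_ysection (A : set 'rV[R]_n.+1) : measurable A ->
  munS A = \int[mun]_y mu1 [set t | A (rV_cons (t, y))].
Proof.
move=> mA; rewrite lebesgue_rVS.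
rewrite (@product_measure_unique _ _ _ _ _ mu1 mun (mu1 \x^ mun)); last 2 first.
- by move=> B1 B2 mB1 mB2; apply: (product_measure2E mu1 mun).
- exact: measurable_rV_cons_preimage.
rewrite /product_measure2; apply: eq_integral => y _ /=.
by congr (mu1 _); apply/seteqP; split => t; rewrite /ysection /= in_setE.
Qed.

Lemma measurable_xsection_rV (A : set 'rV[R]_n.+1) : measurable A ->
  measurable_fun setT (fun t => mun [set y | A (rV_cons (t, y))]).
Proof.
move=> /measurable_rV_cons_preimage mA.
apply: eq_measurable_fun (measurable_fun_xsection mun mA) => t _ /=.
by congr (mun _); apply/seteqP; split => y; rewrite /xsection /= in_setE.
Qed.

Lemma measurable_ysection_rV (A : set 'rV[R]_n.+1) : measurable A ->
  measurable_fun setT (fun y => mu1 [set t | A (rV_cons (t, y))]).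
Proof.
move=> /measurable_rV_cons_preimage mA.
apply: eq_measurable_fun (measurable_fun_ysection mu1 mA) => y _ /=.
by congr (mu1 _); apply/seteqP; split => t; rewrite /ysection /= in_setE.
Qed.

Lemma measurable_rV_xslice (A : set 'rV[R]_n.+1) t : measurable A ->
  measurable [set y | A (rV_cons (t, y))].
Proof.
move=> /measurable_rV_cons_preimage/(measurable_xsection t).
by congr measurable; apply/seteqP; split => y; rewrite /xsection /= in_setE.
Qed.

Lemma measurable_rV_yslice (A : set 'rV[R]_n.+1) y : measurable A ->
  measurable [set t : measurableTypeR R | A (rV_cons (t, y))].
Proof.
move=> /measurable_rV_cons_preimage/(measurable_ysection y).
by congr measurable; apply/seteqP; split => t; rewrite /ysection /= in_setE.
Qed.

End rV_sections.

(** * Hyperplanes are null sets *)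

Section hyperplane.
Context {R : realType}.

Lemma continuous_mul (T : topologicalType) (f g : T -> R) :
  continuous f -> continuous g -> continuous (fun x => f x * g x).
Proof. by move=> cf cg x; exact: cvgM (cf x) (cg x). Qed.

Lemma continuous_add (T : topologicalType) (f g : T -> R) :
  continuous f -> continuous g -> continuous (fun x => f x + g x).
Proof. by move=> cf cg x; exact: cvgD (cf x) (cg x). Qed.

Lemma continuous_sum (T : topologicalType) (I : Type) (r : seq I) (f : I -> T -> R) :
  (forall i, continuous (f i)) -> continuous (fun x => \sum_(i <- r) f i x).
Proof.
move=> cf; elim: r => [|i r IH] x.
  by under eq_fun do rewrite big_nil; exact: cvg_cst.
under eq_fun do rewrite big_cons.
by apply: cvgD; [exact: cf|exact: IH].
Qed.

Lemma dotp_continuous n (a : 'rV[R]_n) : continuous (dotp a).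
Proof.
rewrite (_ : dotp a = fun x => \sum_i a 0 i * x 0 i)//.
apply: continuous_sum => i; apply: continuous_mul; first exact: cst_continuous.
exact: coord_continuous.
Qed.

Lemma dotp_rV_cons n (a : 'rV[R]_n.+1) t y :
  dotp a (rV_cons (t, y)) = a 0 ord0 * t + dotp (rV_uncons a).2 y.
Proof.
rewrite /dotp big_ord_recl rV_cons0; congr (_ + _).
by apply: eq_bigr => i _; rewrite rV_consS mxE.
Qed.

Lemma measurable_hyperplane n (a : 'rV[R]_n) (c : R) :
  measurable [set x | dotp a x = c].
Proof.
apply: closed_measurable_rV; apply: (@preimage_closed _ _ (dotp a) [set c]).
  by move=> x _; exact: dotp_continuous.
exact: closed_eq.
Qed.

(** If the first entry of [a] is zero, every slice at a fixed first coordinate is a hyperplane of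
    lower dimension; otherwise every line in the first direction meets the hyperplane in one
    point. *)
Lemma lebesgue_rV_hyperplane n (a : 'rV[R]_n) (c : R) : a != 0 ->
  lebesgue_rV R n [set x | dotp a x = c] = 0%E.
Proof.
elim: n a c => [|n IH] a c a0.
  by case/eqP: a0; apply/rowP => -[].
have [a00|a00] := eqVneq (a 0 ord0) 0.
  rewrite lebesgue_rV_xsection ?integral0_eq//; last exact: measurable_hyperplane.
  move=> t _; rewrite (_ : [set y | _] = [set y | dotp (rV_uncons a).2 y = c]).
    apply: IH; apply: contra_neq a0 => h; rewrite -(rV_unconsK a).
    rewrite (_ : rV_uncons a = (0, 0)); last by rewrite [LHS]surjective_pairing h /= a00.
    apply/rowP => i; case: (unliftP ord0 i) => [j|] ->; last by rewrite rV_cons0 mxE.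
    by rewrite rV_consS !mxE.
  by apply/seteqP; split=> y /=; rewrite dotp_rV_cons a00 mul0r add0r.
rewrite lebesgue_rV_ysection ?integral0_eq//; last exact: measurable_hyperplane.
move=> y _; rewrite (_ : [set t | _] = [set (c - dotp (rV_uncons a).2 y) / a 0 ord0]).
  exact: lebesgue_measure_set1.
apply/seteqP; split=> t /=; rewrite dotp_rV_cons.
  by move=> <-; rewrite addrK mulrC mulKf.
by move=> ->; rewrite mulrC divfK// subrK.
Qed.

End hyperplane.

(** * Affine changes of variables in Lebesgue measure *)

Section affine_change.
Context {R : realType}.
Let mu1 : {sigma_finite_measure set (measurableTypeR R) -> \bar R} := @lebesgue_measure R.

Lemma continuous_rV (T : topologicalType) n (g : T -> 'rV[R]_n) :
  (forall i, continuous (fun x => g x 0 i)) -> continuous g.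
Proof.
move=> cg x A /nbhs_ballP[e /= e0 eA].
have : \forall y \near x, forall i, `|g x 0 i - g y 0 i| < e.
  apply: (@filter_forall _ _ _ _ (nbhs_filter x)) => i.
  exact: (cg i x _ (nbhsx_ballx (g x 0 i) e e0)).
by apply: filterS => y h; apply: eA; apply/rV_ballP.
Qed.

Lemma continuous_affine_rV m n (M : 'M[R]_(m, n)) (b : 'rV[R]_n) :
  continuous (fun x : 'rV[R]_m => x *m M + b).
Proof.
apply: continuous_rV => i.
rewrite (_ : (fun x : 'rV[R]_m => (x *m M + b) 0 i) = fun x => dotp (col i M)^T x + b 0 i).
  by apply: continuous_add; [exact: dotp_continuous|exact: cst_continuous].
by apply/funext => x; rewrite !mxE; congr (_ + _); apply: eq_bigr => j _; rewrite !mxE mulrC.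
Qed.

Lemma measurable_affine_rV m n (M : 'M[R]_(m, n)) (b : 'rV[R]_n) :
  measurable_fun setT (fun x : 'rV[R]_m => x *m M + b).
Proof. by apply: measurable_rV_comp; exact: continuous_affine_rV. Qed.

Lemma measurable_affine_preimage m n (M : 'M[R]_(m, n)) (b : 'rV[R]_n) A :
  measurable A -> measurable ((fun x : 'rV[R]_m => x *m M + b) @^-1` A).
Proof.
by move=> mA; rewrite -[X in measurable X]setTI; exact: measurable_affine_rV.
Qed.

(** The factor is the one of preimages, that is, the inverse of the Jacobian. *)
Definition scales_lebesgue n (phi : 'rV[R]_n -> 'rV[R]_n) (c : R) :=
  measurable_fun setT phi /\ forall A, measurable A ->
    lebesgue_rV R n (phi @^-1` A) = (c%:E * lebesgue_rV R n A)%E.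

Lemma scales_lebesgue_comp n (phi psi : 'rV[R]_n -> 'rV[R]_n) (a b : R) :
  scales_lebesgue phi a -> scales_lebesgue psi b ->
  scales_lebesgue (psi \o phi) (a * b).
Proof.
move=> [mphi phiE] [mpsi psiE]; split; first exact: measurableT_comp.
move=> A mA; have mB : measurable (psi @^-1` A).
  by rewrite -[X in measurable X]setTI; exact: mpsi.
by rewrite comp_preimage phiE// psiE// EFinM muleA.
Qed.

(** By induction on the dimension: the outer integral is translated on the line, each slice by the
    induction hypothesis. *)
Lemma scales_lebesgue_translation n (b : 'rV[R]_n) :
  scales_lebesgue (fun x => x + b) 1.
Proof.
elim: n b => [|n IH] b.
  rewrite (_ : (fun x => x + b) = id); last by apply/funext => x; apply/rowP => -[].
  by split=> [|A mA]; [exact: measurable_id|rewrite mul1e].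
split=> [|A mA].
  by have := measurable_affine_rV 1%:M b; under eq_fun do rewrite mulmx1.
have mpre : measurable ((fun x => x + b) @^-1` A).
  by have := measurable_affine_preimage 1%:M b mA; under eq_fun do rewrite mulmx1.
rewrite !lebesgue_rV_xsection// mul1e.
set h := fun t => lebesgue_rV R n [set y | A (rV_cons (t, y))].
have := @ge0_integral_scaled_pushforward _ _ _ _ R mu1 mu1 (fun t => 1 * t + b 0 ord0) 1.
move=> /(_ _ ler01 _ setT h measurableT) ihE.
transitivity (\int[mu1]_t h (1 * t + b 0 ord0)%R)%E; last first.
  rewrite preimage_setT mul1e in ihE; apply: ihE.
  - by apply: measurable_funD => //; exact: measurable_funM.
  - move=> B mB; have := lebesgue_measure_affine (b 0 ord0) (oner_neq0 R) mB.
    by rewrite normr1 invr1.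
  - exact: measurable_xsection_rV.
  - by move=> y _; exact: measure_ge0.
apply: eq_integral => t _; rewrite /h.
have [_ /(_ _ (measurable_rV_xslice (1 * t + b 0 ord0) mA))] := IH (rV_uncons b).2.
rewrite mul1e => <-; congr (lebesgue_rV R n _); apply/seteqP; split=> y /=.
all: rewrite (_ : rV_cons (t, y) + b = rV_cons (1 * t + b 0 ord0, y + (rV_uncons b).2))//.
all: by apply/rowP => i; case: (unliftP ord0 i) => [j|] ->;
  rewrite mxE ?rV_consS ?rV_cons0 /= ?mxE ?mul1r.
Qed.

(** The slice at first coordinate [t] is merely translated by [t *: r]. *)
Lemma scales_lebesgue_shear n (r : 'rV[R]_n) :
  scales_lebesgue (fun x : 'rV[R]_(1 + n) => x *m block_mx 1%:M r 0 1%:M) 1.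
Proof.
have /= mM := @measurable_affine_rV (1 + n) (1 + n) (block_mx 1%:M r 0 1%:M) 0.
split=> [|A mA]; first by move: mM; under eq_fun do rewrite addr0.
have mpre : measurable ((fun x : 'rV[R]_(1 + n) => x *m block_mx 1%:M r 0 1%:M) @^-1` A).
  by rewrite -[X in measurable X]setTI; move: mM; under eq_fun do rewrite addr0; apply.
rewrite !lebesgue_rV_xsection// mul1e; apply: eq_integral => t _.
have [_ /(_ _ (measurable_rV_xslice t mA))] := scales_lebesgue_translation (t *: r).
rewrite mul1e => <-; congr (lebesgue_rV R n _).
apply/seteqP; split=> y /=; rewrite /rV_cons mul_row_block mulmx1 mulmx0 addr0 mulmx1 /=.
all: rewrite (_ : const_mx t *m r + y = y + t *: r)// addrC; congr (_ + _).
all: by apply/rowP => i; rewrite !mxE big_ord1 !mxE.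
Qed.

(** For fixed [y] the first coordinate undergoes an affine map of slope [a], while [y] itself
    undergoes [S]; hence the sections are taken in the other order. *)
Lemma scales_lebesgue_lower n (a : R) (c : 'cV[R]_n) (S : 'M[R]_n) : a != 0 ->
  scales_lebesgue (fun x => x *m S) `|\det S|^-1 ->
  scales_lebesgue (fun x : 'rV[R]_(1 + n) => x *m block_mx a%:M 0 c S)
    `|a * \det S|^-1.
Proof.
move=> a0 [mS SE].
have /= mM := @measurable_affine_rV (1 + n) (1 + n) (block_mx a%:M 0 c S) 0.
split=> [|A mA]; first by move: mM; under eq_fun do rewrite addr0.
have mpre : measurable ((fun x : 'rV[R]_(1 + n) => x *m block_mx a%:M 0 c S) @^-1` A).
  by rewrite -[X in measurable X]setTI; move: mM; under eq_fun do rewrite addr0; apply.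
rewrite !lebesgue_rV_ysection//.
set g := fun y => mu1 [set t | A (rV_cons (t, y))].
rewrite -[LHS]/(\int[lebesgue_rV R n]_y _)%E.
transitivity (\int[lebesgue_rV R n]_y (`|a|^-1%:E * g (y *m S)))%E.
  apply: eq_integral => y _.
  rewrite -(lebesgue_measure_affine ((y *m c) 0 0) a0 (measurable_rV_yslice (y *m S) mA)).
  suff E t : (rV_cons (t, y) : 'rV_(1 + n)) *m block_mx a%:M 0 c S =
      rV_cons (a * t + (y *m c) 0 0, y *m S).
    by congr (mu1 _); apply/seteqP; split=> t /=; rewrite E.
  rewrite /rV_cons mul_row_block mulmx0 add0r mul_mx_scalar /=; congr row_mx.
  by apply/rowP => i; rewrite !ord1 !mxE.
have mg : measurable_fun setT g by exact: measurable_ysection_rV.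
have g0 y : (0 <= g y)%E by exact: measure_ge0.
rewrite ge0_integralZl//; last exact: (measurableT_comp mg mS).
have c0 : 0 <= `|\det S|^-1 by rewrite invr_ge0.
have := ge0_integral_scaled_pushforward mS c0 SE measurableT mg.
rewrite preimage_setT => ->//.
by rewrite muleA -EFinM normrM invfM.
Qed.

(* Block elimination writes M as a product of shears and a block triangular
   matrix of smaller size; a further shear makes the pivot nonzero. *)
Lemma scales_lebesgue_linear n (M : 'M[R]_n) : M \in unitmx ->
  scales_lebesgue (fun x => x *m M) `|\det M|^-1.
Proof.
elim: n M => [|n IH] M uM.
  rewrite (_ : (fun x => x *m M) = id); last by apply/funext => x; apply/rowP => -[].
  split=> [|A mA]; first exact: measurable_id.
  by rewrite det_mx00 normr1 invr1 mul1e.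
rewrite -[n.+1]/(1 + n)%N in M uM *.
have step (N : 'M[R]_(1 + n)) : N \in unitmx -> ulsubmx N 0 0 != 0 ->
    scales_lebesgue (fun x => x *m N) `|\det N|^-1.
  move=> uN N00; set a := ulsubmx N 0 0 in N00.
  pose r := a^-1 *: ursubmx N.
  pose S := drsubmx N - dlsubmx N *m r.
  have NE : N = block_mx a%:M 0 (dlsubmx N) S *m block_mx 1%:M r 0 1%:M.
    rewrite mulmx_block !mulmx1 !mulmx0 !addr0 /S [_ + (_ - _)]addrC subrK.
    rewrite mul_scalar_mx scalerA divff// scale1r -[LHS]submxK.
    by rewrite [ulsubmx N]mx11_scalar.
  have detN : \det N = a * \det S.
    by rewrite NE det_mulmx det_lblock (@det_ublock _ 1 n) !det1 !mulr1 det_scalar1.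
  have uS : S \in unitmx.
    rewrite unitmxE unitfE; apply: contraTneq uN => S0.
    by rewrite unitmxE unitfE detN S0 mulr0 eqxx.
  rewrite detN NE -[_^-1]mulr1.
  rewrite (_ : (fun x => _) =
    (fun x => x *m block_mx 1%:M r 0 1%:M) \o
    (fun x => x *m block_mx a%:M 0 (dlsubmx N) S)); last first.
    by apply/funext => x /=; rewrite mulmxA.
  apply: scales_lebesgue_comp; last exact: scales_lebesgue_shear.
  by apply: scales_lebesgue_lower => //; exact: IH.
have [M00|M00] := eqVneq (ulsubmx M 0 0) 0; last exact: step.
have [j Mj] : exists j, dlsubmx M j 0 != 0.
  apply/not_existsP => h; move: uM; rewrite -(submxK M).
  rewrite (_ : dlsubmx M = 0); last first.
    by apply/colP => j; rewrite [RHS]mxE; apply/eqP/negPn/negP; exact: h.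
  rewrite (_ : ulsubmx M = 0); last by apply/rowP => i; rewrite !ord1 M00 [RHS]mxE.
  rewrite unitmxE (@det_ublock _ 1 n) (_ : \det 0 = 0) ?mul0r ?unitr0//.
  by rewrite det0.
pose r : 'rV[R]_n := delta_mx 0 j.
pose N := block_mx 1%:M r 0 1%:M *m M.
have N00 : ulsubmx N 0 0 != 0.
  rewrite /N -[M in _ *m M]submxK mulmx_block block_mxKul mul1mx mxE M00 add0r.
  by rewrite -rowE !mxE; rewrite !mxE in Mj.
have detN : \det N = \det M.
  by rewrite /N det_mulmx (@det_ublock _ 1 n) !det1 !mul1r.
have uN : N \in unitmx by rewrite unitmxE detN -unitmxE.
rewrite -detN -[_^-1]mul1r.
rewrite (_ : (fun x => _) =
  (fun x => x *m N) \o (fun x => x *m block_mx 1%:M (- r) 0 1%:M)); last first.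
  apply/funext => x /=; rewrite /N -mulmxA; congr (_ *m _); rewrite mulmxA.
  rewrite mulmx_block !mulmx1 !mul1mx !mul0mx !mulmx0 !addr0 !add0r addrN.
  by rewrite -scalar_mx_block mul1mx.
by apply: scales_lebesgue_comp; [exact: scales_lebesgue_shear|exact: step].
Qed.

Lemma scales_lebesgue_affine n (M : 'M[R]_n) (b : 'rV[R]_n) : M \in unitmx ->
  scales_lebesgue (fun x => x *m M + b) `|\det M|^-1.
Proof.
move=> uM; rewrite -[_^-1]mulr1.
apply: (@scales_lebesgue_comp _ (fun x => x *m M) (fun x => x + b)).
  exact: scales_lebesgue_linear.
exact: scales_lebesgue_translation.
Qed.

End affine_change.

Section insertion.
Context {R : realType} {n : nat}.
Let mu1 : {sigma_finite_measure set (measurableTypeR R) -> \bar R} := @lebesgue_measure R.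
Variable i : 'I_n.+1.

Definition insert_coord (t : R) (y : 'rV[R]_n) : 'rV[R]_n.+1 :=
  \row_j if unlift i j is Some k then y 0 k else t.

Lemma insert_coord_eq t y : insert_coord t y 0 i = t.
Proof. by rewrite mxE unlift_none. Qed.

Lemma insert_coord_lift t y k : insert_coord t y 0 (lift i k) = y 0 k.
Proof. by rewrite mxE liftK. Qed.

Lemma col'_insert_coord t y : col' i (insert_coord t y) = y.
Proof. by apply/rowP => k; rewrite mxE insert_coord_lift. Qed.

Lemma insert_coordK (x : 'rV[R]_n.+1) : insert_coord (x 0 i) (col' i x) = x.
Proof.
apply/rowP => j; case: (unliftP i j) => [k|] ->.
  by rewrite insert_coord_lift mxE.
by rewrite insert_coord_eq.
Qed.

(** The measure singles out the first coordinate; a permutation matrix, of determinant 1 or -1,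
    moves it to position [i] and preserves the measure. *)
Lemma insert_coord_perm t y :
  insert_coord t y =
  rV_cons (t, y) *m perm_mx (lift_perm i ord0 1)^-1.
Proof.
rewrite -col_permE; apply/rowP => j; rewrite [RHS]mxE.
case: (unliftP i j) => [k|] ->.
  by rewrite insert_coord_lift lift_perm_lift perm1 rV_consS.
by rewrite insert_coord_eq lift_perm_id rV_cons0.
Qed.

Lemma measurable_insert_coord :
  measurable_fun setT (fun p : measurableTypeR R * 'rV[R]_n => insert_coord p.1 p.2).
Proof.
rewrite (_ : (fun _ => _) =
  (fun x : 'rV[R]_n.+1 => x *m perm_mx (lift_perm i ord0 1)^-1 + 0) \o @rV_cons R n).
  apply: measurableT_comp; last exact: measurable_rV_cons.
  exact: measurable_affine_rV.
by apply/funext => -[t y]; rewrite /= insert_coord_perm addr0.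
Qed.

Lemma lebesgue_rV_insert_coord (A : set 'rV[R]_n.+1) : measurable A ->
  lebesgue_rV R n.+1 A =
  (mu1 \x lebesgue_rV R n)%E ((fun p => insert_coord p.1 p.2) @^-1` A).
Proof.
move=> mA; have uP : perm_mx (lift_perm i ord0 1)^-1 \in @unitmx R n.+1.
  exact: unitmx_perm.
have [_ /(_ A mA)] := scales_lebesgue_linear uP.
rewrite det_perm normr_sign invr1 mul1e => <-; rewrite lebesgue_rVS.
congr (_ _); apply/seteqP; split=> -[t y] /=; by rewrite insert_coord_perm.
Qed.

Lemma Fubini_insert_coord (f : 'rV[R]_n.+1 -> \bar R) :
  (lebesgue_rV R n.+1).-integrable setT f ->
  (\int[lebesgue_rV R n.+1]_x f x =
   \int[lebesgue_rV R n]_y \int[mu1]_t f (insert_coord t y))%E.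
Proof.
move=> If.
have E A : measurable A ->
    (mu1 \x lebesgue_rV R n)%E ((fun p => insert_coord p.1 p.2) @^-1` A) =
    (1%:E * lebesgue_rV R n.+1 A)%E.
  by move=> mA; rewrite mul1e lebesgue_rV_insert_coord.
have := integrable_scaled_pushforward measurable_insert_coord ler01 E measurableT If.
have := integral_scaled_pushforward measurable_insert_coord ler01 E measurableT If.
rewrite preimage_setT mul1e => <- /integral21_prod_meas1 <-.
exact: eq_integral.
Qed.

End insertion.

(** * Integrals of a derivative over a subset of a line with finitely many break points *)

Section line_integral.
Context {R : realType}.
Local Notation mu := (@lebesgue_measure R).
Variables (S : set R) (sg : R -> R) (P : {poly R}).
Hypothesis mS : measurable S.

Lemma integral_deriv_poly (a b : R) : a < b ->
  \int[mu]_(x in `[a, b]) P^`().[x] = P.[b] - P.[a].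
Proof.
move=> ab; rewrite /Rintegral (@continuous_FTC2 _ (horner P^`()) (horner P) _ _ ab)//.
- by apply: continuous_subspaceT => x; exact: continuous_horner.
- split => //.
  + by apply: cvg_at_right_filter; exact: continuous_horner.
  + by apply: cvg_at_left_filter; exact: continuous_horner.
- by move=> x _; rewrite derivE.
Qed.

Lemma integrable_poly (a b : R) (A : set R) : measurable A -> A `<=` `[a, b] ->
  mu.-integrable A (EFin \o (fun x => P^`().[x])).
Proof.
move=> mA Aab; apply: (@integrableS _ _ _ mu `[a, b]%classic) => //.
apply: continuous_compact_integrable; first exact: segment_compact.
by apply: continuous_subspaceT => x; exact: continuous_horner.
Qed.

Lemma integrable_indic_poly (a b : R) (A : set R) : measurable A -> A `<=` `[a, b] ->
  mu.-integrable A (EFin \o (fun x => \1_S x * P^`().[x])).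
Proof.
move=> mA Aab.
rewrite (_ : EFin \o _ = ((fun x => P^`().[x]%:E) \* (EFin \o \1_S))%E); last first.
  by apply/funext => x /=; rewrite mulrC EFinM.
apply: integrableMl => //; [exact: integrable_poly Aab|].
exists 1; split=> // M M1 x _ /=; rewrite indicE.
by case: (x \in S); rewrite ?normr1 ?normr0 ltW// (lt_trans ltr01).
Qed.

(** The end points are left free, because they will be break points of the set. *)
Lemma integral_indic_cst (a b c : R) : a < b ->
  (forall x, a < x -> x < b -> \1_S x = c) ->
  \int[mu]_(x in `]a, b]) (\1_S x * P^`().[x]) = c * (P.[b] - P.[a]).
Proof.
move=> ab Sc.
rewrite -Rintegral_itv_bndo_bndc; last first.
  apply: (@integrable_indic_poly a b) => //.
  by move=> x /=; rewrite !in_itv/= => /andP[/ltW-> /ltW->].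
transitivity (\int[mu]_(x in `]a, b[) (c * P^`().[x])).
  apply: eq_Rintegral.
  by move=> x; rewrite inE/= in_itv/= => /andP[ax xb]; rewrite Sc.
have ip (A : set R) : measurable A -> A `<=` `[a, b] ->
    mu.-integrable A (EFin \o (fun x => P^`().[x])).
  move=> mA Aab; have := @integrable_poly a b A mA Aab; exact.
rewrite RintegralZl//; last first.
  by apply: ip => // x /=; rewrite !in_itv/= => /andP[/ltW-> /ltW->].
rewrite -integral_deriv_poly//; congr (_ * _).
rewrite Rintegral_itv_obnd_cbnd; last first.
  by apply: ip => // x /=; rewrite !in_itv/= => /andP[/ltW-> /ltW->].
rewrite Rintegral_itv_bndo_bndc//.
by apply: ip => // x /=; rewrite !in_itv/= => /andP[-> /ltW->].
Qed.

(* Summation by parts: the jumps of the indicator at the break points carry the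
   boundary terms. *)
Lemma integral_indic_jumps (ts : seq R) (a b c : R) :
  path <%R a ts -> last a ts < b ->
  (forall u v, a <= u -> v <= b -> (forall t, t \in ts -> ~ (u < t /\ t < v)) ->
     forall x y, u < x -> x < v -> u < y -> y < v -> S x -> S y) ->
  (forall t, t \in ts -> exists2 e : R, 0 < e & forall s, 0 < s -> s < e ->
     \1_S (t - s) - \1_S (t + s) = sg t) ->
  (exists2 e : R, 0 < e & forall s, 0 < s -> s < e -> \1_S (a + s) = c) ->
  (exists2 e : R, 0 < e & forall s, 0 < s -> s < e -> \1_S (b - s) = 0 :> R) ->
  \int[mu]_(x in `]a, b]) (\1_S x * P^`().[x]) =
  - c * P.[a] + \sum_(t <- ts) sg t * P.[t].
Proof.
have loc (u v w : R) : u < w -> w < v ->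
    (forall x y, u < x -> x < v -> u < y -> y < v -> S x -> S y) ->
    forall x, u < x -> x < v -> \1_S x = \1_S w :> R.
  move=> uw wv h x ux xv; rewrite !indicE; congr ((nat_of_bool _)%:R).
  by apply/idP/idP => /set_mem Sx; apply/mem_set; exact: h Sx.
have mid (u e v : R) : u < v -> 0 < e -> exists s, [/\ 0 < s, s < e, u < u + s & u + s < v].
  move=> uv e0; exists (Num.min e (v - u) / 2).
  have : 0 < Num.min e (v - u) by rewrite lt_min e0 subr_gt0.
  have : Num.min e (v - u) <= e by rewrite ge_min lexx.
  have : Num.min e (v - u) <= v - u by rewrite ge_min lexx orbT.
  by move=> ? ? ?; split; lra.
elim: ts a c => [|t ts IH] a c /=.
  move=> _ ab h _ [e e0 ea] [e' e'0 eb]; rewrite big_nil addr0.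
  have {}h := h a b (lexx _) (lexx _) (fun _ ht => ltac:(by [])).
  have [s [s0 se as_ sb]] := mid a e b ab e0.
  have [s' [s'0 s'e as' sb']] := mid (- b) e' (- a) ltac:(lra) e'0.
  (* With no break point left, the values of the indicator near [a] and near [b] agree, so
     [c = 0]. *)
  have := loc a b (a + s) as_ sb h (b - s') ltac:(lra) ltac:(lra).
  rewrite ea// eb// => c0; rewrite (@integral_indic_cst a b 0)//.
    by rewrite -c0; ring.
  by move=> x ax xb; rewrite (loc a b (a + s) as_ sb h)// ea// -c0.
move=> /andP[at_ pt] lb h hj [e e0 ea] eb.
have tb : t < b.
  apply: le_lt_trans lb; case: (ts) pt => [|r ts']//= pt.
  have /allP := order_path_min (@lt_trans _ _) (pt : path <%R t (r :: ts')).
  by move=> /(_ (last r ts') (mem_last _ _))/ltW.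
have hin u v : a <= u -> v <= t -> forall x y, u < x -> x < v -> u < y -> y < v -> S x -> S y.
  move=> au vt; apply: h => //; first exact: le_trans vt (ltW tb).
  move=> r; rewrite inE => /predU1P[-> [_]|rts [_ rv]].
    by rewrite ltNge vt.
  by have /allP/(_ r rts) := order_path_min (@lt_trans _ _) pt; lra.
have [s [s0 se as_ sb]] := mid a e t at_ e0.
have Sc x : a < x -> x < t -> \1_S x = c.
  by move=> ax xt; rewrite (loc a t (a + s) as_ sb (hin _ _ (lexx _) (lexx _)))// ea.
have Iab : mu.-integrable `]a, b] (EFin \o (fun x => \1_S x * P^`().[x])).
  apply: (@integrable_indic_poly a b) => //.
  by move=> x /=; rewrite !in_itv/= => /andP[/ltW-> ->].
have bat : (BRight a <= BRight t)%O by rewrite bnd_simp ltW.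
have btb : (BRight t <= BRight b)%O by rewrite bnd_simp ltW.
have /eqP := Rintegral_itvB Iab bat btb.
rewrite subr_eq => /eqP ->; rewrite (integral_indic_cst at_ Sc).
(* Just to the right of [t] the indicator equals [c - sg t], its value before [t] minus the jump. *)
rewrite (IH t (c - sg t))//; first by rewrite big_cons; ring.
- move=> u v tu vb huv; apply: h => //; first exact: le_trans (ltW at_) tu.
  move=> r; rewrite inE => /predU1P[->|rts]; last exact: huv.
  by case; rewrite ltNge tu.
- by move=> r rts; apply: hj; rewrite inE rts orbT.
- have [e1 e10 he1] := hj t (mem_head _ _).
  exists (Num.min e1 (t - a)); first by rewrite lt_min e10 subr_gt0.
  move=> r r0; rewrite lt_min => /andP[re1 rt].
  by rewrite -(he1 r r0 re1) (Sc (t - r)) ?subKr//; lra.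
Qed.

End line_integral.

(** * Polynomials *)

Section mpoly_tools.
Context {R : realType}.
Implicit Types n : nat.

(** Used for properties of evaluation, substitution and derivation, which are compatible with sums
    and products and so only need checking on constants and variables. *)
Lemma mpoly_ring_ind n (Q : mpoly n R -> Prop) :
  (forall c, Q (mpolyC n c)) -> (forall i, Q (mpolyX R (mnm1 i))) ->
  (forall p q, Q p -> Q q -> Q (p + q)) -> (forall p q, Q p -> Q q -> Q (p * q)) ->
  forall p, Q p.
Proof.
move=> QC QX QD QM; elim/mpolyind => [|c m p _ _ Qp]; first by rewrite -mpolyC0.
apply: (QD) => //; rewrite -mul_mpolyC; apply: (QM) => //; rewrite mpolyXE_id.
have Q1 : Q 1 by rewrite -mpolyC1.
have QXn i k : Q (mpolyX R (mnm1 i) ^+ k).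
  by elim: k => [|k IH]; rewrite ?expr0// exprS; exact: QM.
apply: (big_ind Q) => // i _; exact: QXn.
Qed.

Lemma deg_leP n j (p : mpoly n R) :
  deg_le j p <-> forall m, (j < mdeg m)%N -> mcoeff m p = 0.
Proof.
split=> [pj m jm|h].
  by apply/eqP; rewrite mcoeff_eq0; apply: mmeasure_mnm_ge; exact: leq_trans jm.
rewrite /deg_le mmeasureE; apply/bigmax_leqP_seq => m mp _.
by rewrite ltnS leqNgt; apply/negP => /h/eqP; rewrite mcoeff_eq0 mp.
Qed.

Lemma deg_leW n j k (p : mpoly n R) : (j <= k)%N -> deg_le j p -> deg_le k p.
Proof. by move=> jk pj; apply: leq_trans pj _; rewrite ltnS. Qed.

Lemma deg_le0 n j : deg_le j (0 : mpoly n R).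
Proof. by rewrite /deg_le mmeasure0. Qed.

Lemma deg_leD n j (p q : mpoly n R) : deg_le j p -> deg_le j q -> deg_le j (p + q).
Proof.
move=> /deg_leP hp /deg_leP hq; apply/deg_leP => m jm.
by rewrite mcoeffD hp// hq// addr0.
Qed.

Lemma deg_leZ n j (c : R) (p : mpoly n R) : deg_le j p -> deg_le j (c *: p).
Proof.
by move=> /deg_leP hp; apply/deg_leP => m jm; rewrite mcoeffZ hp// mulr0.
Qed.

Lemma deg_leN n j (p : mpoly n R) : deg_le j p -> deg_le j (- p).
Proof. by move=> h; rewrite -scaleN1r; exact: deg_leZ. Qed.

Lemma deg_le_sum n j (I : Type) (r : seq I) (F : I -> mpoly n R) :
  (forall i, deg_le j (F i)) -> deg_le j (\sum_(i <- r) F i).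
Proof.
by move=> h; elim/big_ind: _ => // [|p q]; [exact: deg_le0|exact: deg_leD].
Qed.

Lemma deg_leM n j k (p q : mpoly n R) : deg_le j p -> deg_le k q -> deg_le (j + k) (p * q).
Proof.
rewrite /deg_le => pj qk.
have [->|p0] := eqVneq p 0; first by rewrite mul0r mmeasure0.
have [->|q0] := eqVneq q 0; first by rewrite mulr0 mmeasure0.
by rewrite msizeM// -ltnS (ltn_predK (m := 0)) ?addn_gt0 ?lt0n ?mmeasure_poly_eq0 ?p0//;
  rewrite -addnS -addSn leq_add.
Qed.

Lemma deg_leC n j (c : R) : deg_le j (mpolyC n c).
Proof. by rewrite /deg_le mmeasureC; case: (c != 0). Qed.

Lemma deg_leX n j (m : multinom n) : (mdeg m <= j)%N -> deg_le j (mpolyX R m).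
Proof. by move=> h; rewrite /deg_le mmeasureX. Qed.

Lemma deg_le_exp n j k (p : mpoly n R) : deg_le j p -> deg_le (k * j) (p ^+ k).
Proof.
move=> h; elim: k => [|k IH]; first by rewrite expr0 -mpolyC1; exact: deg_leC.
by rewrite exprS mulSn; exact: deg_leM.
Qed.

Lemma deg_le_mderiv n j i (p : mpoly n R) : deg_le j.+1 p -> deg_le j (mderiv i p).
Proof.
move=> /deg_leP h; apply/deg_leP => m jm; rewrite mcoeff_deriv h ?mul0rn//.
by rewrite mdegD mdeg1 addn1.
Qed.

(** If [m] has a positive exponent at [i], its coefficient survives in the derivative along [i],
    multiplied by an exponent that is nonzero in [R]. *)
Lemma mderiv_eq0_const n (p : mpoly n R) :
  (forall i, mderiv i p = 0) -> deg_le 0 p.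
Proof.
move=> h; apply/deg_leP => m m0.
have [i mi] : exists i, (0 < fun_of_multinom m i)%N.
  apply/not_existsP => hm; move: m0; rewrite mdegE big1// => i _.
  by apply/eqP; rewrite -leqn0 leqNgt; apply/negP; exact: hm.
have := congr1 (mcoeff (mnm_sub m (mnm1 i))) (h i).
rewrite mcoeff_deriv mcoeff0 submK; last by rewrite lep1mP -lt0n.
by move/eqP; rewrite mulrn_eq0 => /orP[//|/eqP].
Qed.

Lemma pevD n (p q : mpoly n R) x : pev (p + q) x = pev p x + pev q x.
Proof. exact: mevalD. Qed.
Lemma pevM n (p q : mpoly n R) x : pev (p * q) x = pev p x * pev q x.
Proof. exact: mevalM. Qed.
Lemma pevC n c (x : 'rV[R]_n) : pev (mpolyC n c) x = c.
Proof. exact: mevalC. Qed.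
Lemma pevX n i (x : 'rV[R]_n) : pev (mpolyX R (mnm1 i)) x = x 0 i.
Proof. exact: mevalXU. Qed.
Lemma pevZ n c (p : mpoly n R) x : pev (c *: p) x = c * pev p x.
Proof. exact: mevalZ. Qed.
Lemma pev0 n (x : 'rV[R]_n) : pev (0 : mpoly n R) x = 0.
Proof. exact: meval0. Qed.
Lemma pev_sum n (I : Type) (r : seq I) (F : I -> mpoly n R) x :
  pev (\sum_(i <- r) F i) x = \sum_(i <- r) pev (F i) x.
Proof. by elim/big_rec2: _ => [|i a p _ <-]; [exact: pev0|rewrite pevD]. Qed.

Lemma continuous_pev n (p : mpoly n R) : continuous (pev p).
Proof.
elim/mpoly_ring_ind: p => [c|i|p q cp cq|p q cp cq].
- rewrite (_ : pev _ = cst c); first exact: cst_continuous.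
  by apply/funext => x; exact: pevC.
- rewrite (_ : pev _ = fun x : 'rV[R]_n => x 0 i); first exact: coord_continuous.
  by apply/funext => x; exact: pevX.
- rewrite (_ : pev _ = fun x => pev p x + pev q x); first exact: continuous_add.
  by apply/funext => x; exact: pevD.
- rewrite (_ : pev _ = fun x => pev p x * pev q x); first exact: continuous_mul.
  by apply/funext => x; exact: pevM.
Qed.

(** The restriction of [p] to the line over [y] parallel to axis [i], as a polynomial in the
    inserted coordinate. *)
Definition line_poly n (i : 'I_n.+1) (y : 'rV[R]_n) (p : mpoly n.+1 R) : {poly R} :=
  mmap (@polyC R) (fun j => if unlift i j is Some k then (y 0 k)%:P else 'X) p.

Lemma line_polyX n (i : 'I_n.+1) (y : 'rV[R]_n) j :
  line_poly i y (mpolyX R (mnm1 j)) = if unlift i j is Some k then (y 0 k)%:P else 'X.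
Proof. by rewrite /line_poly mmapX mmap1U. Qed.

Lemma line_polyM n (i : 'I_n.+1) (y : 'rV[R]_n) p q :
  line_poly i y (p * q) = line_poly i y p * line_poly i y q.
Proof. exact: rmorphM. Qed.

Lemma horner_line_poly n (i : 'I_n.+1) y t (p : mpoly n.+1 R) :
  (line_poly i y p).[t] = pev p (insert_coord i t y).
Proof.
elim/mpoly_ring_ind: p => [c|j|p q hp hq|p q hp hq].
- by rewrite /line_poly mmapC hornerC pevC.
- rewrite line_polyX pevX; case: (unliftP i j) => [k|] ->.
    by rewrite hornerC insert_coord_lift.
  by rewrite hornerX insert_coord_eq.
- by rewrite /line_poly mmapD hornerD pevD -hp -hq.
- by rewrite line_polyM hornerM pevM -hp -hq.
Qed.

Lemma deriv_line_poly n (i : 'I_n.+1) y (p : mpoly n.+1 R) :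
  (line_poly i y p)^`() = line_poly i y (mderiv i p).
Proof.
elim/mpoly_ring_ind: p => [c|j|p q hp hq|p q hp hq].
- by rewrite mderivC /line_poly mmapC derivC mmap0.
- rewrite line_polyX mderivX mnm1E; case: (unliftP i j) => [k|] ->.
    by rewrite derivC (eq_sym (lift i k)) (negbTE (neq_lift _ _)) scale0r /line_poly mmap0.
  rewrite eqxx scale1r derivX (_ : mnm_sub _ _ = mnm0) ?mpolyX0 ?/line_poly.
    by rewrite -mpolyC1 mmapC.
  by apply/mnmP => k; rewrite mnmBE subnn mnm0E.
- by rewrite mderivD /line_poly !mmapD derivD -!/(line_poly _ _ _) hp hq.
- rewrite mderivM line_polyM derivM hp hq -!line_polyM /line_poly mmapD.
  by [].
Qed.

(** The composite of [p] with [u |-> u *m M + b]. Through it the trace on a face is a polynomial in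
    the chart coordinates, of no larger degree. *)
Definition affine_comp m n (M : 'M[R]_(m, n)) (b : 'rV[R]_n) (p : mpoly n R) : mpoly m R :=
  mmap (@mpolyC m R) (fun j : 'I_n => \sum_i M i j *: mpolyX R (mnm1 i) + mpolyC m (b 0 j)) p.

Lemma pev_affine_comp m n (M : 'M[R]_(m, n)) (b : 'rV[R]_n) (p : mpoly n R) u :
  pev (affine_comp M b p) u = pev p (u *m M + b).
Proof.
elim/mpoly_ring_ind: p => [c|j|p q hp hq|p q hp hq].
- by rewrite /affine_comp mmapC !pevC.
- rewrite /affine_comp mmapX mmap1U pevD pevC pevX !mxE; congr (_ + _).
  by rewrite pev_sum; apply: eq_bigr => i _; rewrite pevZ pevX mulrC.
- by rewrite /affine_comp mmapD !pevD -hp -hq.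
- by rewrite /affine_comp rmorphM/= !pevM -hp -hq.
Qed.

Lemma deg_le_affine_comp m n (M : 'M[R]_(m, n)) (b : 'rV[R]_n) j (p : mpoly n R) :
  deg_le j p -> deg_le j (affine_comp M b p).
Proof.
move=> /deg_leP hp; rewrite (mpolyE p) /affine_comp raddf_sum /=.
apply: deg_le_sum => a; rewrite mmapZ.
have [aj|/hp->] := leqP (mdeg a) j; last by rewrite raddf0 mul0r; exact: deg_le0.
rewrite /= mul_mpolyC; apply: deg_leZ; rewrite mmapX; apply: (deg_leW aj).
rewrite mdegE /mmap1; elim/big_rec2: _ => [|i q k _ IH].
  by rewrite -mpolyC1; exact: deg_leC.
apply: deg_leM => //; rewrite -[X in deg_le X]muln1; apply: deg_le_exp.
apply: deg_leD; last exact: deg_leC.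
by apply: deg_le_sum => i'; apply: deg_leZ; apply: deg_leX; rewrite mdeg1.
Qed.

(** Induction on the degree. On a line through a point of [U] the polynomial has more roots than its
    degree, so all partial derivatives vanish on [U]; by induction they are zero and [p] is
    constant. *)
Lemma pev_eq0_open n (U : set 'rV[R]_n) (p : mpoly n R) :
  open U -> U !=set0 -> (forall x, U x -> pev p x = 0) -> p = 0.
Proof.
move=> oU [x0 Ux0].
have const j : deg_le 0 p -> (forall x, U x -> pev p x = 0) -> p = 0.
  move=> /msize1_polyC -> /(_ _ Ux0); rewrite pevC => ->; exact: mpolyC0.
have [s] : exists s, deg_le s p by exists (mmeasure mdeg p); rewrite /deg_le.
elim: s p {const} => [|s IH] p ps p0.
  by move: p0 => /(_ _ Ux0); rewrite (msize1_polyC ps) pevC => ->; exact: mpolyC0.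
have d0 i : mderiv i p = 0.
  apply: IH; first exact: deg_le_mderiv.
  move=> x Ux; have n0 : (0 < n)%N by case: (n) i => // -[].
  case: n n0 U oU x0 Ux0 p ps p0 i x Ux => // n _ U oU x0 Ux0 p ps p0 i x Ux.
  suff L0 : line_poly i (col' i x) p = 0.
    by rewrite -(insert_coordK i x) -horner_line_poly -deriv_line_poly L0 deriv0 horner0.
  have /nbhs_ballP[r /= r0 xrU] : nbhs x U by exact: open_nbhs_nbhs.
  apply/eqP/negPn/negP => L0.
  (* Pairwise distinct points on the line; the denominators start at 2 so that all lie strictly
     inside the ball of radius [r]. *)
  pose c k : R := x 0 i + r / (k.+2)%:R.
  have := max_poly_roots L0 (rs := [seq c k | k <- iota 0 (size (line_poly i (col' i x) p))]).
  rewrite size_map size_iota ltnn => h; suff : false by []; apply: h.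
    apply/allP => _ /mapP[k _ ->]; rewrite /root horner_line_poly p0//.
    apply: xrU; apply/rV_ballP => // j; case: (unliftP i j) => [l|] ->.
      by rewrite insert_coord_lift mxE subrr normr0.
    rewrite insert_coord_eq /c opprD addrA subrr sub0r normrN ger0_norm; last first.
      by rewrite divr_ge0// ltW.
    by rewrite ltr_pdivrMr// ltr_pMr// ltr1n.
  rewrite map_inj_uniq ?iota_uniq// => k l /addrI /(mulfI (lt0r_neq0 r0)) /invr_inj.
  by move=> /eqP; rewrite eqr_nat => /eqP[].
by move: p0 => /(_ _ Ux0); rewrite (msize1_polyC (mderiv_eq0_const d0)) pevC => ->; exact: mpolyC0.
Qed.

End mpoly_tools.

(** * Polytopes and negligible sets *)

Section dot_product.
Context {R : realType}.

Lemma dotpE n (a x : 'rV[R]_n) : dotp a x = (a *m x^T) 0 0.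
Proof. by rewrite /dotp mxE; apply: eq_bigr => i _; rewrite mxE. Qed.

Lemma dotpC n (a x : 'rV[R]_n) : dotp a x = dotp x a.
Proof. by apply: eq_bigr => i _; rewrite mulrC. Qed.

Lemma dotpDr n (a x y : 'rV[R]_n) : dotp a (x + y) = dotp a x + dotp a y.
Proof. by rewrite !dotpE linearD mulmxDr mxE. Qed.

Lemma dotpZr n (a x : 'rV[R]_n) c : dotp a (c *: x) = c * dotp a x.
Proof. by rewrite !dotpE linearZ -scalemxAr mxE. Qed.

Lemma dotpNr n (a x : 'rV[R]_n) : dotp a (- x) = - dotp a x.
Proof. by rewrite -scaleN1r dotpZr mulN1r. Qed.

Lemma dotpBr n (a x y : 'rV[R]_n) : dotp a (x - y) = dotp a x - dotp a y.
Proof. by rewrite dotpDr dotpNr. Qed.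

Lemma dot0p n (x : 'rV[R]_n) : dotp 0 x = 0.
Proof. by rewrite dotpE mul0mx mxE. Qed.

Lemma dotp_ge0 n (x : 'rV[R]_n) : 0 <= dotp x x.
Proof. by apply: sumr_ge0 => i _; rewrite -expr2 sqr_ge0. Qed.

Lemma dotp_eq0 n (x : 'rV[R]_n) : (dotp x x == 0) = (x == 0).
Proof.
apply/idP/eqP => [/eqP/psumr_eq0P h|->]; last by rewrite dot0p.
apply/rowP => i; rewrite mxE; apply/eqP; rewrite -sqrf_eq0 expr2.
by rewrite h// => j _; rewrite -expr2 sqr_ge0.
Qed.

Lemma dotp_mulmx m n (a : 'rV[R]_n) (x : 'rV[R]_m) (M : 'M[R]_(m, n)) :
  dotp a (x *m M) = dotp (a *m M^T) x.
Proof. by rewrite !dotpE trmx_mul mulmxA. Qed.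

Lemma nbhs_line n (z e : 'rV[R]_n) (U : set 'rV[R]_n) : nbhs z U ->
  exists2 r : R, 0 < r & forall t, `|t| < r -> U (z + t *: e).
Proof.
move=> /nbhs_ballP[r /= r0 zr]; pose M := 1 + `|e|.
have M0 : 0 < M by rewrite ltr_pwDl.
exists (r / M) => [|t tr]; first by rewrite divr_gt0.
apply: zr; apply/rV_ballP => // i; rewrite !mxE opprD addrA subrr sub0r normrN normrM.
apply: (@le_lt_trans _ _ (`|t| * M)); last by rewrite -ltr_pdivlMr.
by rewrite ler_wpM2l// /M (le_trans (coord_le_norm e i))// lerDr.
Qed.

End dot_product.

Section thin_sets.
Context {R : realType}.

(** Covered by finitely many hyperplanes. This algebraic form transports along affine maps by
    transforming the normals, with no measure theory. *)
Definition thin n (A : set 'rV[R]_n) : Prop :=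
  exists2 s : seq ('rV[R]_n * R), (forall h, h \in s -> h.1 != 0) &
    forall x, A x -> exists2 h, h \in s & dotp h.1 x = h.2.

Lemma thinS n (A B : set 'rV[R]_n) : A `<=` B -> thin B -> thin A.
Proof. by move=> AB [s s0 sB]; exists s => // x /AB /sB. Qed.

Lemma thinU n (A B : set 'rV[R]_n) : thin A -> thin B -> thin (A `|` B).
Proof.
move=> [s s0 sA] [r r0 rB]; exists (s ++ r) => [h|x].
  by rewrite mem_cat => /orP[/s0|/r0].
by case=> [/sA|/rB] [h hs hx]; exists h => //; rewrite mem_cat hs ?orbT.
Qed.

Lemma thin0 n : thin (@set0 'rV[R]_n).
Proof. by exists [::]. Qed.

Lemma thin_bigcup n (I : finType) (F : I -> set 'rV[R]_n) (P : set I) :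
  (forall i, P i -> thin (F i)) -> thin (\bigcup_(i in P) F i).
Proof.
move=> tF; suff h (r : seq I) : thin [set x | exists2 i, i \in r & P i /\ F i x].
  by apply: thinS (h (enum I)) => x [i Pi Fx]; exists i; rewrite ?mem_enum.
elim: r => [|i r IH]; first by apply: thinS (thin0 n) => x [].
have tFi : thin [set x | P i /\ F i x].
  have [/tF|nP] := pselect (P i); first by apply: thinS => x [].
  by apply: thinS (thin0 n) => x [].
apply: thinS (thinU tFi IH) => x [j]; rewrite inE => /predU1P[->|jr] h; first by left.
by right; exists j.
Qed.

Lemma thin_hyperplane n (a : 'rV[R]_n) c : a != 0 -> thin [set x | dotp a x = c].
Proof.
move=> a0; exists [:: (a, c)] => [h|x h]; first by rewrite inE => /eqP->.
by exists (a, c); rewrite ?inE.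
Qed.

(** The hypothesis says [N *m M = 1%:M], so the map is surjective and a nonzero normal pulls back to
    a nonzero normal. *)
Lemma thin_preimage m n (M : 'M[R]_(m, n)) (b : 'rV[R]_n) (N : 'M[R]_(n, m)) A :
  M^T *m N^T = 1%:M -> thin A -> thin ((fun x => x *m M + b) @^-1` A).
Proof.
move=> MN [s s0 sA].
exists [seq (h.1 *m M^T, h.2 - dotp h.1 b) | h <- s] => [_ /mapP[h hs ->]|x /= /sA[h hs hx]].
  apply: contra_neq (s0 _ hs) => /= h0.
  by rewrite -[h.1]mulmx1 -MN mulmxA h0 mul0mx.
exists (h.1 *m M^T, h.2 - dotp h.1 b); first by apply/mapP; exists h.
by rewrite /= -dotp_mulmx -hx dotpDr addrK.
Qed.

Lemma thin_preimage_unit n (M : 'M[R]_n) (b : 'rV[R]_n) A :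
  M \in unitmx -> thin A -> thin ((fun x => x *m M + b) @^-1` A).
Proof.
move=> uM; apply: (@thin_preimage _ _ _ _ (invmx M)).
by rewrite -trmx_mul mulVmx// trmx1.
Qed.

Lemma thin_negligible n (A : set 'rV[R]_n) : thin A ->
  exists N, [/\ measurable N, lebesgue_rV R n N = 0%E & A `<=` N].
Proof.
move=> [s s0 sA]; exists [set x | exists2 h, h \in s & dotp h.1 x = h.2].
have E (r : seq ('rV[R]_n * R)) : {subset r <= s} ->
    measurable [set x : 'rV[R]_n | exists2 h, h \in r & dotp h.1 x = h.2] /\
    lebesgue_rV R n [set x | exists2 h, h \in r & dotp h.1 x = h.2] = 0%E.
  elim: r => [|h r IH] rs.
    rewrite (_ : [set x | _] = set0); first by rewrite measure0; split.
    by apply/seteqP; split=> x // -[].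
  have rs' : {subset r <= s} by move=> h' h'r; apply: (rs); rewrite inE h'r orbT.
  have [mr r0] := IH rs'.
  rewrite (_ : [set x | _] = [set x | dotp h.1 x = h.2] `|`
     [set x | exists2 h, h \in r & dotp h.1 x = h.2]); last first.
    apply/seteqP; split=> x.
      by case=> h'; rewrite inE => /predU1P[->|h'r] hx; [left|right; exists h'].
    by case=> [hx|[h' h'r hx]]; [exists h|exists h'] => //; rewrite inE ?eqxx// h'r orbT.
  have mh := measurable_hyperplane h.1 h.2; split; first exact: measurableU.
  rewrite measureU0//; apply: lebesgue_rV_hyperplane.
  by apply: s0; apply: (rs); exact: mem_head.
have [mN N0] := E s (fun _ => id); split => //.
Qed.

Lemma thin_open_avoid n (A U : set 'rV[R]_n) : thin A -> open U -> U !=set0 ->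
  exists2 x, U x & ~ A x.
Proof.
move=> /thin_negligible[N [mN N0 AN]] oU U0; apply: contrapT => h.
have UN : U `<=` N.
  move=> x Ux; apply: AN; apply: contrapT => nA; apply: h; by exists x.
have := lebesgue_rV_open_gt0 oU U0; rewrite ltNge; apply/negP/negPn.
by rewrite -N0; apply: le_measure => //; rewrite inE//; exact: open_measurable_rV.
Qed.

End thin_sets.

Section polytopes.
Context {R : realType} {n : nat}.
Implicit Types (P : set 'rV[R]_n) (H : seq ('rV[R]_n * R)).

Lemma open_halfspaces H : open [set x | forall h, h \in H -> dotp h.1 x < h.2].
Proof.
elim: H => [|h H IH].
  by rewrite (_ : [set x | _] = setT); [exact: openT|apply/seteqP; split].
rewrite (_ : [set x | _] = [set x | dotp h.1 x < h.2] `&`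
   [set x | forall h, h \in H -> dotp h.1 x < h.2]).
  apply: openI => //; apply: (@open_comp _ _ (dotp h.1) [set c | c < h.2]).
    by move=> x _; exact: dotp_continuous.
  exact: open_lt.
apply/seteqP; split=> x /=.
  by move=> hx; split=> [|h' h'H]; apply: hx; rewrite inE ?eqxx// h'H orbT.
by move=> [hx Hx] h'; rewrite inE => /predU1P[->//|/Hx].
Qed.

Lemma closed_closed_polyhedron H : closed (closed_polyhedron H).
Proof.
elim: H => [|h H IH].
  by rewrite (_ : closed_polyhedron _ = setT); [exact: closedT|apply/seteqP; split].
rewrite (_ : closed_polyhedron _ = [set x | dotp h.1 x <= h.2] `&` closed_polyhedron H).
  apply: closedI => //; apply: (@preimage_closed _ _ (dotp h.1) [set c | c <= h.2]).
    by move=> x _; exact: dotp_continuous.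
  exact: closed_le.
apply/seteqP; split=> x /=.
  by move=> hx; split=> [|h' h'H]; apply: hx; rewrite inE ?eqxx// h'H orbT.
by move=> [hx Hx] h'; rewrite inE => /predU1P[->//|/Hx].
Qed.

Lemma polytope_closed P : polytope P -> closed P.
Proof.
move=> [_ _ _ [Hs _ ->]].
elim: Hs => [|H Hs IH].
  by rewrite (_ : [set x | _] = set0); [exact: closed0|apply/seteqP; split=> x // -[]].
rewrite (_ : [set x | _] = closed_polyhedron H `|`
   [set x | exists2 H, H \in Hs & closed_polyhedron H x]).
  by apply: closedU => //; exact: closed_closed_polyhedron.
apply/seteqP; split=> x /=.
  by case=> H'; rewrite inE => /predU1P[->|H'H] hx; [left|right; exists H'].
by case=> [hx|[H' H'H hx]]; [exists H|exists H'] => //; rewrite inE ?eqxx// H'H orbT.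
Qed.

(** If equality held, a small move in the direction [h.1] would leave the half-space. *)
Lemma interior_polyhedron_lt H z : interior (closed_polyhedron H) z ->
  forall h, h \in H -> h.1 != 0 -> dotp h.1 z < h.2.
Proof.
move=> iz h hH h0; have [r r0 zr] := nbhs_line h.1 iz.
have r2 : `|r / 2| < r by rewrite gtr0_norm ?divr_gt0// ltr_pdivrMr// ltr_pMr// ltr1n.
have := zr _ r2 h hH; rewrite dotpDr dotpZr; apply: lt_le_trans.
by rewrite ltrDl mulr_gt0 ?divr_gt0// lt_def dotp_eq0 h0 dotp_ge0.
Qed.

(** A constraint with zero normal does not depend on the point; the witness [y] shows that it holds
    everywhere. *)
Lemma lt_interior_polyhedron H z y : interior (closed_polyhedron H) y ->
  (forall h, h \in H -> h.1 != 0 -> dotp h.1 z < h.2) ->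
  interior (closed_polyhedron H) z.
Proof.
move=> /interior_subset Hy Hz.
pose H' := [seq h <- H | h.1 != 0].
have : nbhs z [set x | forall h, h \in H' -> dotp h.1 x < h.2].
  apply: open_nbhs_nbhs; split; first exact: open_halfspaces.
  by move=> h; rewrite mem_filter => /andP[h0 hH]; exact: Hz.
apply: filterS => x Hx h hH.
have [h0|h0] := eqVneq h.1 0.
  by have := Hy h hH; rewrite h0 !dot0p.
by apply/ltW/Hx; rewrite mem_filter h0.
Qed.

Lemma polytope_interior_neq0 P : polytope P -> interior P !=set0.
Proof.
move=> [[x Px] _ _ [Hs iHs PE]]; move: Px; rewrite PE => -[H HHs _].
have [y yH] := iHs _ HHs; exists y; apply: (@interiorS _ (closed_polyhedron H)) yH.
by move=> z zH; exists H.
Qed.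

(** [x] lies in a convex piece with an interior point [y]; moving slightly from [x] towards [y]
    makes all constraints with nonzero normal strict. *)
Lemma polytope_closure_interior P x : polytope P -> P x -> closure (interior P) x.
Proof.
move=> [_ _ _ [Hs iHs PE]]; rewrite PE => -[H HHs xH] B /nbhs_line.
have [y yH] := iHs _ HHs => /(_ (y - x))[r r0 xrB].
pose s := Num.min 1 (r / 2).
have s0 : 0 < s by rewrite lt_min ltr01 divr_gt0.
have s1 : s <= 1 by rewrite ge_min lexx.
have sr : s < r by rewrite gt_min ltr_pdivrMr// ltr_pMr ?ltr1n ?orbT.
exists (x + s *: (y - x)); split; last by apply: xrB; rewrite gtr0_norm.
apply: (@interiorS _ (closed_polyhedron H)) => [z zH|]; first by exists H.
apply: (lt_interior_polyhedron yH) => h hH h0.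
have := interior_polyhedron_lt yH hH h0; have := xH h hH.
rewrite dotpDr dotpZr dotpBr; nra.
Qed.

(** A point of a convex piece lying on none of its bounding hyperplanes is interior to that piece,
    hence to [P]. *)
Lemma polytope_boundary_thin P : polytope P -> thin (P `\` interior P).
Proof.
move=> [_ _ _ [Hs iHs PE]].
exists [seq h <- flatten Hs | h.1 != 0] => [h|x]; first by rewrite mem_filter => /andP[].
rewrite PE => -[[H HHs xH] nix]; apply: contrapT => nh; apply: nix.
have [y yH] := iHs _ HHs.
apply: (@interiorS _ (closed_polyhedron H)) => [z zH|]; first by exists H.
apply: (lt_interior_polyhedron yH) => h hH h0.
rewrite lt_neqAle xH// andbT; apply/eqP => hx; apply: nh; exists h => //.
by rewrite mem_filter h0; apply/flattenP; exists H.
Qed.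

End polytopes.

Section frames.
Context {R : realType} {n : nat}.
Implicit Types (F : 'M[R]_(n, n.+1)) (nu : 'rV[R]_n.+1).

(** Equivalently, stacking [nu] on [F] gives an orthogonal matrix. *)
Definition is_frame F nu := [/\ F *m F^T = 1%:M, F *m nu^T = 0 & dotp nu nu = 1].

Lemma frame_mul_tr F nu : is_frame F nu ->
  (col_mx nu F : 'M[R]_(1 + n)) *m (col_mx nu F : 'M[R]_(1 + n))^T = 1%:M.
Proof.
move=> [FF Fnu nn]; rewrite (@tr_col_mx _ 1 n (1 + n)) (@mul_col_row _ 1 n (1 + n) 1 n).
rewrite FF Fnu (_ : nu *m nu^T = 1%:M); last first.
  by apply/rowP => i; rewrite !ord1 -dotpE nn mxE eqxx.
rewrite (_ : nu *m F^T = 0); first by rewrite -scalar_mx_block.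
by apply: trmx_inj; rewrite trmx_mul trmxK Fnu trmx0.
Qed.

(** Resolution of the identity into the projections onto the hyperplane and onto its normal. *)
Lemma frame_decomp F nu : is_frame F nu -> F^T *m F + nu^T *m nu = 1%:M.
Proof.
move=> /frame_mul_tr/mulmx1C; rewrite (@tr_col_mx _ 1 n (1 + n)).
by rewrite (@mul_row_col _ (1 + n) 1 n (1 + n)) addrC.
Qed.

Lemma dotp_frame F nu (u : 'rV[R]_n) : is_frame F nu -> dotp nu (u *m F) = 0.
Proof.
move=> [_ Fnu _]; rewrite dotp_mulmx (_ : nu *m F^T = 0) ?dot0p//.
by apply: trmx_inj; rewrite trmx_mul trmxK Fnu trmx0.
Qed.

Lemma frame_hyperplane F nu (x : 'rV[R]_n.+1) : is_frame F nu -> dotp nu x = 0 ->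
  x *m F^T *m F = x.
Proof.
move=> fr nx; rewrite -mulmxA -[RHS]mulmx1 -(frame_decomp fr) mulmxDr.
rewrite [x *m (nu^T *m nu)]mulmxA (_ : x *m nu^T = 0) ?mul0mx ?addr0//.
by apply/rowP => i; rewrite !ord1 -dotpE dotpC nx mxE.
Qed.

(** The Jacobian of the projection of a face along axis [i]. For an orthogonal matrix the adjugate
    is the determinant times the transpose, so the cofactor of an entry is that entry up to sign. *)
Lemma det_frame_col' F nu i : is_frame F nu -> `|\det (col' i F)| = `|nu 0 i|.
Proof.
move=> fr; set O : 'M[R]_n.+1 := (col_mx nu F : 'M[R]_(1 + n)).
have OO : O *m O^T = 1%:M := frame_mul_tr fr.
have dO : `|\det O| = 1.
  have := congr1 determinant OO; rewrite det_mulmx det_tr det1 -expr2 => h.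
  by apply/eqP; rewrite -(@eqrXn2 _ 2)// real_normK ?num_real// h expr1n.
have adjO : \adj O = \det O *: O^T.
  by rewrite -[LHS]mulmx1 -OO mulmxA mul_adj_mx mul_scalar_mx.
have := congr1 (fun A : 'M[R]_n.+1 => A i ord0) adjO.
rewrite mxE /cofactor [RHS]mxE [(O^T) i ord0]mxE.
rewrite (_ : O ord0 i = nu 0 i); last first.
  transitivity (O (lshift n (0 : 'I_1)) i); last exact: col_mxEu.
  by congr (O _ _); exact: val_inj.
rewrite (_ : row' ord0 (col' i O) = col' i F); last first.
  apply/matrixP => a b; rewrite [LHS]mxE [(col' i O) _ _]mxE [RHS]mxE.
  transitivity (O (rshift 1 a) (lift i b)); last exact: col_mxEd.
  by congr (O _ _); exact: val_inj.
move=> /(congr1 Num.norm); rewrite !normrM dO mul1r normrX normrN normr1 expr1n mul1r.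
by [].
Qed.

(** Transversal hyperplanes meet in a hyperplane of the chart, and parallel distinct ones do not
    meet. In a common hyperplane the two charts differ by an isometry, and disjointness of the
    relative interiors pushes the overlap into the thin boundary of [D']. *)
Lemma frame_overlap_thin F nu p (D : set 'rV[R]_n) F' nu' p' (D' : set 'rV[R]_n) :
  is_frame F nu -> is_frame F' nu' -> polytope D' ->
  (forall u v, interior D u -> interior D' v -> p + u *m F <> p' + v *m F') ->
  thin [set u | interior D u /\ exists2 v, D' v & p' + v *m F' = p + u *m F].
Proof.
move=> fr fr' pD' disj; pose a := nu' *m F^T.
have key u v : p' + v *m F' = p + u *m F -> dotp a u = dotp nu' (p' - p).
  move=> h; rewrite -dotp_mulmx; have -> : u *m F = (p' - p) + v *m F'.
    by apply: (addrI p); rewrite -h addrA [p + _]addrC subrK.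
  by rewrite dotpDr (dotp_frame _ fr') addr0.
have [a0|a0] := eqVneq a 0; last first.
  apply: thinS (thin_hyperplane (dotp nu' (p' - p)) a0) => u [_ [v _ /key]]; exact.
have [c0|c0] := eqVneq (dotp nu' (p' - p)) 0; last first.
  apply: thinS (thin0 n) => u [_ [v _ /key]]; rewrite a0 dot0p => /esym/eqP.
  by rewrite (negbTE c0).
have sol u : p' + ((u *m F + (p - p')) *m F'^T) *m F' = p + u *m F.
  rewrite (frame_hyperplane fr'); last first.
    by rewrite dotpDr dotp_mulmx -/a a0 dot0p add0r -opprB dotpNr c0 oppr0.
  by rewrite addrC -addrA subrK addrC.
(* The change of chart within the common hyperplane. *)
pose Q := F *m F'^T; pose b := (p - p') *m F'^T.
have QQ : Q *m Q^T = 1%:M.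
  rewrite /Q trmx_mul trmxK mulmxA -[F *m F'^T *m F']mulmxA.
  have -> : F'^T *m F' = 1%:M - nu'^T *m nu' by rewrite -(frame_decomp fr') addrK.
  rewrite mulmxBr mulmx1 mulmxBl; case: fr => -> _ _; rewrite mulmxA -mulmxA.
  by rewrite -[nu' *m F^T]/a a0 mulmx0 subr0.
have uQ : Q \in unitmx by case: (mulmx1_unit QQ).
apply: thinS (thin_preimage_unit b uQ (polytope_boundary_thin pD')) => u [iu [v Dv]].
move=> h; have vE : v = u *m Q + b.
  have : v *m F' = (u *m F + (p - p')).
    by apply: (addrI p'); rewrite h addrCA [p' + _]addrC subrK addrC.
  move=> /(congr1 (mulmxr F'^T)) /=; rewrite -mulmxA; case: (fr') => -> _ _.
  by rewrite mulmx1 mulmxDl -mulmxA.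
rewrite /preimage/= -vE; split=> // iv; exact: (disj u v).
Qed.

End frames.

(** * Geometry of the mesh *)

Section mesh_geometry.
Context {R : realType} {n : nat}.
Variables (M : mesh R n.+1) (Om : set 'rV[R]_n.+1).
Hypothesis dec : is_decomposition M Om.
Implicit Types (K : cell M) (E : face M).
Local Notation F E := (face_frame (face_geo E) : 'M[R]_(n, n.+1)).
Local Notation org E := (face_origin (face_geo E)).
Local Notation dom E := (face_dom (face_geo E) : set 'rV[R]_n).
Local Notation chart E := (face_chart (face_geo E)).
Local Notation fset E := (face_set (face_geo E)).

Lemma cell_polytope K : polytope (cell_set K). Proof. by case: dec. Qed.

Lemma dom_polytope E : polytope (dom E).
Proof. by case: dec => _ [/(_ E)[]]. Qed.

Lemma face_of_exists E : exists K, face_of K E.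
Proof. by case: dec => _ [_ [_ [_ [/(_ E)]]]]. Qed.

Lemma closure_domain : closure Om = \bigcup_(K in [set: cell M]) cell_set K.
Proof. by case: dec => _ [_ []]. Qed.

Lemma cell_int_disjoint K K' x : cell_int K x -> cell_int K' x -> K = K'.
Proof.
move=> Kx K'x; apply/eqP/negPn/negP => KK'.
case: dec => _ [_ [_ [/(_ K K' KK') h _]]].
by have : set0 x by rewrite -h.
Qed.

Lemma boundary_cell K x : boundary (cell_set K) x <-> exists2 E, face_of K E & fset E x.
Proof.
by case: dec => _ [_ [_ [_ [_ [/(_ K) h _]]]]]; rewrite h.
Qed.

Lemma relint_disjoint E E' u v : E != E' -> interior (dom E) u -> interior (dom E') v ->
  chart E u <> chart E' v.
Proof.
move=> EE' iu iv h; case: dec => _ [_ [_ [_ [_ [_ [/(_ _ _ EE') h0 _]]]]]].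
have : set0 (chart E u) by rewrite -h0; split; [exists u|rewrite h; exists v].
by [].
Qed.

Lemma cell_normal K E : face_of K E -> outward_normal (cell_set K) (face_geo E) (normal K E).
Proof. by case: dec => _ [_ [_ [_ [_ [_ [_ h]]]]]]; exact: h. Qed.

Lemma cell_frame K E : face_of K E -> is_frame (F E) (normal K E).
Proof.
move=> KE; have [n1 Fn _] := cell_normal KE; case: dec => _ [/(_ E)[FF _] _].
split => //; move: n1; rewrite /enorm => /(congr1 (fun x => x ^+ 2)).
by rewrite sqr_sqrtr ?dotp_ge0// expr1n.
Qed.

Lemma boundary_cellE K x : boundary (cell_set K) x <-> cell_set K x /\ ~ cell_int K x.
Proof.
rewrite /boundary; have /closure_id <- := polytope_closed (cell_polytope K).
by [].
Qed.

Lemma face_hyperplane K E x u : face_of K E -> fset E x ->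
  dotp (normal K E) (x - chart E u) = 0.
Proof.
move=> /cell_frame fr [v _ <-]; rewrite /face_chart opprD addrACA subrr add0r -mulmxBl.
exact: dotp_frame.
Qed.

Lemma chart_continuous E : continuous (chart E).
Proof.
rewrite (_ : chart E = fun u => u *m F E + org E); first exact: continuous_affine_rV.
by apply/funext => u; rewrite /face_chart addrC.
Qed.

Lemma face_setE K E x : face_of K E ->
  fset E x <-> dotp (normal K E) x = dotp (normal K E) (org E) /\
               dom E (x *m (F E)^T - org E *m (F E)^T).
Proof.
move=> /cell_frame fr; split=> [[u Du <-]|[nx Dx]].
  rewrite /face_chart dotpDr (dotp_frame _ fr) addr0; split => //.
  by rewrite mulmxDl addrAC subrr add0r -mulmxA; case: (fr) => -> _ _; rewrite mulmx1.
exists (x *m (F E)^T - org E *m (F E)^T) => //.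
rewrite /face_chart -mulmxBl (frame_hyperplane fr) ?dotpBr ?nx ?subrr//.
by rewrite addrC subrK.
Qed.

Lemma face_set_closed E : closed (fset E).
Proof.
have [K KE] := face_of_exists E.
rewrite (_ : fset E = [set x | dotp (normal K E) x = dotp (normal K E) (org E)] `&`
   ((fun x => x *m (F E)^T - org E *m (F E)^T) @^-1` dom E)); last first.
  by apply/seteqP; split=> x /(face_setE _ KE).
apply: closedI.
  apply: (@preimage_closed _ _ (dotp (normal K E)) [set c | c = _]).
    by move=> x _; exact: dotp_continuous.
  exact: closed_eq.
apply: preimage_closed; last exact: polytope_closed (dom_polytope E).
by move=> x _; exact: continuous_affine_rV.
Qed.

(** At such a point the mesh looks like a single hyperplane: no other face comes near. *)
Definition generic_face_point E (u : 'rV[R]_n) :=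
  interior (dom E) u /\ forall E', E' != E -> ~ fset E' (chart E u).

Lemma nongeneric_thin E : thin [set u | dom E u /\ ~ generic_face_point E u].
Proof.
apply: (@thinS _ _ _ ((dom E `\` interior (dom E)) `|`
  \bigcup_(E' in [set E' | E' != E])
    [set u | interior (dom E) u /\ exists2 v, dom E' v & org E' + v *m F E' = org E + u *m F E])).
  move=> u [Du ng]; have [iu|niu] := pselect (interior (dom E) u); last by left.
  right; apply: contrapT => h; apply: ng; split=> // E' E'E [v Dv hv]; apply: h.
  by exists E' => //; split=> //; exists v.
apply: thinU; first exact: polytope_boundary_thin (dom_polytope E).
apply: thin_bigcup => E' /= E'E.
have [K /cell_frame KE] := face_of_exists E; have [K' /cell_frame KE'] := face_of_exists E'.
apply: frame_overlap_thin KE KE' (dom_polytope E') _ => u v iu iv.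
by apply: relint_disjoint => //; rewrite eq_sym.
Qed.

(** The other faces are finitely many closed sets missing the point, and cell boundaries consist of
    faces. *)
Lemma generic_nbhs E u : generic_face_point E u ->
  exists2 r : R, 0 < r & forall z K, ball (chart E u) r z -> boundary (cell_set K) z ->
    face_of K E /\ fset E z.
Proof.
move=> [iu gu].
have : \forall z \near chart E u, forall E', E' != E -> ~ fset E' z.
  apply: (@filter_forall _ _ _ _ (nbhs_filter (chart E u))) => E'.
  have [->|E'E] := eqVneq E' E.
    by apply: (@filterS _ _ (nbhs_filter _) setT); [by []|exact: filterT].
  apply: (@filterS _ _ (nbhs_filter _) (~` fset E')) => //.
  apply: open_nbhs_nbhs; split; last exact: gu.
  exact/closed_openC/face_set_closed.
move=> /nbhs_ballP[r /= r0 h]; exists r => // z K zr /boundary_cell[E' KE' E'z].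
have [EE'|E'E] := eqVneq E' E; first by rewrite -EE'.
by case: (h z zr E' E'E).
Qed.

(** Off its boundary the closed cell coincides with its open interior, so the parameters landing in
    the cell form an open and closed part of the connected interval. *)
Lemma segment_cell K a b : (forall s : R, 0 <= s -> s <= 1 ->
    ~ boundary (cell_set K) (a + s *: (b - a))) ->
  cell_set K a -> cell_set K b.
Proof.
move=> nb Ka.
pose g (s : R) : 'rV[R]_n.+1 := a + s *: (b - a).
have cg : continuous g.
  apply: continuous_rV => i; rewrite (_ : (fun x => _) = fun s => a 0 i + s * (b - a) 0 i).
    apply: continuous_add; first exact: cst_continuous.
    by apply: continuous_mul; [by move=> s; exact: cvg_id|exact: cst_continuous].
  by apply/funext => s; rewrite !mxE.
have Kc := polytope_closed (cell_polytope K).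
have inside s : 0 <= s -> s <= 1 -> cell_set K (g s) -> cell_int K (g s).
  move=> s0 s1 Ks; apply: contrapT => ni; apply: (nb s s0 s1).
  by apply/boundary_cellE.
have E : `[0%R, 1%R] `&` (g @^-1` cell_set K) = `[0%R, 1%R] `&` (g @^-1` cell_int K).
  apply/seteqP; split=> s []; rewrite /= in_itv/= => /andP[s0 s1] hs; rewrite s0 s1; split=> //.
    exact: inside.
  exact: interior_subset hs.
have B1 : (`[0%R, 1%R] `&` (g @^-1` cell_set K)) 1.
  rewrite (@segment_connected R 0 1 (`[0%R, 1%R] `&` (g @^-1` cell_set K))).
  - by rewrite /= in_itv/= lexx ler01.
  - exists 0; split; first by rewrite /= in_itv/= lexx ler01.
    by rewrite /preimage/= /g scale0r addr0.
  - rewrite E; exists (g @^-1` cell_int K) => //.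
    by apply: open_comp; [move=> s _; exact: cg|exact: open_interior].
  - exists (g @^-1` cell_set K) => //.
    by apply: preimage_closed => // s _; exact: cg.
by case: B1 => _; rewrite /preimage/= /g scale1r addrC subrK.
Qed.

End mesh_geometry.

Section mesh_sides.
Context {R : realType} {n : nat}.
Variables (M : mesh R n.+1) (Om : set 'rV[R]_n.+1).
Hypothesis dec : is_decomposition M Om.
Implicit Types (K : cell M) (E : face M).
Local Notation F E := (face_frame (face_geo E) : 'M[R]_(n, n.+1)).
Local Notation org E := (face_origin (face_geo E)).
Local Notation dom E := (face_dom (face_geo E) : set 'rV[R]_n).
Local Notation chart E := (face_chart (face_geo E)).
Local Notation fset E := (face_set (face_geo E)).

Lemma convex_gt0 (a b s : R) : 0 < a -> 0 < b -> 0 <= s -> s <= 1 ->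
  0 < (1 - s) * a + s * b.
Proof.
move=> a0 b0 s0; rewrite le_eqVlt => /predU1P[->|s1].
  by rewrite subrr mul0r add0r mul1r.
by rewrite ltr_pwDl// ?mulr_gt0 ?subr_gt0// mulr_ge0// ltW.
Qed.

Lemma ball_segment (x a b : 'rV[R]_n.+1) (r s : R) : 0 < r ->
  ball x r a -> ball x r b -> 0 <= s -> s <= 1 -> ball x r (a + s *: (b - a)).
Proof.
move=> r0 /(rV_ballP _ _ r0) ha /(rV_ballP _ _ r0) hb s0 s1.
apply/rV_ballP => // i; move: (ha i) (hb i); rewrite !mxE !ltr_norml.
set c := x _ _; set a0 := a _ _; set b0 := b _ _ => /andP[a1 a2] /andP[b1 b2].
have := convex_gt0 (a := c - a0 + r) (b := c - b0 + r) ltac:(lra) ltac:(lra) s0 s1.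
have := convex_gt0 (a := r - (c - a0)) (b := r - (c - b0)) ltac:(lra) ltac:(lra) s0 s1.
by move=> ? ?; apply/andP; split; lra.
Qed.

(** [outward_normal] only speaks of points on the normal line. Near a generic point the boundary
    lies in the hyperplane of [E], so each open half-ball, being convex, lies entirely on the side
    of its point on that line. *)
Lemma cell_side K E u : face_of K E -> generic_face_point E u ->
  exists2 r : R, 0 < r & forall z, ball (chart E u) r z ->
    (dotp (normal K E) (z - chart E u) < 0 -> cell_int K z) /\
    (0 < dotp (normal K E) (z - chart E u) -> ~ cell_set K z).
Proof.
move=> KE gu; have [r r0 hr] := generic_nbhs dec gu.
have [iu _] := gu; set x := chart E u in hr *; set nu := normal K E.
have [FF Fn nn] := cell_frame dec KE; rewrite -/nu in Fn nn.
have [_ _ /(_ x)] := cell_normal dec KE; case; first by exists u.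
move=> r' r'0 hr'.
have [t0 t00 ht0] := nbhs_line nu (nbhsx_ballx x r r0).
pose t := Num.min (r' / 2) (t0 / 2).
have tp : 0 < t by rewrite lt_min !divr_gt0.
have tr' : t < r' by rewrite gt_min ltr_pdivrMr// ltr_pMr// ltr1n.
have tt0 : t < t0 by rewrite gt_min [X in _ || X]ltr_pdivrMr// ltr_pMr// ltr1n orbT.
have [Km Kp] := hr' t tp tr'.
have bm : ball x r (x - t *: nu) by rewrite -scaleNr; apply: ht0; rewrite normrN gtr0_norm.
have bp : ball x r (x + t *: nu) by apply: ht0; rewrite gtr0_norm.
have off w : ball x r w -> dotp nu (w - x) != 0 -> ~ boundary (cell_set K) w.
  move=> bw wn /(hr _ _ bw)[_ Ew].
  by move: wn; rewrite (face_hyperplane dec u KE Ew) eqxx.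
have seg a b s : dotp nu (a + s *: (b - a) - x) =
    (1 - s) * dotp nu (a - x) + s * dotp nu (b - x).
  by rewrite !(dotpBr, dotpDr, dotpZr); ring.
have nm : dotp nu (x - t *: nu - x) = - t.
  by rewrite addrAC subrr add0r dotpNr dotpZr nn mulr1.
have np : dotp nu (x + t *: nu - x) = t.
  by rewrite addrAC subrr add0r dotpZr nn mulr1.
exists r => // z bz; split=> hz.
  have Kz : cell_set K z.
    apply: (segment_cell dec _ Km) => s s0 s1; apply: off; first exact: ball_segment.
    rewrite seg nm -oppr_eq0 gt_eqF// opprD -!mulrN opprK.
    by apply: convex_gt0; rewrite ?oppr_gt0.
  apply: contrapT => niz; apply: (off z bz); first by rewrite lt_eqF.
  by apply/(boundary_cellE dec).
move=> Kz; apply: Kp; apply: (segment_cell dec _ Kz) => s s0 s1.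
apply: off; first exact: ball_segment.
by rewrite seg np gt_eqF//; exact: convex_gt0.
Qed.

Lemma exists_generic E (U : set 'rV[R]_n) : open U -> U !=set0 -> U `<=` dom E ->
  exists2 u, U u & generic_face_point E u.
Proof.
move=> oU U0 UD; have [u Uu ng] := thin_open_avoid (nongeneric_thin dec E) oU U0.
by exists u => //; apply: contrapT => h; apply: ng; split=> //; exact: UD.
Qed.

Lemma exists_generic_face E : exists u, generic_face_point E u.
Proof.
have [u _ gu] := exists_generic (open_interior _)
  (polytope_interior_neq0 (dom_polytope dec E)) (@interior_subset _ _).
by exists u.
Qed.

(** Two unit normals of one hyperplane agree up to sign; were they equal, a point just behind a
    generic point of [E] would be interior to both cells. *)
Lemma normal_opp K K' E : face_of K E -> face_of K' E -> K != K' ->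
  normal K' E = - normal K E.
Proof.
move=> KE K'E KK'; have fr := cell_frame dec KE; have fr' := cell_frame dec K'E.
set nu := normal K E in fr *; set nu' := normal K' E in fr' *.
have nE : nu' = dotp nu' nu *: nu.
  rewrite -[LHS]mulmx1 -(frame_decomp fr) mulmxDr mulmxA (_ : nu' *m (F E)^T = 0).
    rewrite mul0mx add0r mulmxA [nu' *m _]mx11_scalar -dotpE.
    by rewrite mul_scalar_mx.
  by case: fr' => _ h _; apply: trmx_inj; rewrite trmx_mul trmxK h trmx0.
have c2 : dotp nu' nu ^+ 2 = 1.
  by case: fr' => _ _; rewrite {2}nE dotpZr dotpC -expr2.
have /eqP := c2; rewrite sqrf_eq1 => /orP[/eqP c1|/eqP c1]; last first.
  by rewrite nE c1 scaleN1r.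
case/negP: KK'; apply/eqP.
have [u gu] := exists_generic_face E.
have [r r0 hr] := cell_side KE gu; have [r' r'0 hr'] := cell_side K'E gu.
have [t t0 ht] := nbhs_line nu (nbhsx_ballx (chart E u) r r0).
have [t' t'0 ht'] := nbhs_line nu (nbhsx_ballx (chart E u) r' r'0).
pose s := - (Num.min t t' / 2).
have m0 : 0 < Num.min t t' by rewrite lt_min t0.
have st : `|s| < t.
  by rewrite normrN gtr0_norm ?divr_gt0// ltr_pdivrMr// gt_min ltr_pMr// ltr1n.
have st' : `|s| < t'.
  by rewrite normrN gtr0_norm ?divr_gt0// ltr_pdivrMr// gt_min [X in _ || X]ltr_pMr// ltr1n orbT.
have ds : dotp nu (chart E u + s *: nu - chart E u) < 0.
  rewrite addrAC subrr add0r dotpZr; case: fr => _ _ ->; rewrite mulr1.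
  by rewrite oppr_lt0 divr_gt0.
apply: (cell_int_disjoint dec (x := chart E u + s *: nu)).
  by apply: (hr _ (ht _ st)).1.
apply: (hr' _ (ht' _ st')).1; rewrite -/nu' nE c1 scale1r; exact: ds.
Qed.

(** Otherwise some cell [K'] covers the points just beyond [E]. As [E] belongs to no cell but [K],
    nothing there bounds [K'], which thus extends across [E] into the interior of [K]. *)
Lemma lone_face_boundary K E : face_of K E -> (forall K', face_of K' E -> K' = K) ->
  boundary_face Om E.
Proof.
move=> KE alone x Ex; split.
  rewrite (closure_domain dec); exists K => //.
  have /(boundary_cellE dec)[] : boundary (cell_set K) x; last by [].
  by apply/(boundary_cell dec); exists E.
move=> iOx; case: Ex => u Du ux.
(* The given point may lie on the rim of the face; it is replaced by a nearby generic one, still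
   interior to [Om]. *)
pose W := interior (dom E) `&` (chart E @^-1` interior Om).
have oW : open W.
  apply: openI; first exact: open_interior.
  by apply: open_comp; [move=> v _; exact: chart_continuous|exact: open_interior].
have W0 : W !=set0.
  have h : nbhs u (chart E @^-1` interior Om).
    apply: chart_continuous; rewrite ux; apply: open_nbhs_nbhs.
    by split=> //; exact: open_interior.
  have [v [iv hv]] := polytope_closure_interior (dom_polytope dec E) Du h.
  by exists v.
have [v [iv Ov] gv] := exists_generic oW W0 (fun v h => interior_subset h.1).
have [r r0 hr] := generic_nbhs dec gv; have [r' r'0 hr'] := cell_side KE gv.
set y := chart E v in hr hr' Ov.
have : \forall z \near y, [/\ ball y r z, ball y r' z & Om z].
  have h1 := nbhsx_ballx y r r0; have h2 := nbhsx_ballx y r' r'0.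
  by apply: filterS3 h1 h2 Ov => z *; split.
move=> /(nbhs_line (normal K E))[t t0 ht].
have [FF Fn nn] := cell_frame dec KE.
pose s := t / 2; have s0 : 0 < s by rewrite divr_gt0.
have st : s < t by rewrite ltr_pdivrMr// ltr_pMr// ltr1n.
have [b1 b1' O1] := ht s ltac:(by rewrite gtr0_norm).
have [b2 b2' O2] := ht (- s) ltac:(by rewrite normrN gtr0_norm).
have nK : ~ cell_set K (y + s *: normal K E).
  by apply: (hr' _ b1').2; rewrite addrAC subrr add0r dotpZr nn mulr1.
have iK : cell_int K (y + (- s) *: normal K E).
  by apply: (hr' _ b2').1; rewrite addrAC subrr add0r dotpZr nn mulr1 oppr_lt0.
have : closure Om (y + s *: normal K E) by exact: subset_closure.
rewrite (closure_domain dec) => -[K' _ K'y].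
suff K'2 : cell_int K' (y + (- s) *: normal K E).
  by apply: nK; rewrite [X in cell_set X](cell_int_disjoint dec iK K'2).
have nb z : ball y r z -> ~ boundary (cell_set K') z.
  move=> bz bdz; have [K'E _] := hr z K' bz bdz.
  by apply: nK; rewrite -[X in cell_set X](alone _ K'E).
have K2 : cell_set K' (y + (- s) *: normal K E).
  apply: (segment_cell dec _ K'y) => c c0 c1; apply: nb; exact: ball_segment.
apply: contrapT => h; apply: (nb _ b2); by apply/(boundary_cellE dec).
Qed.

End mesh_sides.

(** * The divergence theorem on a cell *)

Section finite_sums.
Context d (X : measurableType d) (R : realType) (mu : {measure set X -> \bar R}).
Variables (D : set X) (mD : measurable D).

Lemma integrableD_fun (f g : X -> R) :
  mu.-integrable D (EFin \o f) -> mu.-integrable D (EFin \o g) ->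
  mu.-integrable D (EFin \o (fun x => f x + g x)).
Proof. by move=> fi gi; exact: (integrableD mD fi gi). Qed.

Lemma integrableZ_fun (f : X -> R) (c : R) :
  mu.-integrable D (EFin \o f) -> mu.-integrable D (EFin \o (fun x => c * f x)).
Proof. by move=> fi; exact: (integrableZl mD c fi). Qed.

Lemma integrable_sum_fun (I : Type) (r : seq I) (P : pred I) (f : I -> X -> R) :
  (forall i, P i -> mu.-integrable D (EFin \o f i)) ->
  mu.-integrable D (EFin \o (fun x => \sum_(i <- r | P i) f i x)).
Proof.
move=> fi; elim: r => [|i r IH].
  under eq_fun do rewrite big_nil; exact: integrable0.
under eq_fun do rewrite big_cons; case: (boolP (P i)) => // Pi.
by apply: integrableD_fun => //; exact: fi.
Qed.

Lemma Rintegral_sum_fun (I : Type) (r : seq I) (P : pred I) (f : I -> X -> R) :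
  (forall i, P i -> mu.-integrable D (EFin \o f i)) ->
  \int[mu]_(x in D) (\sum_(i <- r | P i) f i x) =
  \sum_(i <- r | P i) \int[mu]_(x in D) f i x.
Proof.
move=> fi; elim: r => [|i r IH].
  rewrite big_nil (_ : (fun x => _) = cst 0); last by apply/funext => x; rewrite big_nil.
  by rewrite Rintegral_cst// mul0r.
rewrite big_cons -IH; case: (boolP (P i)) => Pi.
  rewrite -RintegralD//; [|exact: fi|exact: integrable_sum_fun].
  by congr Rintegral; apply/funext => x; rewrite big_cons Pi.
by congr Rintegral; apply/funext => x; rewrite big_cons (negbTE Pi).
Qed.

End finite_sums.

Section polynomial_integrals.
Context {R : realType} {n : nat}.
Implicit Types (p q : mpoly n R) (A : set 'rV[R]_n).

Lemma bounded_setS A A' : A' `<=` A -> bounded_set A -> bounded_set A'.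
Proof.
by move=> A'A [L [Lr h]]; exists L; split=> // x Lx y A'y; exact: h (A'A _ A'y).
Qed.

Lemma pev_bounded p (L : R) : exists B : R, forall x, ball 0 L x -> `|pev p x| <= B.
Proof.
move: p; apply: mpoly_ring_ind => [c|i|p q [B1 h1] [B2 h2]|p q [B1 h1] [B2 h2]].
- by exists `|c| => x _; rewrite pevC.
- exists L => x [L0 /(_ 0 i)]; rewrite pevX mxE /ball/= sub0r normrN; exact: ltW.
- exists (B1 + B2) => x bx; rewrite pevD (le_trans (ler_normD _ _))//.
  by rewrite lerD// ?h1// h2.
- exists (B1 * B2) => x bx; rewrite pevM normrM ler_pM// ?h1// h2//.
Qed.

Lemma measurable_pev p A : measurable A -> measurable_fun A (pev p).
Proof. by apply: continuous_measurable_rV; exact: continuous_pev. Qed.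

Lemma pev_integrable p A : measurable A -> bounded_set A ->
  (lebesgue_rV R n).-integrable A (EFin \o pev p).
Proof.
move=> mA bA; apply: measurable_bounded_integrable => //.
- exact: lebesgue_rV_bounded.
- exact: measurable_pev.
- have [L L0 AL] := bounded_subset_ball bA; have [B hB] := pev_bounded p L.
  exists B; split; first exact: num_real.
  by move=> M BM x Ax /=; apply: le_trans (ltW BM); exact/hB/AL.
Qed.

Lemma ip_pevE p q A : ip A (pev p) (pev q) = \int[lebesgue_rV R n]_(x in A) pev (p * q) x.
Proof. by rewrite /ip; congr Rintegral; apply/funext => x; rewrite pevM. Qed.

Lemma ipC A (f g : 'rV[R]_n -> R) : ip A f g = ip A g f.
Proof. by rewrite /ip; congr Rintegral; apply/funext => x; rewrite mulrC. Qed.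

Lemma ip_pevDl p p' q A : measurable A -> bounded_set A ->
  ip A (pev (p + p')) (pev q) = ip A (pev p) (pev q) + ip A (pev p') (pev q).
Proof.
move=> mA bA; rewrite !ip_pevE -RintegralD//; try exact: pev_integrable.
by congr Rintegral; apply/funext => x; rewrite mulrDl pevD.
Qed.

Lemma ip_pevZl c p q A : measurable A -> bounded_set A ->
  ip A (pev (c *: p)) (pev q) = c * ip A (pev p) (pev q).
Proof.
move=> mA bA; rewrite !ip_pevE -RintegralZl//; last exact: pev_integrable.
by congr Rintegral; apply/funext => x; rewrite -scalerAl pevZ.
Qed.

(** [f] agrees with the polynomial only on an open part [U] of [A], which suits piecewise polynomial
    fields. If [p] were nonzero somewhere on [U], it would be so on an open set of positive
    measure. *)
Lemma Rintegral_sqr_eq0 p A (f : 'rV[R]_n -> R) (U : set 'rV[R]_n) :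
  measurable A -> (lebesgue_rV R n).-integrable A (EFin \o (fun x => f x ^+ 2)) ->
  open U -> U !=set0 -> U `<=` A -> (forall x, U x -> f x = pev p x) ->
  \int[lebesgue_rV R n]_(x in A) f x ^+ 2 = 0 -> p = 0.
Proof.
move=> mA If oU U0 UA fp I0; apply: (pev_eq0_open oU U0) => x Ux.
apply/eqP/negPn/negP => px.
have mU := open_measurable_rV oU.
pose V := U `&` (pev p @^-1` [set c | c != 0]).
have oV : open V.
  apply: openI => //; apply: open_comp; first by move=> y _; exact: continuous_pev.
  exact: open_neq.
have V0 : V !=set0 by exists x.
have : ae_eq (lebesgue_rV R n) A (EFin \o (fun x => f x ^+ 2)) (cst 0%E).
  apply/ae_eq_integral_abs => //; first exact: (measurable_int _ If).
  rewrite -[RHS]/(0%:E) -I0 /Rintegral fineK; last exact: integrable_fin_num.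
  by apply: eq_integral => y _ /=; rewrite ger0_norm// sqr_ge0.
move=> [Z [mZ Z0 hZ]].
have VZ : V `<=` Z.
  move=> y [Uy py]; apply: hZ => /= /(_ (UA _ Uy)) [] /eqP.
  by rewrite fp// sqrf_eq0; apply/negP.
have := lebesgue_rV_open_gt0 oV V0; rewrite ltNge; apply/negP/negPn.
by rewrite -Z0; apply: le_measure => //; rewrite inE//; exact: open_measurable_rV.
Qed.

Lemma ip_pev_eq0 p A : measurable A -> bounded_set A -> interior A !=set0 ->
  ip A (pev p) (pev p) = 0 -> p = 0.
Proof.
move=> mA bA iA h; apply: (@Rintegral_sqr_eq0 p A (pev p) (interior A)) => //.
- rewrite (_ : (fun _ => _) = pev (p * p)); first exact: pev_integrable.
  by apply/funext => x; rewrite pevM expr2.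
- exact: open_interior.
- exact: interior_subset.
Qed.

Lemma ip_pev_ge0 p A : 0 <= ip A (pev p) (pev p).
Proof. by apply: Rintegral_ge0 => x _; rewrite -expr2 sqr_ge0. Qed.

End polynomial_integrals.

Lemma measurable_insert_integral (R : realType) n (i : 'I_n.+1) (f : 'rV[R]_n.+1 -> \bar R) :
  (lebesgue_rV R n.+1).-integrable setT f ->
  measurable_fun setT (fun y => \int[@lebesgue_measure R]_t f (insert_coord i t y))%E.
Proof.
pose mu1 : {sigma_finite_measure set (measurableTypeR R) -> \bar R} := @lebesgue_measure R.
move=> If.
have E A : measurable A ->
    (mu1 \x lebesgue_rV R n)%E ((fun p => insert_coord i p.1 p.2) @^-1` A) =
    (1%:E * lebesgue_rV R n.+1 A)%E.
  by move=> mA; rewrite mul1e -(lebesgue_rV_insert_coord i).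
have := integrable_scaled_pushforward (measurable_insert_coord i) ler01 E measurableT If.
rewrite preimage_setT => /measurable_fubini_G.
exact.
Qed.

Lemma rVBE (R : realType) n (a b : 'rV[R]_n) j : (a - b) 0 j = a 0 j - b 0 j.
Proof. by rewrite !mxE. Qed.

Lemma rVDZE (R : realType) n (a b : 'rV[R]_n) c j : (a + c *: b) 0 j = a 0 j + c * b 0 j.
Proof. by rewrite !mxE. Qed.

Lemma dotp_insert_coord (R : realType) n (i : 'I_n.+1) (a : 'rV[R]_n.+1) t y :
  dotp a (insert_coord i t y) = a 0 i * t + dotp (col' i a) y.
Proof.
rewrite /dotp (bigD1_ord i)//= insert_coord_eq; congr (_ + _).
by apply: eq_bigr => k _; rewrite insert_coord_lift mxE.
Qed.

Section divergence.
Context {R : realType} {n : nat}.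
Variables (M : mesh R n.+1) (Om : set 'rV[R]_n.+1).
Hypothesis dec : is_decomposition M Om.
Variables (K : cell M) (i : 'I_n.+1) (q : mpoly n.+1 R).
Implicit Types (E : face M).
Local Notation F E := (face_frame (face_geo E) : 'M[R]_(n, n.+1)).
Local Notation org E := (face_origin (face_geo E)).
Local Notation dom E := (face_dom (face_geo E) : set 'rV[R]_n).
Local Notation chart E := (face_chart (face_geo E)).
Local Notation fset E := (face_set (face_geo E)).
Local Notation nu E := (normal K E).
Local Notation mu1 := (@lebesgue_measure R).

(* A face with [nu 0 i != 0] is a graph over the hyperplane of the other
   coordinates: [face_param E y] is the parameter of its point above y. *)
Let B E : 'M[R]_n := col' i (F E).
Let face_param E (y : 'rV[R]_n) : 'rV[R]_n :=
  y *m invmx (B E) + - (col' i (org E) *m invmx (B E)).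
Let height E y : R := chart E (face_param E y) 0 i.

(** The faces that the line over [y] crosses, at a point of their relative interior. *)
Let active y E : bool :=
  [&& face_of K E, nu E 0 i != 0 & `[< interior (dom E) (face_param E y) >]].

Let slice y : set R := [set t | cell_int K (insert_coord i t y)].

Lemma unitmx_projected_frame E : face_of K E -> nu E 0 i != 0 -> B E \in unitmx.
Proof.
move=> KE ni; rewrite unitmxE unitfE -normr_eq0 (det_frame_col' i (cell_frame dec KE)).
by rewrite normr_eq0.
Qed.

Lemma col'_chart E u : col' i (chart E u) = u *m B E + col' i (org E).
Proof.
apply/rowP => k; rewrite !mxE addrC; congr (_ + _).
by apply: eq_bigr => j _; rewrite !mxE.
Qed.

Lemma face_paramK E u : face_of K E -> nu E 0 i != 0 ->
  face_param E (col' i (chart E u)) = u.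
Proof.
move=> KE ni; rewrite /face_param col'_chart mulmxDl addrK.
by rewrite mulmxK// unitmx_projected_frame.
Qed.

Lemma col'_chart_face_param E y : face_of K E -> nu E 0 i != 0 ->
  col' i (chart E (face_param E y)) = y.
Proof.
move=> KE ni; rewrite col'_chart /face_param mulmxDl mulNmx.
by rewrite !mulmxKV ?unitmx_projected_frame// subrK.
Qed.

Lemma insert_height E y : face_of K E -> nu E 0 i != 0 ->
  insert_coord i (height E y) y = chart E (face_param E y).
Proof.
by move=> KE ni; rewrite -{2}(col'_chart_face_param y KE ni) insert_coordK.
Qed.

(** The two ways for a line to be bad: it meets a transversal face at a nongeneric point, or it
    meets a face parallel to it. *)
Definition nongeneric_line : set 'rV[R]_n :=
  \bigcup_(E in [set E | face_of K E /\ nu E 0 i != 0])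
    [set y | dom E (face_param E y) /\ ~ generic_face_point E (face_param E y)] `|`
  \bigcup_(E in [set E | face_of K E /\ nu E 0 i = 0])
    [set y | exists t, fset E (insert_coord i t y)].

(** [face_param] is an affine bijection and pulls back thin sets. A face parallel to the axis
    projects into a hyperplane of normal [col' i (nu E)], nonzero since [nu E] is a unit vector with
    zero entry at [i]. *)
Lemma nongeneric_line_thin : thin nongeneric_line.
Proof.
apply: thinU; apply: thin_bigcup => E /= [KE ni].
  apply: (thin_preimage_unit _ _ (nongeneric_thin dec E)).
  by rewrite unitmx_inv unitmx_projected_frame.
have [_ _ nn] := cell_frame dec KE.
apply: (@thinS _ _ _ [set y | dotp (col' i (nu E)) y = dotp (nu E) (org E)]).
  move=> y [t] /(face_setE dec _ KE)[<- _].
  by rewrite /= dotp_insert_coord ni mul0r add0r.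
apply: thin_hyperplane; apply/eqP => h; move: nn.
rewrite /dotp (bigD1_ord i)//= ni mul0r add0r big1 ?(rwP eqP) 1?eq_sym ?oner_eq0// => k _.
by have /rowP/(_ k) := h; rewrite !mxE => ->; rewrite mul0r.
Qed.

Lemma measurable_slice y : measurable (slice y : set (measurableTypeR R)).
Proof.
have mC : measurable (cell_int K) by apply: open_measurable_rV; exact: open_interior.
have mi : measurable_fun setT (fun t : measurableTypeR R => insert_coord i t y).
  apply: (@measurableT_comp _ _ _ _ _ _ _ _ (fun t : measurableTypeR R => (t, y))
    (measurable_insert_coord i)).
  by apply/measurable_fun_pairP; split; [exact: measurable_id|exact: measurable_cst].
by rewrite -[X in measurable X]setTI; exact: mi.
Qed.

Section generic_line.
Variable y : 'rV[R]_n.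
Hypothesis gy : ~ nongeneric_line y.

Lemma active_generic E : active y E -> generic_face_point E (face_param E y).
Proof.
move=> /and3P[KE ni /asboolP iE]; apply: contrapT => h; apply: gy; left.
by exists E => //; split=> //; exact: interior_subset.
Qed.

Lemma line_boundary t : boundary (cell_set K) (insert_coord i t y) ->
  exists2 E, active y E & t = height E y.
Proof.
move=> /(boundary_cell dec)[E KE Et].
have [ni|ni] := eqVneq (nu E 0 i) 0.
  by case: gy; right; exists E => //; exists t.
case: Et => u Du hu.
have uE : u = face_param E y by rewrite -(face_paramK u KE ni) hu col'_insert_coord.
have g : generic_face_point E u.
  apply: contrapT => h; apply: gy; left; exists E => //; rewrite /= -uE.
  by split.
exists E; first by rewrite /active KE ni; apply/asboolP; rewrite -uE; case: g.
by rewrite /height -uE hu insert_coord_eq.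
Qed.

Lemma height_inj E E' : active y E -> active y E' -> height E y = height E' y -> E = E'.
Proof.
move=> aE aE' h; apply/eqP/negPn/negP => EE'.
have [_ gE] := active_generic aE.
move: aE aE' => /and3P[KE ni _] /and3P[KE' ni' /asboolP iE'].
apply: (gE E'); first by rewrite eq_sym.
rewrite -(insert_height _ KE ni) h (insert_height _ KE' ni').
by exists (face_param E' y) => //; exact: interior_subset.
Qed.

(** Near a generic point the cell is the side of negative normal component, and a move by [c] along
    the axis changes that component by [c * nu E 0 i]. *)
Lemma height_jump E : active y E -> exists2 e : R, 0 < e & forall s, 0 < s -> s < e ->
  \1_(slice y) (height E y - s) - \1_(slice y) (height E y + s) = Num.sg (nu E 0 i).
Proof.
move=> aE; have gE := active_generic aE; move: aE => /and3P[KE ni _].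
have [r r0 hr] := cell_side dec KE gE; exists r => // s s0 sr.
have E1 c : insert_coord i (height E y + c) y - chart E (face_param E y) =
    c *: delta_mx 0 i.
  rewrite -(insert_height y KE ni); apply/rowP => j; case: (unliftP i j) => [l|] ->.
    rewrite rVBE !insert_coord_lift subrr !mxE eq_sym (negbTE (neq_lift _ _)).
    by rewrite andbF mulr0.
  by rewrite rVBE !insert_coord_eq !mxE !eqxx mulr1 addrAC subrr add0r.
have E2 c : dotp (nu E) (insert_coord i (height E y + c) y - chart E (face_param E y)) =
    c * nu E 0 i.
  rewrite E1 dotpZr /dotp (bigD1 i)//= big1 ?addr0 => [|j ji].
    by rewrite !mxE !eqxx mulr1.
  by rewrite mxE (negbTE ji) mulr0.
have E3 c : `|c| < r ->
    ball (chart E (face_param E y)) r (insert_coord i (height E y + c) y).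
  move=> cr; apply/rV_ballP => // j; have /rowP/(_ j) := E1 c.
  rewrite rVBE => h; rewrite distrC h !mxE /= normrM.
  by case: (j == i); rewrite ?normr1 ?mulr1// normr0 mulr0.
have ins c : `|c| < r -> c * nu E 0 i < 0 -> \1_(slice y) (height E y + c) = 1 :> R.
  by move=> cr cn; rewrite indicE mem_set//; apply: (hr _ (E3 _ cr)).1; rewrite E2.
have out c : `|c| < r -> 0 < c * nu E 0 i -> \1_(slice y) (height E y + c) = 0 :> R.
  move=> cr cn; rewrite indicE memNset// => /interior_subset.
  by apply: (hr _ (E3 _ cr)).2; rewrite E2.
have sr' : `|s| < r by rewrite gtr0_norm.
case/orP : (lt_total ni) => [nn|np].
  rewrite ltr0_sg// (out (- s)) ?normrN// ?(ins s)// ?sub0r//.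
    by rewrite nmulr_llt0.
  by rewrite mulNr oppr_gt0 nmulr_llt0.
rewrite gtr0_sg// (ins (- s)) ?normrN// ?(out s)// ?subr0//.
  by rewrite mulr_gt0.
by rewrite mulNr oppr_lt0 mulr_gt0.
Qed.

(** The line meets the boundary only at heights of active faces, so the segment from [s] to [t]
    avoids it. *)
Lemma slice_locally_constant a b : (forall E, active y E -> ~ (a < height E y /\ height E y < b)) ->
  forall s t, a < s -> s < b -> a < t -> t < b -> slice y s -> slice y t.
Proof.
move=> hab s t as_ sb at_ tb Ks.
have nb c : 0 <= c -> c <= 1 ->
    ~ boundary (cell_set K) (insert_coord i (s + c * (t - s)) y).
  move=> c0 c1 /line_boundary[E aE hE]; apply: (hab E aE); rewrite -hE.
  have := convex_gt0 (a := s - a) (b := t - a) ltac:(lra) ltac:(lra) c0 c1.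
  have := convex_gt0 (a := b - s) (b := b - t) ltac:(lra) ltac:(lra) c0 c1.
  by move=> ? ?; split; lra.
have segE c : insert_coord i s y + c *: (insert_coord i t y - insert_coord i s y) =
    insert_coord i (s + c * (t - s)) y.
  apply/rowP => j; case: (unliftP i j) => [k|] ->.
    by rewrite rVDZE rVBE !insert_coord_lift subrr mulr0 addr0.
  by rewrite rVDZE rVBE !insert_coord_eq.
have Kt : cell_set K (insert_coord i t y).
  apply: (segment_cell dec) (interior_subset Ks) => c c0 c1.
  by rewrite segE; exact: nb.
apply: contrapT => h; apply: (nb 1 ler01 (lexx _)).
by rewrite mul1r addrC subrK; apply/(boundary_cellE dec); exact: conj Kt h.
Qed.

Lemma line_divergence (L : R) : 0 < L -> cell_set K `<=` ball 0 L ->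
  \int[mu1]_(t in `](- (L + 1)), (L + 1)]) (\1_(slice y) t * (line_poly i y q)^`().[t]) =
  \sum_(E | active y E) Num.sg (nu E 0 i) * pev q (chart E (face_param E y)).
Proof.
move=> L0 KL; pose hs := [seq height E y | E <- enum (active y)].
pose ts := sort <=%R hs.
have hsP t : t \in ts -> exists2 E, active y E & t = height E y.
  by rewrite mem_sort => /mapP[E]; rewrite mem_enum => aE ->; exists E.
have tsP E : active y E -> height E y \in ts.
  by move=> aE; rewrite mem_sort; apply/mapP; exists E; rewrite ?mem_enum.
have uts : uniq ts.
  rewrite sort_uniq map_inj_in_uniq ?enum_uniq// => E E'.
  by rewrite !mem_enum; exact: height_inj.
have sts : sorted <%R ts by rewrite lt_sorted_uniq_le uts sort_le_sorted.
(* By [height_inj] the face at a given height is unique, so the jump is a function of the height; 0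
   is the default elsewhere. *)
pose sg t : R := if [pick E | active y E && (height E y == t)] is Some E
  then Num.sg (nu E 0 i) else 0.
have sgE E : active y E -> sg (height E y) = Num.sg (nu E 0 i).
  move=> aE; rewrite /sg; case: pickP => [E' /andP[aE' /eqP h]|/(_ E)].
    by rewrite (height_inj aE' aE h).
  by rewrite aE eqxx.
have inL t : cell_set K (insert_coord i t y) -> `|t| < L.
  by move=> /KL[_ /(_ 0 i)]; rewrite mxE insert_coord_eq /ball/= sub0r normrN.
have tsL t : t \in ts -> - (L + 1) < t < L + 1.
  move=> /hsP[E aE ->]; have [iE _] := active_generic aE.
  move: aE => /and3P[KE ni _].
  have : cell_set K (insert_coord i (height E y) y).
    rewrite (insert_height y KE ni); have /(boundary_cellE dec)[] // :
      boundary (cell_set K) (chart E (face_param E y)).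
    apply/(boundary_cell dec); exists E => //.
    by exists (face_param E y) => //; exact: interior_subset.
  by move=> /inL; rewrite ltr_norml => /andP[? ?]; apply/andP; split; lra.
have out t : L <= `|t| -> \1_(slice y) t = 0 :> R.
  move=> Lt; rewrite indicE memNset// => /interior_subset/inL.
  by rewrite ltNge Lt.
have mslice := measurable_slice y.
(* The cell lies strictly between [-L] and [L], so the indicator is 0 within distance 1 of either
   end: the constant is [c = 0] and no boundary term remains. *)
rewrite (@integral_indic_jumps _ _ sg _ mslice ts _ _ 0).
- rewrite mulNr mul0r oppr0 add0r (perm_big hs) ?perm_sort//= big_map big_enum/=.
  apply: eq_bigr => E aE; rewrite sgE// horner_line_poly.
  by have /and3P[KE ni _] := aE; rewrite insert_height.
- rewrite path_sortedE; last exact: lt_trans.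
  by rewrite sts andbT; apply/allP => t /tsL/andP[].
- have := mem_last (- (L + 1)) ts; rewrite inE => /predU1P[->|/tsL/andP[]//].
  lra.
- move=> a b _ _ h; apply: slice_locally_constant => E /tsP; exact: h.
- move=> t /hsP[E aE ->]; rewrite sgE//; exact: height_jump.
- exists 1 => // s s0 s1; apply: out; rewrite ler0_norm; lra.
- exists 1 => // s s0 s1; apply: out; rewrite ger0_norm; lra.
Qed.

End generic_line.
(** Extended by 0 to all [y], so that the sum over faces no longer depends on [y] and commutes with
    the integral. *)
Let face_term E (y : 'rV[R]_n) : R :=
  if active y E then Num.sg (nu E 0 i) * pev q (chart E (face_param E y)) else 0.

(** For a transversal face this is the change of variables from the coordinate hyperplane back to
    the chart; for a parallel face both sides vanish. *)
Lemma face_term_integral E : face_of K E ->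
  (lebesgue_rV R n).-integrable setT (EFin \o face_term E) /\
  \int[lebesgue_rV R n]_y face_term E y =
  \int[lebesgue_rV R n]_(u in dom E) (pev q (chart E u) * nu E 0 i).
Proof.
move=> KE; have [ni|ni] := eqVneq (nu E 0 i) 0.
  have f0 : face_term E = cst 0.
    by apply/funext => y; rewrite /face_term /active ni eqxx andbF.
  rewrite f0; split; first exact: integrable0.
  rewrite Rintegral_cst// mul0r (_ : (fun u => _) = cst 0).
    rewrite Rintegral_cst ?mul0r//.
    exact: closed_measurable_rV (polytope_closed (dom_polytope dec E)).
  by apply/funext => u; rewrite ni mulr0.
have uB := unitmx_projected_frame KE ni.
have uV : invmx (B E) \in unitmx by rewrite unitmx_inv.
have [mphi phiE] := scales_lebesgue_affine (- (col' i (org E) *m invmx (B E))) uV.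
have c0 : 0 <= `|\det (invmx (B E))|^-1 by rewrite invr_ge0.
pose D := interior (dom E); pose p := affine_comp (F E) (org E) q.
have pE u : pev q (chart E u) = pev p u by rewrite pev_affine_comp addrC.
have mD : measurable D by apply: open_measurable_rV; exact: open_interior.
have mdom := closed_measurable_rV (polytope_closed (dom_polytope dec E)).
have bdom : bounded_set (dom E) by case: (dom_polytope dec E).
have Idom := pev_integrable p mdom bdom.
have ID : (lebesgue_rV R n).-integrable D (EFin \o (fun u => Num.sg (nu E 0 i) * pev p u)).
  by apply: integrableZ_fun => //; apply: integrableS Idom => //; exact: interior_subset.
have ftE : face_term E =
    (fun y => Num.sg (nu E 0 i) * pev p (face_param E y)) \_ (face_param E @^-1` D).
  apply/funext => y; rewrite /face_term /active KE ni /= patchE -pE.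
  by congr (if _ then _ else _); apply/idP/idP => [/asboolP/mem_set//|/set_mem/asboolP].
have I1 := integrable_scaled_pushforward mphi c0 phiE mD ID.
have I2 := Rintegral_scaled_pushforward mphi c0 phiE mD ID.
have mpre : measurable (face_param E @^-1` D).
  by apply: measurable_affine_preimage.
split.
  rewrite ftE -restrict_EFin; apply/(integrable_mkcond _ mpre).
  exact: I1.
have IDp : (lebesgue_rV R n).-integrable D (EFin \o pev p).
  by apply: integrableS Idom => //; exact: interior_subset.
(* [dom E] and its interior differ by a thin, hence null, set. *)
have intE : \int[lebesgue_rV R n]_(u in D) pev p u = \int[lebesgue_rV R n]_(u in dom E) pev p u.
  have [N [mN N0 DN]] := thin_negligible (polytope_boundary_thin (dom_polytope dec E)).
  rewrite /Rintegral (negligible_integral mN mdom Idom N0) (negligible_integral mN mD IDp N0).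
  congr fine; congr integral; apply/seteqP; split=> u [uD uN]; split=> //.
    exact: interior_subset.
  by apply: contrapT => iu; apply: uN; exact: DN.
rewrite ftE -Rintegral_mkcond [LHS]I2 RintegralZl// mulrA.
(* The factor is [|\det (B E)| = |nu E 0 i|], and the sign completes it to [nu E 0 i]. *)
rewrite det_inv normfV invrK (det_frame_col' i (cell_frame dec KE)) [_ * Num.sg _]mulrC -numEsg.
rewrite intE -RintegralZl//; congr Rintegral; apply/funext => u.
by rewrite pE mulrC.
Qed.

Lemma divergence_coord :
  \int[lebesgue_rV R n.+1]_(x in cell_int K) pev (mderiv i q) x =
  \sum_(E | face_of K E)
    \int[lebesgue_rV R n]_(u in dom E) (pev q (chart E u) * nu E 0 i).
Proof.
have bK : bounded_set (cell_set K) by case: (cell_polytope dec K).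
have [L L0 KL] := bounded_subset_ball bK.
have mC : measurable (cell_int K) by apply: open_measurable_rV; exact: open_interior.
have bC : bounded_set (cell_int K) by apply: bounded_setS bK; exact: interior_subset.
have IC := pev_integrable (mderiv i q) mC bC.
have IC' : (lebesgue_rV R n.+1).-integrable setT (EFin \o (pev (mderiv i q) \_ (cell_int K))).
  by rewrite -restrict_EFin; apply/(integrable_mkcond _ mC).
rewrite Rintegral_mkcond /Rintegral (Fubini_insert_coord i IC').
have It E : face_of K E -> (lebesgue_rV R n).-integrable setT (EFin \o face_term E).
  by case/face_term_integral.
have Isum := integrable_sum_fun measurableT (index_enum (face M)) It.
(* The inner integral is computed on generic lines only, that is, for almost every [y]. *)
rewrite (ae_eq_integral (EFin \o (fun y => \sum_(E | face_of K E) face_term E y))) //.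
- rewrite -[LHS]/(Rintegral _ _ _) Rintegral_sum_fun//.
  by apply: eq_bigr => E /face_term_integral[].
- exact: measurable_insert_integral.
- exact: (measurable_int _ Isum).
have [N [mN N0 hN]] := thin_negligible nongeneric_line_thin.
exists N; split=> // y /= hy; apply: hN; apply: contrapT => gy; apply: hy => _.
have sumE : \sum_(E | face_of K E) face_term E y =
    \sum_(E | active y E) Num.sg (nu E 0 i) * pev q (chart E (face_param E y)).
  rewrite /face_term [LHS]big_mkcond [RHS]big_mkcond; apply: eq_bigr => E _.
  by case aE : (active y E); [case/and3P: aE => -> _ _|case: (face_of K E)].
rewrite sumE -(line_divergence gy L0 KL) /Rintegral fineK; last first.
  apply: integrable_fin_num => //; apply: (@integrable_indic_poly _ _ _ _ (- (L + 1)) (L + 1)) => //.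
  - exact: measurable_slice.
  - by move=> x /=; rewrite !in_itv/= => /andP[/ltW-> ->].
(* Outside the range of [line_divergence] the line does not meet the cell, so integrating over the
   whole line changes nothing. *)
rewrite [RHS]integral_mkcond; apply: eq_integral => t _.
rewrite [LHS]/= !patchE deriv_line_poly horner_line_poly indicE.
case: ifPn => [/set_mem tC|tC]; last first.
  rewrite (memNset (fun h : slice y t => negP tC (mem_set h))) mul0r.
  by case: ifP.
rewrite (mem_set (tC : slice y t)) mul1r mem_set//.
have /KL[_ /(_ 0 i)] := interior_subset tC.
rewrite mxE insert_coord_eq /ball/= sub0r normrN ltr_norml => /andP[t1 t2].
by rewrite in_itv/=; apply/andP; split; lra.
Qed.

End divergence.

(** * Linear algebra of the discrete spaces *)

Section linear_solve.
(* A vector space W inside a bare type V: [lin a x y] stands for a x + y and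
   injective coordinates replace the module axioms, so that the discrete spaces
   need no module structure. *)
Context {R : realType}.
Variables (V : Type) (I : finType) (W : V -> Prop) (lin : R -> V -> V -> V) (w0 : V).
Variable coord : V -> I -> R.
Hypothesis coord_lin : forall a x y k, coord (lin a x y) k = a * coord x k + coord y k.
Hypothesis coord_inj : forall x y, W x -> W y -> (forall k, coord x k = coord y k) -> x = y.
Hypothesis coord_w0 : forall k, coord w0 k = 0.
Hypothesis W0 : W w0.
Hypothesis W_lin : forall a x y, W x -> W y -> W (lin a x y).

Let phi (x : V) : 'rV[R]_#|I| := \row_k coord x (enum_val k).

Let phi_lin a x y : phi (lin a x y) = a *: phi x + phi y.
Proof. by apply/rowP => k; rewrite !mxE coord_lin. Qed.

Let phi_inj x y : W x -> W y -> phi x = phi y -> x = y.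
Proof.
move=> Wx Wy h; apply: coord_inj => // k.
by have /rowP/(_ (enum_rank k)) := h; rewrite !mxE enum_rankK.
Qed.

Let phi_w0 : phi w0 = 0.
Proof. by apply/rowP => k; rewrite !mxE coord_w0. Qed.

Definition linear_on (L : V -> R) :=
  forall a x y, W x -> W y -> L (lin a x y) = a * L x + L y.

Lemma linear_on0 (L : V -> R) : linear_on L -> L w0 = 0.
Proof.
move=> hL; have := hL 1 w0 w0 W0 W0.
have -> : lin 1 w0 w0 = w0.
  by apply: phi_inj => //; [exact: W_lin|rewrite phi_lin phi_w0 scaler0 addr0].
by rewrite mul1r => /eqP; rewrite -subr_eq0 opprD addrA subrr sub0r oppr_eq0 => /eqP.
Qed.

Lemma exists_basis : exists r (A : 'M[R]_(r, #|I|)) (e : 'I_r -> V),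
  [/\ row_free A, forall i, W (e i), forall i, phi (e i) = row i A &
      forall w, W w -> (phi w <= A)%MS].
Proof.
pose Q r := exists A : 'M[R]_(r, #|I|), row_free A /\ forall i, exists2 w, W w & phi w = row i A.
have Q0 : exists r, `[< Q r >].
  by exists 0%N; apply/asboolP; exists 0; split=> [|[]//]; rewrite /row_free mxrank0.
have Qm r : `[< Q r >] -> (r <= #|I|)%N.
  by move=> /asboolP[A [/eqP rA _]]; have := rank_leq_col A; rewrite rA.
have [r /asboolP[A [fA hA]] rmax] := ex_maxnP Q0 Qm.
have /choice[e he] : forall i, exists w, W w /\ phi w = row i A.
  by move=> i; have [w Ww hw] := hA i; exists w.
exists r, A, e; split=> // [i|i|w Ww]; [by case: (he i)|by case: (he i)|].
apply: contrapT => /negP nA; have := rmax r.+1; rewrite ltnn => h.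
suff : false by []; apply: h; apply/asboolP; exists (col_mx (phi w) A); split.
  rewrite /row_free eqn_leq rank_leq_row /=.
  have lt : (A < phi w + A)%MS by rewrite ltmxE addsmxSr addsmx_sub (negbTE nA).
  have /rank_ltmx := lt; rewrite addsmxE; move: fA => /eqP ->.
  exact.
move=> i; case: (@split_ordP 1 r i) => j ->.
  by exists w => //; apply/esym; apply: (etrans (rowKu j (phi w) A)); rewrite ord1 row_id.
have [w' Ww' hw'] := hA j; exists w' => //; rewrite hw'.
exact/esym/(rowKd j (phi w) A).
Qed.

Variable B : V -> V -> R.
Hypothesis B_linl : forall z, W z -> linear_on (B ^~ z).
Hypothesis B_linr : forall x, W x -> linear_on (B x).
Hypothesis B_nondeg : forall w, W w -> (forall z, W z -> B w z = 0) -> w = w0.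

(** In a basis the problem is a square system, and nondegeneracy makes the rows of its matrix free.
    It provides the projections, the weak gradients and the time steps alike. *)
Lemma linear_solve (L : V -> R) : linear_on L ->
  exists2 w, W w & forall z, W z -> B w z = L z.
Proof.
move=> hL; have [r [A [e [fA We eA WA]]]] := exists_basis.
(* [V] carries no addition, so linear combinations are folds of [lin]. *)
pose comb (c : 'rV[R]_r) s := foldr (fun i acc => lin (c 0 i) (e i) acc) w0 s.
have Wcomb c s : W (comb c s) by elim: s => //= i s IH; exact: W_lin.
have Lcomb (H : V -> R) c s : linear_on H -> H (comb c s) = \sum_(i <- s) c 0 i * H (e i).
  move=> hH; elim: s => [|i s IH]; first by rewrite big_nil /=; exact: linear_on0.
  by rewrite big_cons /= hH// IH.
have phicomb c : phi (comb c (enum 'I_r)) = c *m A.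
  have h s : phi (comb c s) = \sum_(i <- s) c 0 i *: row i A.
    elim: s => [|i s IH]; first by rewrite big_nil /= phi_w0.
    by rewrite big_cons /= phi_lin IH eA.
  by rewrite h mulmx_sum_row big_enum.
have spanned w : W w -> exists c, w = comb c (enum 'I_r).
  move=> Ww; have /submxP[c hc] := WA w Ww; exists c.
  by apply: phi_inj => //; rewrite phicomb.
pose N : 'M[R]_r := \matrix_(i, j) B (e i) (e j).
have Bcomb c z : W z -> B (comb c (enum 'I_r)) z = \sum_i c 0 i * B (e i) z.
  by move=> Wz; rewrite (Lcomb (B ^~ z)) ?big_enum//; exact: B_linl.
have test (H H' : V -> R) : linear_on H -> linear_on H' ->
    (forall j, H (e j) = H' (e j)) -> forall z, W z -> H z = H' z.
  move=> hH hH' h z /spanned[c ->]; rewrite !Lcomb//.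
  by apply: eq_bigr => j _; rewrite h.
have uN : N \in unitmx.
  rewrite -row_free_unit; apply/inj_row_free => c cN.
  have cw : comb c (enum 'I_r) = w0.
    apply: B_nondeg => // z Wz.
    apply: (test (B (comb c (enum 'I_r))) (fun=> 0)) => // [|a x y _ _|j].
    - exact: B_linr.
    - by rewrite mulr0 addr0.
    have /rowP/(_ j) := cN; rewrite !mxE => <-; rewrite Bcomb//.
    by apply: eq_bigr => i _; rewrite mxE.
  have cA : c *m A = 0 by rewrite -phicomb cw phi_w0.
  by have [A' AA'] := row_freeP fA; rewrite -[c]mulmx1 -AA' mulmxA cA mul0mx.
pose c := (\row_j L (e j)) *m invmx N.
exists (comb c (enum 'I_r)) => //; apply: test => // [|j]; first exact: B_linr.
rewrite Bcomb//; have /rowP/(_ j) : c *m N = \row_j L (e j) by rewrite mulmxKV.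
by rewrite !mxE => <-; apply: eq_bigr => i _; rewrite [N i j]mxE.
Qed.

End linear_solve.

(** * Families of cells without boundary *)

Section closed_families.
Context {R : realType} {n : nat}.
Variables (M : mesh R n.+1) (Om : set 'rV[R]_n.+1).
Hypothesis dec : is_decomposition M Om.
Implicit Types (K : cell M) (E : face M).

(* The flux of the field x |-> x through the faces of the family would vanish,
   the two sides of each face cancelling, but it is a multiple of the volume. *)
Lemma closed_family_empty (U : pred (cell M)) :
  (forall K, U K -> forall E, face_of K E ->
     exists K', [/\ U K', K' != K & face_of K' E]) ->
  forall K, ~~ U K.
Proof.
move=> hU K0; apply/negP => UK0.
pose X i : mpoly n.+1 R := mpolyX R (mnm1 i).
(* [J] depends on the face alone; the cell enters the flux only through its normal. *)
pose J (E : face M) (i : 'I_n.+1) :=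
  \int[lebesgue_rV R n]_(u in (face_dom (face_geo E) : set 'rV[R]_n))
    pev (X i) (face_chart (face_geo E) u).
pose flux (K : cell M) (E : face M) := \sum_i J E i * normal K E 0 i.
have vol (K : cell M) : (n.+1)%:R * \int[lebesgue_rV R n.+1]_(x in cell_int K) 1 =
    \sum_(E | face_of K E) flux K E.
  rewrite /flux exchange_big mulr_natl.
  transitivity (\sum_(i < n.+1) \int[lebesgue_rV R n.+1]_(x in cell_int K) pev (mderiv i (X i)) x).
    transitivity (\sum_(i < n.+1) \int[lebesgue_rV R n.+1]_(x in cell_int K) (1 : R)).
      by rewrite sumr_const card_ord.
    apply: eq_bigr => i _; congr Rintegral; apply/funext => x; rewrite mderivX mnm1E eqxx scale1r.
    rewrite (_ : mnm_sub _ _ = mnm0); first by rewrite mpolyX0 -mpolyC1 pevC.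
    by apply/mnmP => j; rewrite mnmBE subnn mnm0E.
  apply: eq_bigr => i _; rewrite (divergence_coord dec); apply: eq_bigr => E KE.
  have pE : (fun u => pev (X i) (face_chart (face_geo E) u)) =
      pev (affine_comp (face_frame (face_geo E) : 'M[R]_(n, n.+1))
        (face_origin (face_geo E)) (X i)).
    by apply/funext => u; rewrite pev_affine_comp addrC.
  have pD := dom_polytope dec E.
  rewrite RintegralZr//; first exact: closed_measurable_rV (polytope_closed pD).
  rewrite pE; apply: pev_integrable; first exact: closed_measurable_rV (polytope_closed pD).
  by case: pD.
have pos (K : cell M) : 0 < \int[lebesgue_rV R n.+1]_(x in cell_int K) (1 : R).
  have oK : open (cell_int K) by exact: open_interior.
  have K0' : cell_int K !=set0 := polytope_interior_neq0 (cell_polytope dec K).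
  have fK : (lebesgue_rV R n.+1 (cell_int K) < +oo)%E.
    apply: lebesgue_rV_bounded; first exact: open_measurable_rV.
    by apply: (bounded_setS (@interior_subset _ _)); case: (cell_polytope dec K).
  rewrite Rintegral_cst; last exact: open_measurable_rV.
  by rewrite mul1r fine_gt0// fK lebesgue_rV_open_gt0.
suff : \sum_(K | U K) \sum_(E | face_of K E) flux K E = 0.
  apply/eqP; rewrite gt_eqF// (bigD1 K0)//= ltr_pwDl//.
    by rewrite -vol mulr_gt0.
  by apply: sumr_ge0 => K _; rewrite -vol mulr_ge0// ltW.
rewrite (exchange_big_dep predT)//=; apply: big1 => E _.
have [[K /andP[UK KE]]|none] := pselect (exists K, U K && face_of K E); last first.
  by apply: big1 => K KE; case: none; exists K.
have [K' [UK' K'K K'E]] := hU K UK E KE.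
rewrite (bigD1 K) ?UK//= (bigD1 K')/=; last by rewrite UK' K'E.
have h1 : normal K' E = - normal K E by apply: (normal_opp dec KE K'E); rewrite eq_sym.
(* A third cell would have a normal opposite to both [normal K E] and its negative, hence zero, and
   would contribute no flux. *)
rewrite big1 => [|K'' /andP[/andP[/andP[UK'' K''E] K''K] K''K']]; last first.
  have h2 : normal K'' E = - normal K E by apply: (normal_opp dec KE K''E); rewrite eq_sym.
  have h3 : normal K'' E = - normal K' E by apply: (normal_opp dec K'E K''E); rewrite eq_sym.
  rewrite /flux big1// => i _; have nK : normal K'' E 0 i = - normal K'' E 0 i.
    by rewrite {1}h3 h1 opprK h2 mxE opprK.
  have -> : normal K'' E 0 i = 0 by move: nK; lra.
  by rewrite mulr0.
rewrite addr0 /flux -big_split big1// => i _ /=.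
by rewrite h1 mxE mulrN addrN.
Qed.

End closed_families.

(** * Infinitesimal rigid motions *)

Section rigid_motions.
Context {R : realType} {n : nat}.
Implicit Types (v : 'rV[mpoly n R]_n).

(* The third-order tensor of second derivatives is symmetric in one pair of
   indices and antisymmetric in another, hence zero. *)
Lemma killing_affine v : (forall i j, mderiv j (v 0 i) + mderiv i (v 0 j) = 0) ->
  forall i j, deg_le 0 (mderiv j (v 0 i)).
Proof.
move=> sk i j; apply: mderiv_eq0_const => k.
pose T k j i := mderiv k (mderiv j (v 0 i)).
have sym a b c : T a b c = T b a c by exact: mderiv_comm.
have anti a b c : T a b c = - T a c b.
  have := congr1 (mderiv a) (sk c b); rewrite mderivD mderiv0 => /eqP.
  by rewrite addr_eq0 => /eqP.
have : T k j i = - T k j i.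
  rewrite {1}anti [T k i j]sym [T i k j]anti opprK [T i j k]sym [T j i k]anti.
  by rewrite [T j k i]sym.
rewrite -/(T k j i) => h; apply/mpolyP => m; rewrite mcoeff0.
by have := congr1 (mcoeff m) h; rewrite mcoeffN; lra.
Qed.

(** Subtracting the linear part leaves a polynomial with zero gradient, hence a constant. *)
Lemma deg_le1_pev (p : mpoly n R) : (forall j, deg_le 0 (mderiv j p)) ->
  deg_le 1 p /\ forall x y, pev p y - pev p x = \sum_j mcoeff mnm0 (mderiv j p) * (y 0 j - x 0 j).
Proof.
move=> h; pose a j := mcoeff mnm0 (mderiv j p).
have hj j : mderiv j p = mpolyC n (a j) := msize1_polyC (h j).
pose q := p - \sum_j a j *: mpolyX R (mnm1 j).
have q0 : deg_le 0 q.
  apply: mderiv_eq0_const => k; rewrite mderivB hj.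
  have -> : mderiv k (\sum_j a j *: mpolyX R (mnm1 j)) = mpolyC n (a k).
    rewrite (big_morph (mderiv k) (@mderivD _ _ k) (mderiv0 _ k)) (bigD1 k)//= big1.
      rewrite addr0 mderivZ mderivX mnm1E eqxx scale1r.
      rewrite (_ : mnm_sub _ _ = mnm0); first by rewrite mpolyX0 -mul_mpolyC mulr1.
      by apply/mnmP => l; rewrite mnmBE subnn mnm0E.
    by move=> l lk; rewrite mderivZ mderivX mnm1E (negbTE lk) scale0r scaler0.
  by rewrite subrr.
have pE : p = q + \sum_j a j *: mpolyX R (mnm1 j) by rewrite subrK.
split.
  rewrite pE; apply: deg_leD; first exact: deg_leW q0.
  by apply: deg_le_sum => j; apply: deg_leZ; apply: deg_leX; rewrite mdeg1.
have e z : pev p z = mcoeff mnm0 q + \sum_j a j * z 0 j.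
  rewrite [in LHS]pE pevD pev_sum {1}(msize1_polyC q0) pevC; congr (_ + _).
  by apply: eq_bigr => j _; rewrite pevZ pevX.
move=> x y; rewrite !e opprD addrACA subrr add0r -sumrB.
by apply: eq_bigr => j _; rewrite -mulrBr.
Qed.

End rigid_motions.

(** The field is affine with a skew matrix [A] that kills the hyperplane. Being skew, [A] also has
    range orthogonal to the hyperplane, so it is a multiple of [nu^T *m nu], which is symmetric;
    hence [A = 0]. *)
Lemma rigid_zero (R : realType) n (F : 'M[R]_(n, n.+1)) nu p (v : 'rV[mpoly n.+1 R]_n.+1) :
  is_frame F nu -> (forall i j, mderiv j (v 0 i) + mderiv i (v 0 j) = 0) ->
  (forall i, affine_comp F p (v 0 i) = 0) -> v = 0.
Proof.
move=> fr sk tr; have aff := killing_affine sk.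
pose A : 'M[R]_n.+1 := \matrix_(i, j) mcoeff mnm0 (mderiv j (v 0 i)).
have vE i x y : pev (v 0 i) y - pev (v 0 i) x = (A *m (y - x)^T) i 0.
  have [_ ->] := deg_le1_pev (aff i); rewrite mxE; apply: eq_bigr => j _.
  by rewrite !mxE.
have skA : A^T = - A.
  apply/matrixP => i j; rewrite !mxE; apply/eqP; rewrite -addr_eq0 -mcoeffD.
  by rewrite addrC sk mcoeff0.
have v0 i u : pev (v 0 i) (p + u *m F) = 0 by rewrite addrC -pev_affine_comp tr pev0.
have vp i : pev (v 0 i) p = 0 by have := v0 i 0; rewrite mul0mx addr0.
have AF : A *m F^T = 0.
  apply/matrixP => i a; have := vE i p (p + row a F).
  rewrite {1}rowE v0 vp subrr addrAC subrr add0r tr_row => h.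
  rewrite [RHS]mxE h !mxE; apply: eq_bigr => j _.
  by rewrite !mxE.
have FA : F *m A = 0.
  by apply: trmx_inj; rewrite trmx_mul skA mulNmx AF oppr0 trmx0.
(* Inserting the resolution of the identity on both sides leaves only the component along [nu] in
   each slot. *)
have A1 : A = nu^T *m (nu *m A *m nu^T) *m nu.
  rewrite -[LHS]mulmx1 -(frame_decomp fr) mulmxDr mulmxA AF mul0mx add0r.
  rewrite -{1}[A]mul1mx -(frame_decomp fr) mulmxDl -mulmxA FA mulmx0 add0r.
  by rewrite !mulmxA.
have c0 : nu *m A *m nu^T = 0.
  have : (nu *m A *m nu^T)^T = - (nu *m A *m nu^T).
    by rewrite !trmx_mul trmxK skA mulNmx mulmxN mulmxA.
  move=> /matrixP/(_ 0 0); rewrite [LHS]mxE [RHS]mxE => h.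
  by apply/matrixP => i j; rewrite !ord1 [RHS]mxE; move: h; lra.
have A0 : A = 0 by rewrite A1 c0 mulmx0 mul0mx.
apply/rowP => i; rewrite [RHS]mxE; apply: (pev_eq0_open openT); first by exists 0.
move=> y _; by have := vE i p y; rewrite A0 mul0mx mxE vp subr0.
Qed.

(** * Projections onto polynomials and weak gradients *)

Section projections.
Context {R : realType} {n : nat}.
Variables (D : set 'rV[R]_n) (k : nat).
Hypotheses (mD : measurable D) (bD : bounded_set D) (iD : interior D !=set0).
Implicit Types (p q g : mpoly n R).

Let lin (a : R) (p q : mpoly n R) := a *: p + q.

(** Provides the finite injective coordinates that [linear_solve] asks for; [bmultinom] bounds the
    degree strictly, hence [k.+1]. *)
Lemma deg_le_coeff_inj p q : deg_le k p -> deg_le k q ->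
  (forall m : bmultinom n k.+1, mcoeff (bmnm m) p = mcoeff (bmnm m) q) -> p = q.
Proof.
move=> /deg_leP hp /deg_leP hq h; apply/mpolyP => m.
have [mk|mk] := leqP (mdeg m) k; last by rewrite hp// hq.
by have := h (BMultinom (mk : (mdeg m < k.+1)%N)).
Qed.

(** [L2proj] selects a solution by [xget]; existence is what turns this choice into the
    projection. *)
Lemma L2proj_exists g : exists p, deg_le k p /\
  forall q, deg_le k q -> ip D (pev p) (pev q) = ip D (pev g) (pev q).
Proof.
have l1 z : linear_on (deg_le k (n:=n)) lin (fun p => ip D (pev p) (pev z)).
  by move=> a x y _ _; rewrite ip_pevDl// ip_pevZl.
have l2 z : linear_on (deg_le k (n:=n)) lin (fun p => ip D (pev z) (pev p)).
  by move=> a x y _ _; rewrite ![ip D (pev z) _]ipC ip_pevDl// ip_pevZl.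
have := @linear_solve R (mpoly n R) (bmultinom n k.+1) (deg_le k (n:=n)) lin 0
  (fun p m => mcoeff (bmnm m) p) _ _ _ _ _ (fun p q => ip D (pev p) (pev q)) _ _ _ _ (l2 g).
case.
- by move=> a x y m; rewrite /lin mcoeffD mcoeffZ.
- by move=> x y; exact: deg_le_coeff_inj.
- by move=> m; rewrite mcoeff0.
- exact: deg_le0.
- by move=> a x y hx hy; apply: deg_leD => //; exact: deg_leZ.
- by move=> z _; exact: l1.
- by move=> z _; exact: l2.
- by move=> w hw /(_ w hw); exact: ip_pev_eq0.
- by move=> p hp h; exists p.
Qed.

Lemma L2proj_spec g : deg_le k (L2proj D k (pev g)) /\
  forall q, deg_le k q -> ip D (pev (L2proj D k (pev g))) (pev q) = ip D (pev g) (pev q).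
Proof. exact: (xgetPex 0 (L2proj_exists g)). Qed.

Lemma L2proj_eq g p : deg_le k p ->
  (forall q, deg_le k q -> ip D (pev p) (pev q) = ip D (pev g) (pev q)) ->
  L2proj D k (pev g) = p.
Proof.
move=> pk h; have [pk' h'] := L2proj_spec g.
apply/eqP; rewrite -subr_eq0; apply/eqP; apply: (ip_pev_eq0 mD bD iD).
have dk : deg_le k (L2proj D k (pev g) - p) by apply: deg_leD => //; exact: deg_leN.
set r := L2proj D k (pev g) - p in dk *.
have -> : ip D (pev r) (pev r) =
    ip D (pev (L2proj D k (pev g))) (pev r) + -1 * ip D (pev p) (pev r).
  by rewrite -ip_pevZl// -ip_pevDl// scaleN1r.
by rewrite h// h'// mulN1r subrr.
Qed.

Lemma L2proj_id p : deg_le k p -> L2proj D k (pev p) = p.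
Proof. by move=> pk; exact: L2proj_eq. Qed.

Lemma L2proj_lin a g g' :
  L2proj D k (pev (a *: g + g')) = a *: L2proj D k (pev g) + L2proj D k (pev g').
Proof.
have [h1 e1] := L2proj_spec g; have [h2 e2] := L2proj_spec g'.
apply: L2proj_eq => [|q qk]; first by apply: deg_leD => //; exact: deg_leZ.
by rewrite !ip_pevDl// !ip_pevZl// e1// e2.
Qed.

End projections.

Section weak_gradients.
Context {R : realType} {n : nat}.
Variables (M : mesh R n.+1) (Om : set 'rV[R]_n.+1) (k : nat).
Hypothesis dec : is_decomposition M Om.
Implicit Types (K : cell M) (E : face M) (q G : 'rV[mpoly n.+1 R]_n.+1).
Implicit Types (w : cell M -> mpoly n.+1 R) (vb : face M -> mpoly n R).
Local Notation F E := (face_frame (face_geo E) : 'M[R]_(n, n.+1)).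
Local Notation org E := (face_origin (face_geo E)).
Local Notation dom E := (face_dom (face_geo E) : set 'rV[R]_n).
Local Notation chart E := (face_chart (face_geo E)).


Lemma cell_int_measurable K : measurable (cell_int K).
Proof. by apply: open_measurable_rV; exact: open_interior. Qed.

Lemma cell_int_bounded K : bounded_set (cell_int K).
Proof. by apply: (bounded_setS (@interior_subset _ _)); case: (cell_polytope dec K). Qed.

Lemma cell_int_neq0 K : interior (cell_int K) !=set0.
Proof.
rewrite (_ : interior _ = cell_int K); first exact: polytope_interior_neq0 (cell_polytope dec K).
exact/interior_id/open_interior.
Qed.

Lemma dom_measurable E : measurable (dom E).
Proof. exact: closed_measurable_rV (polytope_closed (dom_polytope dec E)). Qed.

Lemma dom_bounded E : bounded_set (dom E).
Proof. by case: (dom_polytope dec E). Qed.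

Lemma dom_interior E : interior (dom E) !=set0.
Proof. exact: polytope_interior_neq0 (dom_polytope dec E). Qed.

Lemma pev_trace E p u : pev p (chart E u) = pev (affine_comp (F E) (org E) p) u.
Proof. by rewrite pev_affine_comp addrC. Qed.

Definition lin_row (a : R) q G : 'rV[mpoly n.+1 R]_n.+1 := \row_i (a *: q 0 i + G 0 i).

(** The normal flux of [q] through [E] as a polynomial in the chart coordinates, so that polynomial
    inner products apply to it. *)
Definition flux_trace K E q : mpoly n R :=
  \sum_i normal K E 0 i *: affine_comp (F E) (org E) (q 0 i).

Lemma flux_traceE K E q :
  face_trace E (fun x => dotp (pevmx q x) (normal K E)) = pev (flux_trace K E q).
Proof.
apply/funext => u; rewrite /face_trace /= /flux_trace pev_sum; apply: eq_bigr => i _.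
by rewrite mxE pevZ -pev_trace mulrC.
Qed.

Lemma affine_comp_lin m l (A : 'M[R]_(m, l)) b c p p' :
  affine_comp A b (c *: p + p') = c *: affine_comp A b p + affine_comp A b p'.
Proof. by rewrite /affine_comp mmapD mmapZ /= mul_mpolyC. Qed.

Lemma flux_trace_lin K E a q G :
  flux_trace K E (lin_row a q G) = a *: flux_trace K E q + flux_trace K E G.
Proof.
rewrite /flux_trace scaler_sumr -big_split; apply: eq_bigr => i _ /=.
by rewrite mxE affine_comp_lin scalerDr !scalerA mulrC.
Qed.

Lemma deg_le_flux_trace K E q : (forall i, deg_le k (q 0 i)) -> deg_le k (flux_trace K E q).
Proof.
move=> qk; apply: deg_le_sum => i; apply: deg_leZ; exact: deg_le_affine_comp.
Qed.

Lemma divergence_lin a q G : divergence (lin_row a q G) = a *: divergence q + divergence G.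
Proof.
rewrite /divergence scaler_sumr -big_split; apply: eq_bigr => i _ /=.
by rewrite mxE mderivD mderivZ.
Qed.

Definition weak_gradient_form w vb K q : R :=
  - ip (cell_int K) (pev (w K)) (pev (divergence q)) +
  \sum_(E | face_of K E)
    face_ip E (pev (vb E)) (face_trace E (fun x => dotp (pevmx q x) (normal K E))).

Lemma weak_gradient_formE w vb K q : weak_gradient_form w vb K q =
  - ip (cell_int K) (pev (w K)) (pev (divergence q)) +
  \sum_(E | face_of K E) ip (dom E) (pev (vb E)) (pev (flux_trace K E q)).
Proof. by congr (_ + _); apply: eq_bigr => E _; rewrite /face_ip flux_traceE. Qed.

Lemma weak_gradient_form_linr w vb K a q G :
  weak_gradient_form w vb K (lin_row a q G) =
  a * weak_gradient_form w vb K q + weak_gradient_form w vb K G.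
Proof.
have [mC bC] := (cell_int_measurable K, cell_int_bounded K).
rewrite !weak_gradient_formE divergence_lin ![ip _ (pev (w K)) _]ipC ip_pevDl// ip_pevZl//.
rewrite mulrDr mulr_sumr opprD mulrN addrACA -big_split; congr (_ + _).
apply: eq_bigr => E _ /=; rewrite flux_trace_lin ![ip _ (pev (vb E)) _]ipC.
have [mE bE] := (dom_measurable E, dom_bounded E).
by rewrite ip_pevDl// ip_pevZl.
Qed.

Lemma weak_gradient_form_linl (a : R) w w' vb vb' K q :
  weak_gradient_form (fun K => a *: w K + w' K) (fun E => a *: vb E + vb' E) K q =
  a * weak_gradient_form w vb K q + weak_gradient_form w' vb' K q.
Proof.
have [mC bC] := (cell_int_measurable K, cell_int_bounded K).
rewrite !weak_gradient_formE ip_pevDl// ip_pevZl//.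
rewrite mulrDr mulr_sumr opprD mulrN addrACA -big_split; congr (_ + _).
apply: eq_bigr => E _ /=.
have [mE bE] := (dom_measurable E, dom_bounded E).
by rewrite ip_pevDl// ip_pevZl.
Qed.

Definition ip_row K G q : R := \sum_i ip (cell_int K) (pev (G 0 i)) (pev (q 0 i)).

Lemma ip_rowC K G q : ip_row K G q = ip_row K q G.
Proof. by apply: eq_bigr => i _; rewrite ipC. Qed.

Lemma ip_row_linl K a G G' q : ip_row K (lin_row a G G') q = a * ip_row K G q + ip_row K G' q.
Proof.
have [mC bC] := (cell_int_measurable K, cell_int_bounded K).
rewrite /ip_row mulr_sumr -big_split; apply: eq_bigr => i _ /=.
by rewrite mxE ip_pevDl// ip_pevZl.
Qed.

Lemma ip_row_eq0 K G : ip_row K G G = 0 -> G = 0.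
Proof.
have [mC bC] := (cell_int_measurable K, cell_int_bounded K).
move=> /psumr_eq0P h; apply/rowP => i; rewrite [RHS]mxE.
apply: (ip_pev_eq0 mC bC (cell_int_neq0 K)); apply: h => // j _.
exact: ip_pev_ge0.
Qed.

Let deg_row G := forall i, deg_le k (G 0 i).

Let deg_row_lin a G q : deg_row G -> deg_row q -> deg_row (lin_row a G q).
Proof. by move=> hG hq i; rewrite mxE; apply: deg_leD => //; exact: deg_leZ. Qed.

Lemma weak_gradient_exists w vb K : exists G, deg_row G /\
  forall q, deg_row q -> ip_row K G q = weak_gradient_form w vb K q.
Proof.
have := @linear_solve R _ ('I_n.+1 * bmultinom n.+1 k.+1)%type deg_row lin_row 0
  (fun G m => mcoeff (bmnm m.2) (G 0 m.1)) _ _ _ _ _ (ip_row K) _ _ _ (weak_gradient_form w vb K).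
case.
- by move=> a x y m; rewrite /= mxE mcoeffD mcoeffZ.
- move=> x y hx hy h; apply/rowP => i; apply: (deg_le_coeff_inj (hx i) (hy i)) => m.
  exact: (h (i, m)).
- by move=> m; rewrite mxE mcoeff0.
- by move=> i; rewrite mxE; exact: deg_le0.
- exact: deg_row_lin.
- by move=> z _ a x y _ _; rewrite ip_row_linl.
- by move=> z _ a x y _ _; rewrite ip_rowC ip_row_linl ![ip_row K _ z]ip_rowC.
- by move=> G hG /(_ G hG); exact: ip_row_eq0.
- by move=> a x y _ _; exact: weak_gradient_form_linr.
- by move=> G hG h; exists G.
Qed.

Lemma weak_gradient_spec w vb K : deg_row (weak_gradient k w vb K) /\
  forall q, deg_row q -> ip_row K (weak_gradient k w vb K) q = weak_gradient_form w vb K q.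
Proof. exact: (xgetPex 0 (weak_gradient_exists w vb K)). Qed.

Lemma weak_gradient_eq w vb K G : deg_row G ->
  (forall q, deg_row q -> ip_row K G q = weak_gradient_form w vb K q) ->
  weak_gradient k w vb K = G.
Proof.
move=> Gk h; have [Gk' h'] := weak_gradient_spec w vb K.
suff : lin_row (-1) G (weak_gradient k w vb K) = 0.
  move=> /rowP e; apply/rowP => i; have := e i; rewrite !mxE scaleN1r addrC.
  by move=> /eqP; rewrite subr_eq0 => /eqP.
apply: (@ip_row_eq0 K); have dk := deg_row_lin (-1) Gk Gk'.
by rewrite ip_row_linl h// h'// mulN1r addNr.
Qed.

Lemma weak_gradient_lin (a : R) w w' vb vb' K :
  weak_gradient k (fun K => a *: w K + w' K) (fun E => a *: vb E + vb' E) K =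
  lin_row a (weak_gradient k w vb K) (weak_gradient k w' vb' K).
Proof.
have [h1 e1] := weak_gradient_spec w vb K; have [h2 e2] := weak_gradient_spec w' vb' K.
apply: weak_gradient_eq => [|q qk]; first exact: deg_row_lin.
by rewrite ip_row_linl e1// e2// weak_gradient_form_linl.
Qed.

(* The flux of a test field of degree k has degree k on each face, so that the
   projection is invisible and Green's formula applies. *)
Lemma weak_gradient_classical w vb K : deg_le k.+1 (w K) ->
  (forall E, face_of K E -> vb E = L2proj (dom E) k (face_trace E (pev (w K)))) ->
  weak_gradient k w vb K = \row_i mderiv i (w K).
Proof.
move=> wk vbE; apply: weak_gradient_eq => [i|q qk].
  by rewrite mxE; exact: deg_le_mderiv.
have [mC bC] := (cell_int_measurable K, cell_int_bounded K).
(* Integration by parts: the divergence identity for the product [w K * q 0 i]. *)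
have green i : ip (cell_int K) (pev (mderiv i (w K))) (pev (q 0 i)) =
    - ip (cell_int K) (pev (w K)) (pev (mderiv i (q 0 i))) +
    \sum_(E | face_of K E) ip (dom E) (pev (affine_comp (F E) (org E) (w K)))
      (pev (normal K E 0 i *: affine_comp (F E) (org E) (q 0 i))).
  have := divergence_coord dec K i (w K * q 0 i); rewrite mderivM.
  rewrite (_ : \int[_]_(x in _) _ = ip (cell_int K) (pev (mderiv i (w K))) (pev (q 0 i)) +
     ip (cell_int K) (pev (w K)) (pev (mderiv i (q 0 i)))); last first.
    rewrite !ip_pevE -RintegralD//; try exact: pev_integrable.
    by congr Rintegral; apply/funext => x; rewrite pevD.
  move=> /(canRL (addrK _)) ->; rewrite addrC; congr (_ + _); apply: eq_bigr => E _.
  by congr Rintegral; apply/funext => u; rewrite pevM !pev_trace pevZ -mulrA [_ * normal _ _ _ _]mulrC.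
rewrite weak_gradient_formE /ip_row.
under eq_bigr => i _ do rewrite mxE green.
rewrite big_split sumrN exchange_big; congr (- _ + _).
  rewrite /divergence; elim/big_rec2: _ => [|i p x _ ->].
    rewrite ip_pevE mulr0 (_ : pev 0 = cst 0) ?Rintegral_cst ?mul0r//.
    by apply/funext => y; rewrite pev0.
  by rewrite ![ip _ (pev (w K)) _]ipC ip_pevDl.
apply: eq_bigr => E KE; have [mE bE] := (dom_measurable E, dom_bounded E).
have -> : \sum_i ip (dom E) (pev (affine_comp (F E) (org E) (w K)))
      (pev (normal K E 0 i *: affine_comp (F E) (org E) (q 0 i))) =
    ip (dom E) (pev (affine_comp (F E) (org E) (w K))) (pev (flux_trace K E q)).
  rewrite /flux_trace; elim/big_rec2: _ => [|i p x _ ->].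
    rewrite ip_pevE mulr0 (_ : pev 0 = cst 0) ?Rintegral_cst ?mul0r//.
    by apply/funext => y; rewrite pev0.
  by rewrite ![ip _ (pev (affine_comp _ _ (w K))) _]ipC ip_pevDl.
rewrite vbE// (_ : face_trace E (pev (w K)) = pev (affine_comp (F E) (org E) (w K))).
  have [_ h] := L2proj_spec k mE bE (dom_interior E) (affine_comp (F E) (org E) (w K)).
  by rewrite h//; exact: deg_le_flux_trace.
by apply/funext => u; rewrite /face_trace /= pev_trace.
Qed.

End weak_gradients.

(** * The forms of the scheme *)

Section bounded_functions.
Context {R : realType} {n : nat}.
Variable Om : set 'rV[R]_n.
Hypotheses (mOm : measurable Om) (bOm : bounded_set Om).

(** On a bounded domain these functions are integrable and, unlike integrable functions in general,
    closed under products. *)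
Definition bounded_measurable (f : 'rV[R]_n -> R) :=
  measurable_fun Om f /\ exists B : R, forall x, Om x -> `|f x| <= B.

Lemma bounded_measurable_cst c : bounded_measurable (cst c).
Proof. by split=> //; exists `|c|. Qed.

Lemma bounded_measurableD f g : bounded_measurable f -> bounded_measurable g ->
  bounded_measurable (fun x => f x + g x).
Proof.
move=> [mf [B hB]] [mg [B' hB']]; split; first exact: measurable_funD.
by exists (B + B') => x Ox; rewrite (le_trans (ler_normD _ _))// lerD ?hB ?hB'.
Qed.

Lemma bounded_measurableM f g : bounded_measurable f -> bounded_measurable g ->
  bounded_measurable (fun x => f x * g x).
Proof.
move=> [mf [B hB]] [mg [B' hB']]; split; first exact: measurable_funM.
by exists (B * B') => x Ox; rewrite normrM ler_pM ?hB ?hB'.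
Qed.

Lemma bounded_measurable_sum (I : Type) (r : seq I) (f : I -> 'rV[R]_n -> R) :
  (forall i, bounded_measurable (f i)) ->
  bounded_measurable (fun x => \sum_(i <- r) f i x).
Proof.
move=> h; elim: r => [|i r IH].
  by under eq_fun do rewrite big_nil; exact: bounded_measurable_cst.
by under eq_fun do rewrite big_cons; exact: bounded_measurableD.
Qed.

Lemma bounded_measurable_indic A : measurable A -> bounded_measurable \1_A.
Proof.
move=> mA; split; first exact: measurable_indic.
by exists 1 => x _; rewrite indicE; case: (x \in A); rewrite ?normr1// normr0.
Qed.

Lemma bounded_measurable_pev p : bounded_measurable (pev p).
Proof.
split; first exact: measurable_pev.
have [L L0 OL] := bounded_subset_ball bOm; have [B hB] := pev_bounded p L.
by exists B => x Ox; apply/hB/OL.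
Qed.

Lemma bounded_measurable_integrable f : bounded_measurable f ->
  (lebesgue_rV R n).-integrable Om (EFin \o f).
Proof.
move=> [mf [B hB]]; apply: measurable_bounded_integrable => //.
  exact: lebesgue_rV_bounded.
exists B; split; first exact: num_real.
by move=> M BM x Ox /=; apply: le_trans (ltW BM); exact: hB.
Qed.

(** Since [|f| <= 1 + f ^+ 2] and [Om] has finite measure, [f] is integrable, and a bounded factor
    keeps it so. *)
Lemma square_integrableM f g : L2 Om f -> bounded_measurable g ->
  (lebesgue_rV R n).-integrable Om (EFin \o (fun x => f x * g x)).
Proof.
move=> [mf fi] [mg [B hB]].
have If2 : (lebesgue_rV R n).-integrable Om (EFin \o (fun x => f x ^+ 2)).
  apply/integrableP; split; first by apply/measurable_EFinP; exact: measurable_funX.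
  rewrite (eq_integral (fun x => ((f x) ^+ 2)%:E))// => x _ /=.
  by rewrite ger0_norm// sqr_ge0.
have I1 : (lebesgue_rV R n).-integrable Om (EFin \o (fun x => 1 + f x ^+ 2)).
  apply: (integrableD_fun mOm (f := cst 1)) => //.
  exact: bounded_measurable_integrable (bounded_measurable_cst 1).
have If : (lebesgue_rV R n).-integrable Om (EFin \o f).
  apply: le_integrable I1 => // [|x Ox]; first exact/measurable_EFinP.
  rewrite /= lee_fin [X in _ <= X]ger0_norm ?addr_ge0 ?sqr_ge0// -[X in _ + X]real_normK ?num_real//.
  by have := sqr_ge0 (`|f x| - 1); rewrite sqrrB expr1n mulr1; have := normr_ge0 (f x); lra.
apply: (integrableMl mOm If mg).
by exists B; split; [exact: num_real|move=> M BM x Ox /=; apply: le_trans (ltW BM); exact: hB].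
Qed.

End bounded_functions.

Section frobenius.
Context {R : realType} {d : nat}.
Implicit Types A B C : 'M[R]_d.

Lemma frobC A B : frob A B = frob B A.
Proof. by apply: eq_bigr => i _; apply: eq_bigr => j _; rewrite mulrC. Qed.

Lemma frobDl A B C : frob (A + B) C = frob A C + frob B C.
Proof.
rewrite /frob -big_split; apply: eq_bigr => i _ /=.
by rewrite -big_split; apply: eq_bigr => j _ /=; rewrite mxE mulrDl.
Qed.

Lemma frobZl c A B : frob (c *: A) B = c * frob A B.
Proof.
rewrite /frob mulr_sumr; apply: eq_bigr => i _.
by rewrite mulr_sumr; apply: eq_bigr => j _; rewrite mxE mulrA.
Qed.

Lemma frobDr A B C : frob C (A + B) = frob C A + frob C B.
Proof. by rewrite !(frobC C) frobDl. Qed.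

Lemma frobZr c A B : frob B (c *: A) = c * frob B A.
Proof. by rewrite !(frobC B) frobZl. Qed.

Lemma tappD (C : tensor4_field R d) x A B : tapp C x (A + B) = tapp C x A + tapp C x B.
Proof.
apply/matrixP => i j; rewrite !mxE -big_split; apply: eq_bigr => k _ /=.
by rewrite -big_split; apply: eq_bigr => l _ /=; rewrite mxE mulrDr.
Qed.

Lemma tappZ (C : tensor4_field R d) x c A : tapp C x (c *: A) = c *: tapp C x A.
Proof.
apply/matrixP => i j; rewrite !mxE mulr_sumr; apply: eq_bigr => k _.
by rewrite mulr_sumr; apply: eq_bigr => l _; rewrite mxE mulrCA.
Qed.

Lemma frob_tapp_sym (C : tensor4_field R d) x A B :
  (forall i j k l, C x i j k l = C x k l i j) -> frob (tapp C x A) B = frob A (tapp C x B).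
Proof.
move=> h; rewrite /frob.
transitivity (\sum_i \sum_j \sum_k \sum_l C x i j k l * A k l * B i j).
  apply: eq_bigr => i _; apply: eq_bigr => j _; rewrite mxE mulr_suml.
  by apply: eq_bigr => k _; rewrite mulr_suml.
transitivity (\sum_k \sum_l \sum_i \sum_j C x i j k l * A k l * B i j); last first.
  apply: eq_bigr => k _; apply: eq_bigr => l _; rewrite mxE mulr_sumr.
  apply: eq_bigr => i _; rewrite mulr_sumr; apply: eq_bigr => j _.
  by rewrite (h i j k l) mulrAC mulrC.
rewrite (eq_bigr (fun i => \sum_k \sum_j \sum_l C x i j k l * A k l * B i j)); last first.
  by move=> i _; rewrite exchange_big.
rewrite exchange_big; apply: eq_bigr => k _.
rewrite (eq_bigr (fun i => \sum_l \sum_j C x i j k l * A k l * B i j)); last first.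
  by move=> i _; rewrite exchange_big.
by rewrite exchange_big.
Qed.

End frobenius.

Section piecewise_tensors.
Context {R : realType} {n : nat}.
Variables (M : mesh R n.+1) (Om : set 'rV[R]_n.+1) (k : nat).
Hypothesis dec : is_decomposition M Om.
Hypotheses (oOm : open Om) (bOm : bounded_set Om).
Implicit Types (K : cell M) (E : face M) (s t : broken_tensor M).

Let mOm : measurable Om. Proof. exact: open_measurable_rV. Qed.

Definition lin_tensor (a : R) s t : broken_tensor M :=
  [ffun K => \matrix_(i, j) (a *: s K i j + t K i j)].

Lemma glue_cell (V : nmodType) (u : cell M -> 'rV[R]_n.+1 -> V) K x :
  cell_int K x -> Defs.glue u x = u K x.
Proof.
move=> Kx; rewrite /Defs.glue (bigD1 K) ?mem_set//= big1 ?addr0// => K' /andP[/set_mem K'x].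
by rewrite (cell_int_disjoint dec K'x Kx) eqxx.
Qed.

(** Written with indicators, a piecewise polynomial is visibly measurable, bounded and linear in its
    pieces. *)
Lemma tensor_funE s x i j :
  tensor_fun s x i j = \sum_K \1_(cell_int K) x * pev (s K i j) x.
Proof.
rewrite /tensor_fun /Defs.glue summxE big_mkcond; apply: eq_bigr => K _.
rewrite indicE; case: (x \in cell_int K); last by rewrite mul0r.
by rewrite mul1r mxE.
Qed.

Lemma tensor_fun_bounded s i j : bounded_measurable Om (fun x => tensor_fun s x i j).
Proof.
under eq_fun do rewrite tensor_funE; apply: bounded_measurable_sum => K.
apply: bounded_measurableM; last exact: bounded_measurable_pev.
by apply: bounded_measurable_indic; exact: cell_int_measurable.
Qed.

Lemma tensor_fun_lin a s t x :
  tensor_fun (lin_tensor a s t) x = a *: tensor_fun s x + tensor_fun t x.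
Proof.
apply/matrixP => i j; rewrite mxE mxE !tensor_funE mulr_sumr -big_split; apply: eq_bigr => K _ /=.
by rewrite ffunE mxE pevD pevZ; ring.
Qed.

Lemma tensor_fun_symm s x : Sigma_h k s -> symm (tensor_fun s x).
Proof.
move=> hs; apply/matrixP => i j; rewrite mxE !tensor_funE; apply: eq_bigr => K _.
by have [/matrixP/(_ i j)] := hs K; rewrite mxE => ->.
Qed.

Lemma Sigma_h_lin a s t : Sigma_h k s -> Sigma_h k t -> Sigma_h k (lin_tensor a s t).
Proof.
move=> hs ht K; have [sK sd] := hs K; have [tK td] := ht K; split=> [|i j].
  apply/matrixP => i j; rewrite ffunE !mxE.
  by have /matrixP/(_ i j) := sK; have /matrixP/(_ i j) := tK; rewrite !mxE => -> ->.
by rewrite ffunE mxE; apply: deg_leD => //; exact: deg_leZ.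
Qed.

Lemma ip_tensor_integrable s t : (lebesgue_rV R n.+1).-integrable Om
  (EFin \o (fun x => frob (tensor_fun s x) (tensor_fun t x))).
Proof.
apply: bounded_measurable_integrable => //; apply: bounded_measurable_sum => i.
apply: bounded_measurable_sum => j.
by apply: bounded_measurableM; exact: tensor_fun_bounded.
Qed.

Lemma ip_tensorC s t :
  ip_tensor Om (tensor_fun s) (tensor_fun t) = ip_tensor Om (tensor_fun t) (tensor_fun s).
Proof. by congr Rintegral; apply/funext => x; rewrite frobC. Qed.

Lemma ip_tensor_linl a s s' t :
  ip_tensor Om (tensor_fun (lin_tensor a s s')) (tensor_fun t) =
  a * ip_tensor Om (tensor_fun s) (tensor_fun t) + ip_tensor Om (tensor_fun s') (tensor_fun t).
Proof.
rewrite /ip_tensor -RintegralZl//; last exact: ip_tensor_integrable.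
rewrite -RintegralD//; [|exact/integrableZ_fun/ip_tensor_integrable|exact: ip_tensor_integrable].
by congr Rintegral; apply/funext => x; rewrite tensor_fun_lin frobDl frobZl.
Qed.

(** The interior of a cell is a nonempty open subset of the closure of [Om]. *)
Lemma cell_meets_domain K : (cell_int K `&` Om) !=set0.
Proof.
have [x Kx] := polytope_interior_neq0 (cell_polytope dec K).
have : closure Om x by rewrite (closure_domain dec); exists K => //; exact: interior_subset.
move=> /(_ (cell_int K)) h; have [] : (Om `&` cell_int K) !=set0.
  by apply: h; apply: open_nbhs_nbhs; split=> //; exact: open_interior.
by move=> y [? ?]; exists y.
Qed.

(** The integral splits into those of the squared entries; each entry therefore vanishes on an open
    part of every cell, hence as a polynomial. *)
Lemma ip_tensor_eq0 s : ip_tensor Om (tensor_fun s) (tensor_fun s) = 0 ->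
  forall K, s K = 0.
Proof.
rewrite /ip_tensor /frob => h K.
have sq i j : (lebesgue_rV R n.+1).-integrable Om (EFin \o (fun x => tensor_fun s x i j ^+ 2)).
  apply: bounded_measurable_integrable => //; under eq_fun do rewrite expr2.
  by apply: bounded_measurableM; exact: tensor_fun_bounded.
have : \sum_i \sum_j \int[lebesgue_rV R n.+1]_(x in Om) tensor_fun s x i j ^+ 2 = 0.
  apply: etrans h; rewrite Rintegral_sum_fun// => [|i _]; last first.
    by apply: integrable_sum_fun => // j _; exact: sq.
  by apply: eq_bigr => i _; rewrite Rintegral_sum_fun// => j _; exact: sq.
have ge0 i j : 0 <= \int[lebesgue_rV R n.+1]_(x in Om) tensor_fun s x i j ^+ 2.
  by apply: Rintegral_ge0 => x _; exact: sqr_ge0.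
move=> /psumr_eq0P h1; apply/matrixP => i j; rewrite [RHS]mxE.
have /psumr_eq0P h2 : \sum_j \int[lebesgue_rV R n.+1]_(x in Om) tensor_fun s x i j ^+ 2 = 0.
  by apply: h1 => // a _; apply: sumr_ge0.
apply: (@Rintegral_sqr_eq0 _ _ (s K i j) Om (fun x => tensor_fun s x i j) (cell_int K `&` Om)) => //.
- by apply: openI => //; exact: open_interior.
- exact: cell_meets_domain.
- by move=> x [Kx _]; rewrite /tensor_fun (glue_cell _ Kx) mxE.
- by apply: h2.
Qed.

End piecewise_tensors.

(** * Integrability, bilinearity and coercivity of the form of [Ci] *)

Section compliance.
Context {R : realType} {n : nat}.
Variables (M : mesh R n.+1) (Om : set 'rV[R]_n.+1) (k : nat).
Hypothesis dec : is_decomposition M Om.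
Hypotheses (oOm : open Om) (bOm : bounded_set Om).
Variables (C Ci : tensor4_field R n.+1) (M0 M1 : R).
Hypotheses (hC : elasticity_tensor Om C) (hCi : inverse_tensor Om C Ci).
Hypotheses (M0_gt0 : 0 < M0).
Hypothesis hbound : {ae lebesgue_rV R n.+1, forall x, Om x -> forall A, symm A ->
     M0 * frob A A <= frob (tapp Ci x A) A <= M1 * frob A A}.
Implicit Types (K : cell M) (s t : broken_tensor M).

Let mOm : measurable Om. Proof. exact: open_measurable_rV. Qed.

Lemma frob_ge0 (A : 'M[R]_n.+1) : 0 <= frob A A.
Proof. by apply: sumr_ge0 => i _; apply: sumr_ge0 => j _; rewrite -expr2 sqr_ge0. Qed.

Lemma symmD (A B : 'M[R]_n.+1) : symm A -> symm B -> symm (A + B).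
Proof. by rewrite /symm linearD /= => -> ->. Qed.

Lemma symmN (A : 'M[R]_n.+1) : symm A -> symm (- A).
Proof. by rewrite /symm linearN /= => ->. Qed.

(* The form of Ci inherits its symmetry from that of C; being nonnegative at
   A + B and A - B it is bounded off the diagonal. *)
Lemma ae_compliance_bound : {ae lebesgue_rV R n.+1, forall x, Om x -> forall A B,
  symm A -> symm B -> `|frob (tapp Ci x A) B| <= M1 * (frob A A + frob B B)}.
Proof.
apply: filterS3 hC.2 hCi.2 hbound => x hCx hCix hbx Ox A B sA sB.
have [_ symC _] := hCx Ox.
have sym2 : frob (tapp Ci x B) A = frob (tapp Ci x A) B.
  have [_ CB _] := hCix Ox B sB; have [_ CA _] := hCix Ox A sA.
  rewrite -{1}CA (frobC (tapp Ci x B)) (frob_tapp_sym _ _ symC) CB.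
  by [].
have q0 D : symm D -> 0 <= frob (tapp Ci x D) D.
  move=> sD; have /andP[h _] := hbx Ox D sD; apply: le_trans h.
  by rewrite mulr_ge0 ?frob_ge0// ltW.
have hp := q0 _ (symmD sA sB); have hm := q0 _ (symmD sA (symmN sB)).
rewrite -scaleN1r in hm; rewrite !(tappD, tappZ, frobDl, frobDr, frobZl, frobZr) sym2 in hp hm.
have /andP[_ hA] := hbx Ox A sA; have /andP[_ hB] := hbx Ox B sB.
have ? := q0 _ sA; have ? := q0 _ sB.
by rewrite ler_norml mulrDr; apply/andP; split; lra.
Qed.

Lemma measurable_compliance s t : measurable_fun Om
  (fun x => frob (tapp Ci x (tensor_fun s x)) (tensor_fun t x)).
Proof.
apply: measurable_sum => i; apply: measurable_sum => j.
apply: measurable_funM; last by have [] := tensor_fun_bounded oOm bOm t i j.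
under eq_fun do rewrite mxE; apply: measurable_sum => a; apply: measurable_sum => b.
apply: measurable_funM; first exact: hCi.1.
by have [] := tensor_fun_bounded oOm bOm s a b.
Qed.

(** The entries of [Ci] have no bound of their own; symmetry of the discrete tensors gives access to
    [ae_compliance_bound], whose right-hand side is integrable. *)
Lemma compliance_integrable s t : Sigma_h k s -> Sigma_h k t ->
  (lebesgue_rV R n.+1).-integrable Om
    (EFin \o (fun x => frob (tapp Ci x (tensor_fun s x)) (tensor_fun t x))).
Proof.
move=> hs ht.
pose g x := M1 * (frob (tensor_fun s x) (tensor_fun s x) + frob (tensor_fun t x) (tensor_fun t x)).
have Ig : (lebesgue_rV R n.+1).-integrable Om (EFin \o g).
  by apply: integrableZ_fun => //; apply: integrableD_fun => //; exact: ip_tensor_integrable.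
have /integrableP[mg fg] := Ig.
apply/integrableP; split; first by apply/measurable_EFinP; exact: measurable_compliance.
apply: le_lt_trans fg; apply: ae_ge0_le_integral => //.
- by apply: measurableT_comp => //; apply/measurable_EFinP; exact: measurable_compliance.
- exact: measurableT_comp.
apply: filterS ae_compliance_bound => x h Ox; rewrite /= lee_fin.
apply: (le_trans (h Ox _ _ (tensor_fun_symm x hs) (tensor_fun_symm x ht))).
exact: ler_norm.
Qed.

Definition compliance s t : R := a_h Om Ci (tensor_fun s) (tensor_fun t).

Lemma compliance_linl a s s' t : Sigma_h k s -> Sigma_h k s' -> Sigma_h k t ->
  compliance (lin_tensor a s s') t = a * compliance s t + compliance s' t.
Proof.
move=> hs hs' ht; have I1 := compliance_integrable hs ht; have I2 := compliance_integrable hs' ht.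
rewrite /compliance /a_h /ip_tensor -RintegralZl// -RintegralD//; last exact: integrableZ_fun.
by congr Rintegral; apply/funext => x; rewrite tensor_fun_lin tappD tappZ frobDl frobZl.
Qed.

Lemma compliance_linr a s t t' : Sigma_h k s -> Sigma_h k t -> Sigma_h k t' ->
  compliance s (lin_tensor a t t') = a * compliance s t + compliance s t'.
Proof.
move=> hs ht ht'; have I1 := compliance_integrable hs ht; have I2 := compliance_integrable hs ht'.
rewrite /compliance /a_h /ip_tensor -RintegralZl// -RintegralD//; last exact: integrableZ_fun.
by congr Rintegral; apply/funext => x; rewrite tensor_fun_lin frobDr frobZr.
Qed.

Lemma compliance_increment c s s' t : Sigma_h k s -> Sigma_h k s' -> Sigma_h k t ->
  a_h Om Ci (fun x => c *: (tensor_fun s x - tensor_fun s' x)) (tensor_fun t) =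
  c * (compliance s t - compliance s' t).
Proof.
move=> hs hs' ht; have I1 := compliance_integrable hs ht; have I2 := compliance_integrable hs' ht.
rewrite /compliance /a_h /ip_tensor -RintegralB// -RintegralZl//; last exact: (integrableB mOm I1 I2).
congr Rintegral; apply/funext => x.
by rewrite tappZ frobZl -scaleN1r tappD tappZ frobDl frobZl mulN1r.
Qed.

Lemma compliance_ge s : Sigma_h k s ->
  M0 * ip_tensor Om (tensor_fun s) (tensor_fun s) <= compliance s s.
Proof.
move=> hs; have I1 := compliance_integrable hs hs.
have I2 := ip_tensor_integrable oOm bOm s s.
have I3 := integrableZ_fun mOm M0 I2.
rewrite /compliance /a_h /ip_tensor -RintegralZl// /Rintegral fine_le//.
- exact: integrable_fin_num.
- exact: integrable_fin_num.
have c0 x : 0 <= M0 * frob (tensor_fun s x) (tensor_fun s x).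
  by rewrite mulr_ge0 ?frob_ge0// ltW.
(* The integrand is nonnegative almost everywhere only; its absolute value equals it there and is
   nonnegative everywhere, as the comparison of integrals requires. *)
rewrite [X in (_ <= X)%E](_ : _ = \int[lebesgue_rV R n.+1]_(x in Om)
    (`|frob (tapp Ci x (tensor_fun s x)) (tensor_fun s x)|)%:E)%E.
  apply: ae_ge0_le_integral => //.
  - by move=> x _; rewrite lee_fin.
  - exact: (measurable_int _ I3).
  - apply/measurable_EFinP; apply: measurableT_comp => //; exact: measurable_compliance.
  apply: filterS hbound => x h Ox; rewrite lee_fin.
  have /andP[h1 _] := h Ox _ (tensor_fun_symm x hs).
  by apply: le_trans h1 _; exact: ler_norm.
apply: ae_eq_integral => //.
- exact: (measurable_int _ I1).
- apply/measurable_EFinP; apply: measurableT_comp => //; exact: measurable_compliance.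
apply: filterS hbound => x h Ox; congr EFin; rewrite ger0_norm//.
have /andP[h1 _] := h Ox _ (tensor_fun_symm x hs).
by apply: le_trans h1.
Qed.

Lemma compliance_eq0 s : Sigma_h k s -> compliance s s <= 0 -> forall K, s K = 0.
Proof.
move=> hs c0; apply: (ip_tensor_eq0 dec oOm bOm).
have := le_trans (compliance_ge hs) c0; rewrite pmulr_rle0// => h.
by apply/eqP; rewrite eq_le h /=; apply: Rintegral_ge0 => x _; exact: frob_ge0.
Qed.

End compliance.

(** * Symmetry of the projected initial stress *)

Section initial_stress.
Context {R : realType} {n : nat}.
Variables (M : mesh R n.+1) (Om : set 'rV[R]_n.+1) (k : nat).
Hypothesis dec : is_decomposition M Om.
Hypothesis hOm : convex_polyhedral_domain Om.

Lemma domain_open : open Om.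
Proof. by case: hOm => _ _ [H ->]; exact: open_halfspaces. Qed.

Lemma domain_bounded : bounded_set Om. Proof. by case: hOm. Qed.

(** Cells lie in the closed polyhedron with the constraints of [Om], and interior points satisfy
    those with nonzero normal strictly; a point of [Om] settles the others. *)
Lemma cell_int_subset (K : cell M) : cell_int K `<=` Om.
Proof.
case: hOm => -[x0 Ox0] _ [H OmE] x Kx; rewrite OmE => h hH.
have [h0|h0] := eqVneq h.1 0.
  by move: Ox0; rewrite OmE => /(_ h hH); rewrite h0 !dot0p.
apply: (@interior_polyhedron_lt _ _ H) => //.
apply: (@interiorS _ (cell_set K)) Kx => y Ky.
have : closure Om y by rewrite (closure_domain dec); exists K.
have /closure_id -> := @closed_closed_polyhedron R n.+1 H.
by apply: closureS => z; rewrite OmE => hz h' h'H; apply/ltW/hz.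
Qed.

(** For a general [g] the selection may fall back on its default 0, which also satisfies the degree
    bound. *)
Lemma L2proj_deg (D : set 'rV[R]_n.+1) g : deg_le k (L2proj D k g).
Proof.
rewrite /L2proj; set P := (X in xget _ X).
have [h|h] := pselect (exists p, P p); first by have [] := xgetPex 0 h.
rewrite xgetPN; first exact: deg_le0.
by move=> p Pp; apply: h; exists p.
Qed.

(** Entries that agree almost everywhere have the same inner products with polynomials, so the two
    sets from which [xget] selects coincide, and so do the selected polynomials. *)
Lemma Qk0_Sigma_h psi : L2_sym Om psi -> Sigma_h k (@Qk0 R n.+1 M k psi).
Proof.
move=> [hpsi sympsi] K; split=> [|i j]; last by rewrite ffunE mxE; exact: L2proj_deg.
have mC := cell_int_measurable K.
have mpsi i j : measurable_fun (cell_int K) (fun x => psi x i j).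
  have [h _] := hpsi i j; apply: measurable_funS h => //; last exact: cell_int_subset.
  by apply: open_measurable_rV; exact: domain_open.
apply/matrixP => i j; rewrite ffunE !mxE /L2proj; congr (xget _ _).
suff ipE p : ip (cell_int K) (fun x => psi x j i) (pev p) =
    ip (cell_int K) (fun x => psi x i j) (pev p).
  by apply/seteqP; split=> p [pk hp]; split=> // q qk; rewrite hp// ipE.
rewrite /ip /Rintegral; congr fine; apply: ae_eq_integral => //.
- by apply/measurable_EFinP; apply: measurable_funM => //; exact: measurable_pev.
- by apply/measurable_EFinP; apply: measurable_funM => //; exact: measurable_pev.
apply: filterS sympsi => x h Kx; congr ((_ * _)%:E).
by have /matrixP/(_ i j) := h (cell_int_subset Kx); rewrite mxE.
Qed.

End initial_stress.

Section discrete_forms.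
Context {R : realType} {n : nat}.
Variables (M : mesh R n.+1) (Om : set 'rV[R]_n.+1) (k : nat).
Hypothesis dec : is_decomposition M Om.
Hypotheses (oOm : open Om) (bOm : bounded_set Om).
Implicit Types (K : cell M) (E : face M) (s t : broken_tensor M) (v w : weak_vector M).
Local Notation F E := (face_frame (face_geo E) : 'M[R]_(n, n.+1)).
Local Notation org E := (face_origin (face_geo E)).
Local Notation dom E := (face_dom (face_geo E) : set 'rV[R]_n).
Local Notation chart E := (face_chart (face_geo E)).

Let mOm : measurable Om. Proof. exact: open_measurable_rV. Qed.

Definition lin_vec (a : R) v w : weak_vector M :=
  ([ffun K => \row_i (a *: v.1 K 0 i + w.1 K 0 i)],
   [ffun E => \row_i (a *: v.2 E 0 i + w.2 E 0 i)]).

Definition zero_vec : weak_vector M := ([ffun=> 0], [ffun=> 0]).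

Definition zero_tensor : broken_tensor M := [ffun=> 0].

Lemma lin_vecN1 w : lin_vec (-1) w w = zero_vec.
Proof.
by congr pair; apply/ffunP => X; rewrite !ffunE; apply/rowP => i; rewrite !mxE scaleN1r addNr.
Qed.

Lemma lin_tensorN1 s : lin_tensor (-1) s s = zero_tensor.
Proof.
by apply/ffunP => X; rewrite !ffunE; apply/matrixP => i j; rewrite !mxE scaleN1r addNr.
Qed.

Lemma V_h0_lin a v w : V_h0 Om k v -> V_h0 Om k w -> V_h0 Om k (lin_vec a v w).
Proof.
move=> [[v1 v2] v3] [[w1 w2] w3]; split; first split.
- by move=> K i; rewrite ffunE mxE; apply: deg_leD => //; exact: deg_leZ.
- by move=> E i; rewrite ffunE mxE; apply: deg_leD => //; exact: deg_leZ.
- move=> E bE; rewrite ffunE; apply/rowP => i.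
  by rewrite !mxE v3// w3// !mxE scaler0 addr0.
Qed.

Lemma V_h0_zero : V_h0 Om k zero_vec.
Proof.
split=> [|E _]; last by rewrite ffunE.
by split=> X i; rewrite ffunE mxE; exact: deg_le0.
Qed.

Lemma Sigma_h_zero : Sigma_h k zero_tensor.
Proof.
move=> K; rewrite ffunE; split=> [|i j]; first by rewrite trmx0.
by rewrite mxE; exact: deg_le0.
Qed.

Lemma trace_polyE K E v i :
  face_trace E (fun x => pevmx (v.1 K) x 0 i) = pev (affine_comp (F E) (org E) (v.1 K 0 i)).
Proof. by apply/funext => u; rewrite /face_trace /= mxE (pev_trace E). Qed.

Lemma jumpE K E v i : jump k K E v 0 i =
  L2proj (dom E) k (pev (affine_comp (F E) (org E) (v.1 K 0 i))) - v.2 E 0 i.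
Proof. by rewrite /jump !mxE trace_polyE. Qed.

Lemma jump_lin K E a v w i :
  jump k K E (lin_vec a v w) 0 i = a *: jump k K E v 0 i + jump k K E w 0 i.
Proof.
rewrite !jumpE !ffunE !mxE affine_comp_lin L2proj_lin.
- by rewrite scalerBr opprD addrACA.
- exact: dom_measurable dec E.
- exact: dom_bounded dec E.
- exact: dom_interior dec E.
Qed.

Lemma s_hE v w : s_h k v w = \sum_(K : cell M) \sum_(E : face M | face_of K E) \sum_(i < n.+1)
  (diam_face E)^-1 * ip (dom E) (pev (jump k K E v 0 i)) (pev (jump k K E w 0 i)).
Proof.
apply: eq_bigr => K _; apply: eq_bigr => E _; apply: eq_bigr => i _.
rewrite -(ip_pevZl _ _ _ (dom_measurable dec E) (dom_bounded dec E)).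
by rewrite /face_ip; congr ip; apply/funext => u; rewrite pevZ.
Qed.

Lemma s_hC v w : s_h k v w = s_h k w v.
Proof.
by rewrite !s_hE; do 3 (apply: eq_bigr => ? _); rewrite ipC.
Qed.

Lemma s_h_linl a v v' w : s_h k (lin_vec a v v') w = a * s_h k v w + s_h k v' w.
Proof.
rewrite !s_hE mulr_sumr -big_split; apply: eq_bigr => K _ /=.
rewrite mulr_sumr -big_split; apply: eq_bigr => E _ /=.
rewrite mulr_sumr -big_split; apply: eq_bigr => i _ /=.
have [mE bE] := (dom_measurable dec E, dom_bounded dec E).
by rewrite jump_lin ip_pevDl// ip_pevZl//; ring.
Qed.

Lemma s_h_linr a v w w' : s_h k v (lin_vec a w w') = a * s_h k v w + s_h k v w'.
Proof. by rewrite !(s_hC v) s_h_linl. Qed.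

(** In positive dimension a face contains two points at distance [r / 2], the chart being isometric.
    The diameter is a supremum, so boundedness of the face is needed as well. *)
Lemma diam_face_gt0 E : (0 < n)%N -> 0 < diam_face E.
Proof.
move=> n0; have [K KE] := face_of_exists dec E.
have [u0 iu0] := dom_interior dec E.
pose j0 : 'I_n := Ordinal n0; pose e : 'rV[R]_n := delta_mx 0 j0.
have [r r0 hr] := nbhs_line e iu0.
have Du0 : dom E u0 by exact: interior_subset.
have Du1 : dom E (u0 + (r / 2) *: e).
  by apply: hr; rewrite gtr0_norm ?divr_gt0// ltr_pdivrMr// ltr_pMr// ltr1n.
have [FF _ _] := cell_frame dec KE.
have dE : chart E (u0 + (r / 2) *: e) - chart E u0 = (r / 2) *: row j0 (F E).
  by rewrite /face_chart opprD addrACA subrr add0r -mulmxBl addrAC subrr add0r -scalemxAl -rowE.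
have nE : enorm (chart E (u0 + (r / 2) *: e) - chart E u0) = r / 2.
  rewrite /enorm dE dotpZr dotpC dotpZr.
  have -> : dotp (row j0 (F E)) (row j0 (F E)) = 1.
    have /matrixP/(_ j0 j0) := FF; rewrite !mxE eqxx => h; apply: etrans h.
    by apply: eq_bigr => a _; rewrite !mxE.
  by rewrite mulr1 -expr2 sqrtr_sqr gtr0_norm// divr_gt0.
have [L L0 KL] := bounded_subset_ball (A := cell_set K) ltac:(by case: (cell_polytope dec K)).
have EL x : face_set (face_geo E) x -> ball 0 L x.
  move=> Ex; apply: KL; have /(boundary_cellE dec)[] // : boundary (cell_set K) x.
  by apply/(boundary_cell dec); exists E.
apply: (@lt_le_trans _ _ (r / 2)); first by rewrite divr_gt0.
rewrite -nE /diam_face /diam; apply: ub_le_sup; last first.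
  exists (chart E (u0 + (r / 2) *: e)); first by exists (u0 + (r / 2) *: e).
  by exists (chart E u0) => //; exists u0.
(* Both points lie in the cube of half side [L], so their coordinates differ by at most [L + L]. *)
exists (Num.sqrt (\sum_(i < n.+1) (L + L) ^+ 2)) => _ [x /EL Lx [y /EL Ly <-]].
rewrite /enorm ler_sqrt; last by apply: sumr_ge0 => i _; exact: sqr_ge0.
apply: ler_sum => i _; rewrite !mxE -expr2 -[leLHS]real_normK ?num_real//.
rewrite ler_sqr ?nnegrE//; last by rewrite addr_ge0// ltW.
move: Lx Ly => /(rV_ballP _ _ L0)/(_ i) + /(rV_ballP _ _ L0)/(_ i).
rewrite !mxE !sub0r !normrN => hx hy.
by apply/ltW; rewrite (le_lt_trans (ler_normB _ _))// ltrD.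
Qed.

Lemma s_h_eq0 v : (0 < n)%N -> s_h k v v <= 0 ->
  forall K E, face_of K E -> jump k K E v = 0.
Proof.
move=> n0; rewrite s_hE => h.
have ge K E i : 0 <= (diam_face E)^-1 *
    ip (dom E) (pev (jump k K E v 0 i)) (pev (jump k K E v 0 i)).
  by rewrite mulr_ge0 ?ip_pev_ge0// invr_ge0 ltW// diam_face_gt0.
have geE K E : 0 <= \sum_(i < n.+1) (diam_face E)^-1 *
    ip (dom E) (pev (jump k K E v 0 i)) (pev (jump k K E v 0 i)).
  by apply: sumr_ge0 => i _.
have geK K : 0 <= \sum_(E : face M | face_of K E) \sum_(i < n.+1) (diam_face E)^-1 *
    ip (dom E) (pev (jump k K E v 0 i)) (pev (jump k K E v 0 i)).
  by apply: sumr_ge0 => E _.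
move=> K E KE; apply/rowP => i; rewrite [RHS]mxE.
have /psumr_eq0P h1 : \sum_(K : cell M) \sum_(E : face M | face_of K E) \sum_(i < n.+1) (diam_face E)^-1 *
    ip (dom E) (pev (jump k K E v 0 i)) (pev (jump k K E v 0 i)) = 0.
  by apply/eqP; rewrite eq_le h sumr_ge0.
have /psumr_eq0P h2 := h1 (fun K _ => geK K) K isT.
have /psumr_eq0P h3 := h2 (fun E _ => geE K E) E KE.
have /eqP := h3 (fun i _ => ge K E i) i isT.
rewrite mulf_eq0 invr_eq0 gt_eqF ?diam_face_gt0//= => /eqP.
exact: ip_pev_eq0 (dom_measurable dec E) (dom_bounded dec E) (dom_interior dec E).
Qed.

(** The weak strain as an element of [Sigma_h], which makes it available as a test tensor. *)
Definition strain_tensor w : broken_tensor M :=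
  [ffun K => \matrix_(i, j)
     (2^-1 *: (weak_gradient_vec k w K i j + weak_gradient_vec k w K j i))].

Lemma weak_strainE w : weak_strain k w = tensor_fun (strain_tensor w).
Proof.
apply/funext => x; rewrite /weak_strain /tensor_fun /Defs.glue; apply: eq_bigr => K _.
by apply/matrixP => i j; rewrite !mxE ffunE !mxE pevZ pevD.
Qed.

Lemma b_hE t w : b_h Om k t w = ip_tensor Om (tensor_fun (strain_tensor w)) (tensor_fun t).
Proof. by rewrite /b_h weak_strainE. Qed.

Lemma strain_tensor_lin a v w :
  strain_tensor (lin_vec a v w) = lin_tensor a (strain_tensor v) (strain_tensor w).
Proof.
have gE K i j : weak_gradient_vec k (lin_vec a v w) K i j =
    a *: weak_gradient_vec k v K i j + weak_gradient_vec k w K i j.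
  rewrite [LHS]mxE [in RHS]mxE [in X in _ + X]mxE.
  rewrite (_ : (fun K => (lin_vec a v w).1 K 0 i) =
    fun K => a *: v.1 K 0 i + w.1 K 0 i); last by apply/funext => X; rewrite ffunE mxE.
  rewrite (_ : (fun E => (lin_vec a v w).2 E 0 i) =
    fun E => a *: v.2 E 0 i + w.2 E 0 i); last by apply/funext => X; rewrite ffunE mxE.
  by rewrite (weak_gradient_lin k dec) mxE.
have sE (u : weak_vector M) K i j : strain_tensor u K i j =
    2^-1 *: (weak_gradient_vec k u K i j + weak_gradient_vec k u K j i).
  by rewrite /strain_tensor ffunE [LHS]mxE.
have comb (c : R) (x x' y y' z z' s t : mpoly n.+1 R) : x = a *: y + z ->
    x' = a *: y' + z' -> s = c *: (y + y') -> t = c *: (z + z') ->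
    c *: (x + x') = a *: s + t.
  by move=> -> -> -> ->; rewrite !scalerDr !scalerA (mulrC a) addrACA.
apply/ffunP => K; apply/matrixP => i j.
have -> : lin_tensor a (strain_tensor v) (strain_tensor w) K i j =
    a *: strain_tensor v K i j + strain_tensor w K i j by rewrite /lin_tensor ffunE [LHS]mxE.
apply: etrans (sE _ _ _ _) _.
exact: comb (gE K i j) (gE K j i) (sE v K i j) (sE w K i j).
Qed.

Lemma strain_tensor_Sigma_h w : Sigma_h k (strain_tensor w).
Proof.
move=> K; rewrite ffunE; split=> [|i j].
  by apply/matrixP => i j; rewrite !mxE addrC.
rewrite mxE; apply: deg_leZ; apply: deg_leD; rewrite mxE;
  exact: (weak_gradient_spec k dec _ _ _).1.
Qed.

Lemma b_h_lin_vec a t v w : b_h Om k t (lin_vec a v w) = a * b_h Om k t v + b_h Om k t w.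
Proof. by rewrite !b_hE strain_tensor_lin ip_tensor_linl. Qed.

Lemma b_h_lin_tensor a s t w : b_h Om k (lin_tensor a s t) w = a * b_h Om k s w + b_h Om k t w.
Proof. by rewrite !b_hE ![ip_tensor _ (tensor_fun (strain_tensor w)) _]ip_tensorC ip_tensor_linl. Qed.

Lemma interior_funE w x i :
  interior_fun w x 0 i = \sum_K \1_(cell_int K) x * pev (w.1 K 0 i) x.
Proof.
rewrite /interior_fun /Defs.glue summxE big_mkcond; apply: eq_bigr => K _.
rewrite indicE; case: (x \in cell_int K); last by rewrite mul0r.
by rewrite mul1r mxE.
Qed.

Lemma load_lin (f : 'rV[R]_n.+1 -> 'rV[R]_n.+1) a v w : (forall i, L2 Om (fun x => f x 0 i)) ->
  ip_vector Om f (interior_fun (lin_vec a v w)) =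
  a * ip_vector Om f (interior_fun v) + ip_vector Om f (interior_fun w).
Proof.
move=> fL2.
have I (u : weak_vector M) : (lebesgue_rV R n.+1).-integrable Om
    (EFin \o (fun x => dotp (f x) (interior_fun u x))).
  apply: integrable_sum_fun => // i _.
  apply: (square_integrableM mOm bOm (g := fun x => interior_fun u x 0 i)) => //.
  under eq_fun do rewrite interior_funE; apply: bounded_measurable_sum => K.
  apply: bounded_measurableM; last exact: bounded_measurable_pev.
  by apply: bounded_measurable_indic; exact: cell_int_measurable.
rewrite /ip_vector -RintegralZl// -RintegralD//; last exact: integrableZ_fun.
congr Rintegral; apply/funext => x; rewrite -dotpZr -dotpDr; congr dotp; apply/rowP => i.
rewrite mxE mxE !interior_funE mulr_sumr -big_split; apply: eq_bigr => K _ /=.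
by rewrite ffunE mxE pevD pevZ; ring.
Qed.

End discrete_forms.

(** * One time step *)

Section euler_step.
Context {R : realType} {n : nat}.
Variables (M : mesh R n.+1) (Om : set 'rV[R]_n.+1) (k : nat).
Hypothesis dec : is_decomposition M Om.
Hypotheses (oOm : open Om) (bOm : bounded_set Om) (n0 : (0 < n)%N) (k0 : (1 <= k)%N).
Variables (C Ci : tensor4_field R n.+1) (M0 M1 : R).
Hypotheses (hC : elasticity_tensor Om C) (hCi : inverse_tensor Om C Ci).
Hypotheses (M0_gt0 : 0 < M0).
Hypothesis hbound : {ae lebesgue_rV R n.+1, forall x, Om x -> forall A, symm A ->
     M0 * frob A A <= frob (tapp Ci x A) A <= M1 * frob A A}.
Implicit Types (K : cell M) (E : face M) (s t : broken_tensor M) (v w : weak_vector M).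
Local Notation F E := (face_frame (face_geo E) : 'M[R]_(n, n.+1)).
Local Notation org E := (face_origin (face_geo E)).
Local Notation dom E := (face_dom (face_geo E) : set 'rV[R]_n).
Local Notation compl := (@compliance R n M Om Ci).
Local Notation T s t := (ip_tensor Om (tensor_fun s) (tensor_fun t)).

(* Only k >= 1 ensures that the trace of an affine field is its own projection. *)
Lemma strain_free_zero v : V_h0 Om k v ->
  (forall K E, face_of K E -> jump k K E v = 0) ->
  (forall K, strain_tensor k v K = 0) -> v = zero_vec M.
Proof.
move=> [[v1 v2] vb] jv ev.
have vbE K E i : face_of K E ->
    v.2 E 0 i = L2proj (dom E) k (face_trace E (pev (v.1 K 0 i))).
  move=> KE; have /rowP/(_ i) := jv K E KE; rewrite jumpE [RHS]mxE => /eqP.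
  rewrite subr_eq0 => /eqP <-; congr L2proj; apply/funext => u.
  by rewrite /face_trace /= (pev_trace E).
have sk K i j : mderiv j (v.1 K 0 i) + mderiv i (v.1 K 0 j) = 0.
  have := ev K; rewrite ffunE => /matrixP/(_ i j); rewrite mxE [RHS]mxE.
  have gE a b : weak_gradient_vec k v K a b = mderiv b (v.1 K 0 a).
    rewrite /weak_gradient_vec mxE (weak_gradient_classical dec) ?mxE//.
    by move=> E; exact: vbE.
  by rewrite !gE => /eqP; rewrite scaler_eq0 invr_eq0 pnatr_eq0 /= => /eqP.
have deg1 K i : deg_le 1 (v.1 K 0 i) by have [] := deg_le1_pev (killing_affine (sk K) i).
have trE K E i : face_of K E -> v.2 E 0 i = affine_comp (F E) (org E) (v.1 K 0 i).
  move=> KE; rewrite (vbE K E i KE).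
  rewrite (_ : face_trace E _ = pev (affine_comp (F E) (org E) (v.1 K 0 i))); last first.
    by apply/funext => u; rewrite /face_trace /= (pev_trace E).
  apply: L2proj_id.
  - exact: dom_measurable dec E.
  - exact: dom_bounded dec E.
  - exact: dom_interior dec E.
  by apply: deg_le_affine_comp; exact: deg_leW k0 (deg1 K i).
have zeroK K E : face_of K E -> v.2 E = 0 -> v.1 K = 0.
  move=> KE vE; apply: (rigid_zero (cell_frame dec KE) (sk K) (p := org E)) => i.
  by rewrite -trE// vE mxE.
have v10 K : v.1 K = 0.
  apply/eqP; have := @closed_family_empty _ _ M Om dec (fun K => v.1 K != 0) _ K.
  rewrite negbK; apply => {}K vK E KE.
  have [[K' [K'E K'K]]|alone] := pselect (exists K', face_of K' E /\ K' != K).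
    exists K'; split=> //; apply: contra_neq vK => vK'; apply: (zeroK K E KE).
    by apply/rowP => i; rewrite (trE K')// vK' !mxE /affine_comp mmap0.
  case/eqP: vK; apply: (zeroK K E KE); apply: vb.
  apply: (lone_face_boundary dec KE) => K' K'E; apply/eqP/negPn/negP => K'K.
  by apply: alone; exists K'.
rewrite [v]surjective_pairing; congr pair; apply/ffunP => X; rewrite !ffunE//.
have [K KE] := face_of_exists dec X.
by apply/rowP => i; rewrite (trE K)// v10 !mxE /affine_comp mmap0.
Qed.

(** Stands for [dt^-1 + 1], the weight of the unknown stress once the previous one is moved to the
    right-hand side. *)
Variable c : R.
Hypothesis c0 : 0 < c.

Lemma step_homogeneous s v : Sigma_h k s -> V_h0 Om k v ->
  (forall t, Sigma_h k t -> c * compl s t - b_h Om k t v = 0) ->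
  (forall w, V_h0 Om k w -> b_h Om k s w + s_h k v w = 0) ->
  s = zero_tensor M /\ v = zero_vec M.
Proof.
move=> hs hv e1 e2; have E1 := e1 s hs; have E2 := e2 v hv.
have h2 : M0 * T s s <= compl s s by exact: (compliance_ge oOm bOm hC hCi M0_gt0 hbound hs).
have T0 : 0 <= T s s by apply: Rintegral_ge0 => x _; exact: frob_ge0.
have s0 : 0 <= s_h k v v.
  rewrite (s_hE k dec); apply: sumr_ge0 => K _; apply: sumr_ge0 => E _.
  apply: sumr_ge0 => i _; rewrite mulr_ge0 ?ip_pev_ge0// invr_ge0 ltW//.
  exact: (diam_face_gt0 dec).
have cs0 : 0 <= compl s s by apply: le_trans h2; rewrite mulr_ge0// ltW.
have {}cs0 : 0 <= c * compl s s by rewrite mulr_ge0// ltW.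
(* Adding [E1] and [E2] cancels the two [b_h] terms and leaves two nonnegative terms with sum
   zero. *)
have ccs : c * compl s s <= 0 by lra.
have sK := compliance_eq0 dec oOm bOm hC hCi M0_gt0 hbound hs.
have {}sK : forall K, s K = 0 by apply: sK; move: ccs; rewrite pmulr_rle0.
have sz : s = zero_tensor M by apply/ffunP => K; rewrite sK ffunE.
split=> //; apply: strain_free_zero => //; first by apply: (s_h_eq0 dec) => //; lra.
(* The first equation is tested with the weak strain of [v]: since [s = 0], it says that the squared
   norm of this strain is zero. *)
apply: (ip_tensor_eq0 dec oOm bOm); rewrite -b_hE.
have hst := strain_tensor_Sigma_h k dec v; have := e1 _ hst.
suff -> : compl s (strain_tensor k v) = 0 by lra.
have := compliance_linl oOm bOm hC hCi M0_gt0 hbound (-1) hs hs hst.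
by rewrite lin_tensorN1 -sz => ->; rewrite mulN1r addNr.
Qed.

Let state := (broken_tensor M * weak_vector M)%type.
Let admissible (x : state) := Sigma_h k x.1 /\ V_h0 Om k x.2.
Let lin (a : R) (x y : state) : state := (lin_tensor a x.1 y.1, lin_vec a x.2 y.2).

(** All coefficients of the stress, the interior velocity and the face velocity. The interior
    velocity has degree [k.+1], hence [k.+2]; symmetry and the boundary condition stay in
    [admissible]. *)
Let index : finType := ((cell M * 'I_n.+1 * 'I_n.+1 * bmultinom n.+1 k.+1) +
  (cell M * 'I_n.+1 * bmultinom n.+1 k.+2) + (face M * 'I_n.+1 * bmultinom n k.+1))%type.

Let coord (x : state) (a : index) : R :=
  match a with
  | inl (inl (K, i, j, m)) => mcoeff (bmnm m) (x.1 K i j)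
  | inl (inr (K, i, m)) => mcoeff (bmnm m) (x.2.1 K 0 i)
  | inr (E, i, m) => mcoeff (bmnm m) (x.2.2 E 0 i)
  end.

(** The two equations are summed into one bilinear form on pairs and recovered by testing with pairs
    having one zero component. [L1] is linear on [Sigma_h] only, where the compliance form is known
    to be integrable. *)
Lemma step_solvable (L1 : broken_tensor M -> R) (L2 : weak_vector M -> R) :
  (forall a s t, Sigma_h k s -> Sigma_h k t -> L1 (lin_tensor a s t) = a * L1 s + L1 t) ->
  (forall a v w, L2 (lin_vec a v w) = a * L2 v + L2 w) ->
  exists s v, [/\ Sigma_h k s, V_h0 Om k v,
    forall t, Sigma_h k t -> c * compl s t - b_h Om k t v = L1 t &
    forall w, V_h0 Om k w -> b_h Om k s w + s_h k v w = L2 w].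
Proof.
move=> hL1 hL2.
pose B (x z : state) := c * compl x.1 z.1 - b_h Om k z.1 x.2 +
  (b_h Om k x.1 z.2 + s_h k x.2 z.2).
have zs : Sigma_h k (zero_tensor M) by exact: Sigma_h_zero.
have zv : V_h0 Om k (zero_vec M) by exact: V_h0_zero.
have L10 : L1 (zero_tensor M) = 0.
  by rewrite -(lin_tensorN1 (zero_tensor M)) hL1// mulN1r addNr.
have L20 : L2 (zero_vec M) = 0 by rewrite -(lin_vecN1 (zero_vec M)) hL2 mulN1r addNr.
have b0t w : b_h Om k (zero_tensor M) w = 0.
  by rewrite -(lin_tensorN1 (zero_tensor M)) (b_h_lin_tensor k oOm bOm) mulN1r addNr.
have b0v t : b_h Om k t (zero_vec M) = 0.
  by rewrite -(lin_vecN1 (zero_vec M)) (b_h_lin_vec k dec oOm bOm) mulN1r addNr.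
have s0v v : s_h k v (zero_vec M) = 0.
  by rewrite -(lin_vecN1 (zero_vec M)) (s_h_linr k dec) mulN1r addNr.
have cl := @compliance_linl R n M Om k oOm bOm _ _ _ _ hC hCi M0_gt0 hbound.
have cr := @compliance_linr R n M Om k oOm bOm _ _ _ _ hC hCi M0_gt0 hbound.
have c0s s : Sigma_h k s -> compl s (zero_tensor M) = 0.
  by move=> hs; rewrite -(lin_tensorN1 (zero_tensor M)) cr// mulN1r addNr.
have := @linear_solve R state index admissible lin (zero_tensor M, zero_vec M) coord
  _ _ _ _ _ B _ _ _ (fun z => L1 z.1 + L2 z.2).
case.
- move=> a x y [[[[[K i] j] m]|[[K i] m]]|[[E i] m]] /=;
    by rewrite ffunE mxE mcoeffD mcoeffZ.
- move=> [s [v1 v2]] [s' [w1 w2]] [/= hs [[/= hv1 hv2] _]] [/= hs' [[/= hw1 hw2] _]] h.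
  congr (_, (_, _)); apply/ffunP => X.
  + have [_ d1] := hs X; have [_ d2] := hs' X; apply/matrixP => i j.
    by apply: (deg_le_coeff_inj (d1 i j) (d2 i j)) => m; exact: (h (inl (inl (X, i, j, m)))).
  + apply/rowP => i; apply: (deg_le_coeff_inj (hv1 X i) (hw1 X i)) => m.
    exact: (h (inl (inr (X, i, m)))).
  + apply/rowP => i; apply: (deg_le_coeff_inj (hv2 X i) (hw2 X i)) => m.
    exact: (h (inr (X, i, m))).
- by move=> [[[[[K i] j] m]|[[K i] m]]|[[E i] m]] /=; rewrite ffunE mxE mcoeff0.
- by [].
- by move=> a x y [hx1 hx2] [hy1 hy2]; split; [exact: Sigma_h_lin|exact: V_h0_lin].
- move=> z [hz1 hz2] a x y [hx1 hx2] [hy1 hy2]; rewrite /B /= cl// (s_h_linl k dec).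
  rewrite (b_h_lin_tensor k oOm bOm) (b_h_lin_vec k dec oOm bOm).
  do 2 (move: (compl _ _) => ?); do 4 (move: (b_h _ _ _ _) => ?).
  by do 2 (move: (s_h _ _ _) => ?); ring.
- move=> x [hx1 hx2] a y z [hy1 hy2] [hz1 hz2]; rewrite /B /= cr// (s_h_linr k dec).
  rewrite (b_h_lin_tensor k oOm bOm) (b_h_lin_vec k dec oOm bOm).
  do 2 (move: (compl _ _) => ?); do 4 (move: (b_h _ _ _ _) => ?).
  by do 2 (move: (s_h _ _ _) => ?); ring.
- move=> [s v] [/= hs hv] h; have [] := step_homogeneous hs hv; last by move=> -> ->.
  + move=> t ht; have := h (t, zero_vec M) (conj ht zv).
    by rewrite /B /= b0v s0v !addr0.
  + move=> w hw; have := h (zero_tensor M, w) (conj zs hw).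
    by rewrite /B /= b0t c0s// mulr0 subr0 add0r.
- by move=> a x y [hx1 hx2] [hy1 hy2]; rewrite /= hL1// hL2; ring.
move=> [s v] [/= hs hv] h; exists s, v; split=> // [t ht|w hw].
  have := h (t, zero_vec M) (conj ht zv).
  by rewrite /B /= b0v s0v L20 !addr0.
have := h (zero_tensor M, w) (conj zs hw).
by rewrite /B /= b0t c0s// L10 mulr0 subr0 !add0r.
Qed.

Lemma step_unique s s' v v' (L1 : broken_tensor M -> R) (L2 : weak_vector M -> R) :
  Sigma_h k s -> Sigma_h k s' -> V_h0 Om k v -> V_h0 Om k v' ->
  (forall t, Sigma_h k t -> c * compl s t - b_h Om k t v = L1 t) ->
  (forall t, Sigma_h k t -> c * compl s' t - b_h Om k t v' = L1 t) ->
  (forall w, V_h0 Om k w -> b_h Om k s w + s_h k v w = L2 w) ->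
  (forall w, V_h0 Om k w -> b_h Om k s' w + s_h k v' w = L2 w) ->
  s = s' /\ v = v'.
Proof.
move=> hs hs' hv hv' e1 e1' e2 e2'.
have cl := @compliance_linl R n M Om k oOm bOm _ _ _ _ hC hCi M0_gt0 hbound.
have [||||z1 z2] := @step_homogeneous (lin_tensor (-1) s s') (lin_vec (-1) v v').
- exact: Sigma_h_lin.
- exact: V_h0_lin.
- move=> t ht; rewrite cl// (b_h_lin_vec k dec oOm bOm).
  have := e1 t ht; have := e1' t ht; move: (L1 t) => ?.
  by do 2 (move: (compl _ _) => ?); do 2 (move: (b_h _ _ _ _) => ?); lra.
- move=> w hw; rewrite (b_h_lin_tensor k oOm bOm) (s_h_linl k dec).
  have := e2 w hw; have := e2' w hw; move: (L2 w) => ?.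
  by do 2 (move: (b_h _ _ _ _) => ?); do 2 (move: (s_h _ _ _) => ?); lra.
have sub0 m (p q : mpoly m R) : -1 *: p + q = 0 -> p = q.
  by rewrite scaleN1r addrC => /eqP; rewrite subr_eq0 => /eqP.
split.
  apply/ffunP => K; apply/matrixP => i j; apply: sub0.
  by have := congr1 (fun f : broken_tensor M => f K i j) z1; rewrite !ffunE !mxE.
rewrite [v]surjective_pairing [v']surjective_pairing; congr pair.
  apply/ffunP => K; apply/rowP => i; apply: sub0.
  by have := congr1 (fun f : weak_vector M => f.1 K 0 i) z2; rewrite !ffunE !mxE.
apply/ffunP => E; apply/rowP => i; apply: sub0.
by have := congr1 (fun f : weak_vector M => f.2 E 0 i) z2; rewrite !ffunE !mxE.
Qed.

End euler_step.

(** * The recursion over the time steps *)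

Lemma load_square_integrable (R : realType) n (Om : set 'rV[R]_n.+1) T
    (f : R -> 'rV[R]_n.+1 -> 'rV[R]_n.+1) (N m : nat) :
  0 < T -> H1_L2 T Om f -> (m <= N)%N -> (0 < N)%N ->
  forall i, L2 Om (fun x => f (m%:R * (T / N%:R)) x 0 i).
Proof.
move=> T0 [_ _ [fL2 _]] mN N0; have N0' : 0 < N%:R :> R by rewrite ltr0n.
apply: fL2; first by rewrite mulr_ge0 ?divr_ge0// ltW.
rewrite mulrCA; apply: ler_piMr; first exact: ltW.
by rewrite ler_pdivrMr// mul1r ler_nat.
Qed.

Theorem theorem4p1 (R : realType) (d : nat) (hd : (d = 2 \/ d = 3)%N)
  (Om : set 'rV[R]_d) (hOm : convex_polyhedral_domain Om)
  (T : R) (hT : 0 < T)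
  (f : R -> 'rV[R]_d -> 'rV[R]_d) (hf : H1_L2 T Om f)
  (psi0 : 'rV[R]_d -> 'M[R]_d) (hpsi0 : L2_sym Om psi0)
  (C Ci : tensor4_field R d)
  (hC : elasticity_tensor Om C) (hCi : inverse_tensor Om C Ci)
  (M0 M1 : R) (hM0 : 0 < M0) (hM1 : 0 < M1)
  (hbound : {ae lebesgue_rV R d, forall x, Om x -> forall A, symm A ->
     M0 * frob A A <= frob (tapp Ci x A) A <= M1 * frob A A})
  (Th : mesh R d) (hTh : is_decomposition Th Om)
  (theta l : R) (htheta : 0 < theta) (hl : 0 < l)
  (hreg : shape_regular Th theta l)
  (k : nat) (hk : (1 <= k)%N) (N : nat) (hN : (0 < N)%N) :
  exists (sigma : nat -> broken_tensor Th) (v : nat -> weak_vector Th),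
    euler_scheme Om k Ci T N f psi0 sigma v /\
    forall (sigma' : nat -> broken_tensor Th) (v' : nat -> weak_vector Th),
      euler_scheme Om k Ci T N f psi0 sigma' v' ->
      forall n, (1 <= n <= N)%N -> sigma' n = sigma n /\ v' n = v n.
Proof.
(* The induction on coordinates needs [d] as a successor, and [0 < n] gives the faces a positive
   diameter. *)
have [n [n0 dn]] : exists n, (0 < n)%N /\ d = n.+1.
  by case: hd => ->; [exists 1%N|exists 2%N].
subst d; move: hTh => dec; have oOm := domain_open hOm; have bOm := domain_bounded hOm.
set dt := T / N%:R; have dt0 : 0 < dt by rewrite divr_gt0// ltr0n.
pose c : R := dt^-1 + 1; have c0 : 0 < c by rewrite addr_gt0// invr_gt0.
pose load m (w : weak_vector Th) := ip_vector Om (f (m%:R * dt)) (interior_fun w).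
pose step m s0 s v := [/\ Sigma_h k s, V_h0 Om k v,
  forall t, Sigma_h k t -> c * compliance Om Ci s t - b_h Om k t v = dt^-1 * compliance Om Ci s0 t &
  forall w, V_h0 Om k w -> b_h Om k s w + s_h k v w = load m w].
have schemeE (s0 s t : broken_tensor Th) (v : weak_vector Th) :
    Sigma_h k s0 -> Sigma_h k s -> Sigma_h k t ->
    a_h Om Ci (fun x => dt^-1 *: (tensor_fun s x - tensor_fun s0 x)) (tensor_fun t) +
      a_h Om Ci (tensor_fun s) (tensor_fun t) - b_h Om k t v =
    (c * compliance Om Ci s t - b_h Om k t v) - dt^-1 * compliance Om Ci s0 t.
  move=> h0 hs ht.
  rewrite (compliance_increment oOm bOm hC hCi hM0 hbound _ hs h0 ht).
  by rewrite -/(compliance Om Ci s t) /c; ring.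
have step_ex m s0 : (1 <= m <= N)%N -> Sigma_h k s0 -> exists sv, step m s0 sv.1 sv.2.
  move=> /andP[_ mN] hs0.
  have [||s [v h]] := step_solvable dec oOm bOm n0 hk hC hCi hM0 hbound c0
    (L1 := fun t => dt^-1 * compliance Om Ci s0 t) (L2 := load m).
  - move=> a s t hs ht; rewrite (compliance_linr oOm bOm hC hCi hM0 hbound _ hs0 hs ht); ring.
  - by move=> a v w; apply: load_lin => //; exact: (load_square_integrable hT hf mN hN).
  - by exists (s, v).
(* A solver for all inputs at once, admissible or not, so that the solution can be defined by plain
   recursion and its membership in [Sigma_h] proved afterwards. *)
have /choice[g hg] : forall p : nat * broken_tensor Th, exists sv,
    (1 <= p.1 <= N)%N -> Sigma_h k p.2 -> step p.1 p.2 sv.1 sv.2.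
  move=> [m s0]; have [h|h] := pselect ((1 <= m <= N)%N /\ Sigma_h k s0).
    by have [sv hsv] := step_ex m s0 h.1 h.2; exists sv.
  by exists (zero_tensor Th, zero_vec Th) => h1 h2; case: h.
have hQ : Sigma_h k (@Qk0 R n.+1 Th k psi0) := Qk0_Sigma_h k dec hOm hpsi0.
pose sigma := fix sigma m := if m is m'.+1 then (g (m, sigma m')).1 else @Qk0 R n.+1 Th k psi0.
(* The scheme does not constrain [v 0], which is filled with zero. *)
pose v m := if m is m'.+1 then (g (m, sigma m')).2 else zero_vec Th.
have sigmaS m : (m <= N)%N -> Sigma_h k (sigma m).
  elim: m => // m IH mN; have [] // := hg (m.+1, sigma m) mN.
  exact: IH (ltnW mN).
have stepP m : (m < N)%N -> step m.+1 (sigma m) (sigma m.+1) (v m.+1).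
  by move=> mN; exact: (hg (m.+1, sigma m) mN (sigmaS m (ltnW mN))).
exists sigma, v; split.
  split=> // -[//|m] mN; have [h1 h2 h3 h4] := stepP m mN; split=> // t ht.
  by rewrite schemeE//; [rewrite h3// subrr|exact: sigmaS (ltnW mN)].
move=> s' v' [s'0 hs'].
(* The stress of the previous step is the datum of the next, so the induction starts at 0, where
   only the stress is determined. *)
have main m : (m <= N)%N -> s' m = sigma m /\ ((0 < m)%N -> v' m = v m).
  elim: m => [|m IH] mN; first by rewrite s'0.
  have [IHs _] := IH (ltnW mN).
  have [h1 h2 h3 h4] := stepP m mN; have [e1 e2 e3 e4] := hs' m.+1 mN.
  have [] := step_unique dec oOm bOm n0 hk hC hCi hM0 hbound c0 e1 h1 e2 h2 _ h3 e4 h4; last by [].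
  move=> t ht; have := e3 t ht; rewrite -[m.+1.-1]/m IHs schemeE//; last exact: sigmaS (ltnW mN).
  by move=> /eqP; rewrite subr_eq0 => /eqP.
move=> m /andP[m1 mN]; have [hs hv] := main m mN; split=> //; exact: hv.
Qed.
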